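(* Let $P$ be a simple closed $n$-gon in $\mathbb{R}^2$. (i) If $n\ge4$ and $a,b\in\mathrm{int}P$, then there are vertices $a',b'$ of $P$ such that $]a,a'[\subset\mathrm{int}P$, $]b,b'[\subset\mathrm{int}P$, and $a',b'$ are at most $\lfloor n/2\rfloor-2$ edges apart on $P$. (ii) If $n\ge5$ and $a,b\in\mathrm{ext}P$, then either there are vertices $a',b'$ of $P$ such that $]a,a'[\subset\mathrm{ext}P$, $]b,b'[\subset\mathrm{ext}P$, and $a',b'$ are at most $\lceil n/2\rceil-2$ edges apart on $P$, or $\pi_{\mathrm{ext}P}(a,b)\le3$.
   Context: A simple closed $n$-gon is $P=\bigcup_{i=1}^n[p_{i-1},p_i]$ with distinct vertices $p_0,\dots,p_{n-1}$, $p_n=p_0$, whose edges meet only in common endpoints of consecutive edges. $\mathrm{int}P$ and $\mathrm{ext}P$ are the bounded and unbounded components of $\mathbb{R}^2\setminus P$. $]x,y[$ denotes the open segment. Two vertices $a',b'$ are at most $k$ edges apart on $P$ if one of the two arcs of $P$ between them (a single point if $a'=b'$) consists of at most $k$ edges of $P$. For $S\subset\mathbb{R}^2$, $\pi_S(a,b)$ is the smallest number of edges of a polygonal path connecting $a$ to $b$ within $S$. *)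

(* Defs.v *)
From HB Require Import structures.
From mathcomp Require Import all_boot all_order all_algebra.
From mathcomp Require Import all_classical all_reals all_analysis.
Set Implicit Arguments. Unset Strict Implicit. Unset Printing Implicit Defensive.
Import Order.TTheory GRing.Theory Num.Theory.
Local Open Scope classical_set_scope.
Local Open Scope ring_scope.
Import numFieldNormedType.Exports.

Notation pt R := (R * R)%type.
Section Polygons.
Variable R : realType.
Local Notation pt := (R * R)%type.

Definition lerp (x y : pt) (t : R) : pt :=
  ((1 - t) * x.1 + t * y.1, (1 - t) * x.2 + t * y.2).

Definition cseg (x y : pt) : set pt := [set z | exists2 t, 0 <= t <= 1 & z = lerp x y t].
Definition oseg (x y : pt) : set pt := [set z | exists2 t, 0 < t < 1 & z = lerp x y t].

Definition succ_idx (n : nat) (i : 'I_n) : 'I_n :=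
  match n as m return 'I_m -> 'I_m with
  | 0 => fun i => i
  | m.+1 => fun i => inord ((i.+1) %% m.+1)
  end i.

Definition edge (n : nat) (p : 'I_n -> pt) (i : 'I_n) : set pt :=
  cseg (p i) (p (succ_idx i)).

Definition polygon (n : nat) (p : 'I_n -> pt) : set pt :=
  \bigcup_(i in [set: 'I_n]) edge p i.

Definition simple_polygon (n : nat) (p : 'I_n -> pt) : Prop :=
  (3 <= n)%N /\ injective p /\
  forall i j : 'I_n, i != j -> forall x, edge p i x -> edge p j x ->
    (j = succ_idx i /\ x = p (succ_idx i)) \/ (i = succ_idx j /\ x = p (succ_idx j)).

Definition bounded_set (A : set pt) : Prop :=
  exists M : R, forall z, A z -> `|z.1| <= M /\ `|z.2| <= M.

Definition int_poly (n : nat) (p : 'I_n -> pt) : set pt :=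
  [set x | ~ polygon p x /\ bounded_set (@connected_component (R * R)%type (~` polygon p) x)].
Definition ext_poly (n : nat) (p : 'I_n -> pt) : set pt :=
  [set x | ~ polygon p x /\ ~ bounded_set (@connected_component (R * R)%type (~` polygon p) x)].

(* p i and p j are at most k edges apart: one of the two arcs between them
   has at most k edges (arcs have d and n - d edges, d = (i - j) mod n) *)
Definition edges_apart_le (n : nat) (i j : 'I_n) (k : nat) : Prop :=
  let d := ((i + n - j) %% n)%N in (minn d (n - d) <= k)%N.

Fixpoint poly_path_in (S : set pt) (a : pt) (s : seq pt) : Prop :=
  match s with
  | [::] => True
  | q :: s' => cseg a q `<=` S /\ poly_path_in S q s'
  end.

Definition link_dist_le (S : set pt) (a b : pt) (k : nat) : Prop :=
  exists s : seq pt, (size s <= k)%N /\ last a s = b /\ poly_path_in S a s.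

End Polygons.

(* Main.v *)
Require Import Defs.
From HB Require Import structures.
From mathcomp Require Import all_boot all_order all_algebra.
From mathcomp Require Import all_classical all_reals all_analysis.
From mathcomp Require Import ring lra zify.
Set Implicit Arguments. Unset Strict Implicit. Unset Printing Implicit Defensive.
Import Order.TTheory GRing.Theory Num.Theory.
Import numFieldNormedType.Exports.
Local Open Scope classical_set_scope.
Local Open Scope ring_scope.

(** After a shear the vertices of P have distinct abscissae; the sides of a
    polygon are then told apart by the parity of the number of edges above a
    point.  A chord [c, d] avoiding P cuts it into polygons P1 and P2 whose
    parities add up to that of P.  A vertex extreme in the direction normal to
    the chord shows that one arc of P has even parity for the polygon formed by
    the other arc and the chord.  Hence a chord in the odd side of P cuts this
    side in two, while a chord in the even side cuts off a pocket.

    Polygons with at least four vertices have chords in their odd side (look at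
    the leftmost vertex), so by induction a point of the odd side sees the three
    vertices of a triangle, and the triples of two such points either share a
    vertex or are separated by a chord.  A point of the even side either lies in
    a pocket under a lid of the convex hull or is strictly separated from P by
    a line; in the latter case it sees two vertices, and two such points are
    joined by two segments.  Two separated triples leave n - 4 edges for the two
    arcs between them, a triple and a pair leave n - 3, and the shorter arc
    takes at most half of them. *)

(** * Cyclic edge lists and crossing parity *)

(** [int_poly] and [ext_poly] speak of components, and nothing is known beforehand about how many
    components there are. The geometric work therefore uses only the parity sides. The comparison
    comes late: an even point can be led arbitrarily far away, so a bounded component is odd; a
    component that leaves a box around the vertices has a point separated from the polygon by a
    line, so it is even. A segment of sight off the polygon stays in the component of its origin,
    which turns visibility for the parity sides into visibility in [int_poly] or [ext_poly]. The
    obstacle in cutting is that the two polygons beside a chord might overlap. Adding parities alone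
    does not exclude this. Connectedness of the odd side of the smaller polygons does: it carries
    the parity for one part, unchanged, from the chord to the far arc of the other part.
    Connectedness of odd sides is thus proved by the same induction that cuts the polygon, before
    visibility is treated. *)

Lemma uniq_map_inj (T U : eqType) (f : T -> U) (s : seq T) x y :
  uniq (map f s) -> x \in s -> y \in s -> f x = f y -> x = y.
Proof.
elim: s => //= a s IH /andP[na us]; rewrite !inE => /orP[/eqP->|xs] /orP[/eqP->|ys] // fe.
- by move: na; rewrite fe map_f.
- by move: na; rewrite -fe map_f.
- exact: IH.
Qed.

Section Lists.
Variable T : eqType.
Implicit Types (c d z : T) (s A B Q : seq T).

(** Both ends are explicit, so that cutting a closed polygon at two vertices gives a concatenation
    of two open paths. *)
Fixpoint path_edges c s d : seq (T * T) :=
  if s is x :: s' then (c, x) :: path_edges x s' d else [:: (c, d)].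

Definition edges Q : seq (T * T) := if Q is c :: s then path_edges c s c else [::].

Lemma pe_cat c A d B z : path_edges c (A ++ d :: B) z = path_edges c A d ++ path_edges d B z.
Proof. by elim: A c => //= a A IH c; rewrite IH. Qed.

Lemma edges_split c A d B : edges (c :: A ++ d :: B) = path_edges c A d ++ path_edges d B c.
Proof. exact: pe_cat. Qed.

Lemma edges_chord c A d : edges (c :: A ++ [:: d]) = path_edges c A d ++ [:: (d, c)].
Proof. exact: pe_cat. Qed.

Lemma edges_catC A B : perm_eq (edges (A ++ B)) (edges (B ++ A)).
Proof.
case: A B => [|a A] [|b B]; rewrite ?cats0 //=.
by rewrite !pe_cat perm_catC.
Qed.

Lemma mem_pe1 c s d e : e \in path_edges c s d -> e.1 \in c :: s.
Proof.
elim: s c => [|x s IH] c /=; first by rewrite !inE => /eqP -> /=.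
rewrite inE => /orP[/eqP-> /=|/IH]; first by rewrite inE eqxx.
by move=> ->; rewrite orbT.
Qed.

Lemma mem_pe2 c s d e : e \in path_edges c s d -> e.2 \in s ++ [:: d].
Proof.
elim: s c => [|x s IH] c /=; first by rewrite !inE => /eqP -> /=.
rewrite !inE => /orP[/eqP-> /=|/IH ->]; by rewrite ?eqxx ?orbT.
Qed.

Lemma map_fst_pe c s d : [seq e.1 | e <- path_edges c s d] = c :: s.
Proof. by elim: s c => //= x s IH c; rewrite IH. Qed.

Lemma map_snd_pe c s d : [seq e.2 | e <- path_edges c s d] = s ++ [:: d].
Proof. by elim: s c => //= x s IH c; rewrite IH. Qed.

Lemma map_fst_edges Q : [seq e.1 | e <- edges Q] = Q.
Proof. by case: Q => // c s; rewrite /= map_fst_pe. Qed.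

Lemma perm_map_snd_edges Q : perm_eq [seq e.2 | e <- edges Q] Q.
Proof. by case: Q => // c s; rewrite /= map_snd_pe perm_catC. Qed.

Lemma edge_src Q e : e \in edges Q -> e.1 \in Q.
Proof. by move=> h; rewrite -(map_fst_edges Q) map_f. Qed.

Lemma edge_tgt Q e : e \in edges Q -> e.2 \in Q.
Proof. by move=> h; rewrite -(perm_mem (perm_map_snd_edges Q)) map_f. Qed.

Lemma edge_from Q z : z \in Q -> exists y, (z, y) \in edges Q.
Proof.
rewrite -{1}(map_fst_edges Q) => /mapP[[a b] h ->]; by exists b.
Qed.

Lemma edge_to Q z : z \in Q -> exists y, (y, z) \in edges Q.
Proof.
rewrite -(perm_mem (perm_map_snd_edges Q)) => /mapP[[a b] h ->]; by exists a.
Qed.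

Lemma edge_src_inj Q e e' : uniq Q -> e \in edges Q -> e' \in edges Q ->
  e.1 = e'.1 -> e = e'.
Proof. by move=> u h h'; apply: (uniq_map_inj (f := @fst T T) _ h h'); rewrite map_fst_edges. Qed.

Lemma edge_tgt_inj Q e e' : uniq Q -> e \in edges Q -> e' \in edges Q ->
  e.2 = e'.2 -> e = e'.
Proof.
by move=> u h h'; apply: (uniq_map_inj (f := @snd T T) _ h h'); rewrite (perm_uniq (perm_map_snd_edges Q)).
Qed.

Lemma mem_split2 Q c d : c \in Q -> d \in Q -> c != d ->
  exists X A Y, Q = X ++ c :: A ++ d :: Y \/ Q = X ++ d :: A ++ c :: Y.
Proof.
move=> cQ; case/splitPr: cQ => X Y; rewrite mem_cat inE => h cd.
have {h} : (d \in X) || (d \in Y) by move: h; rewrite eq_sym (negPf cd).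
case/orP=> h; case/splitPr: h => Z W.
  by exists Z, W, Y; right; rewrite -catA.
by exists X, Z, W; left.
Qed.

(** A telescoping sum modulo 2. Around a cycle it vanishes, which makes the parity constant off the
    polygon. *)
Lemma big_pe (F : T -> bool) c s d :
  \big[addb/false]_(e <- path_edges c s d) (F e.1 (+) F e.2) = F c (+) F d.
Proof.
elim: s c => [|x s IH] c /=; first by rewrite big_seq1.
by rewrite big_cons IH /= addbA addbK.
Qed.

Lemma big_edges (F : T -> bool) Q :
  \big[addb/false]_(e <- edges Q) (F e.1 (+) F e.2) = false.
Proof. by case: Q => [|c s]; rewrite ?big_nil //= big_pe addbb. Qed.

End Lists.

(** * Segments, determinants and crossings of a vertical ray *)

Section Plane.
Variable R : realType.
Local Notation pt := (R * R)%type.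
Implicit Types (x y z s t u v w : pt) (Q A B : seq pt) (e : pt * pt).

Definition det s t x : R :=
  (t.1 - s.1) * (x.2 - s.2) - (t.2 - s.2) * (x.1 - s.1).
Definition dot u x : R := u.1 * x.1 + u.2 * x.2.

Lemma dot_lerp u x y r : dot u (lerp x y r) = (1 - r) * dot u x + r * dot u y.
Proof. rewrite /dot /lerp /=; ring. Qed.

Lemma det_lerp s t x y r : det s t (lerp x y r) = (1 - r) * det s t x + r * det s t y.
Proof. rewrite /det /lerp /=; ring. Qed.

Lemma pt_eq x y : x.1 = y.1 -> x.2 = y.2 -> x = y.
Proof. by case: x y => a b [a' b'] /= -> ->. Qed.

Lemma lerp0 x y : lerp x y 0 = x.
Proof. by apply: pt_eq; rewrite /lerp /=; ring. Qed.
Lemma lerp1 x y : lerp x y 1 = y.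
Proof. by apply: pt_eq; rewrite /lerp /=; ring. Qed.
Lemma lerpC x y r : lerp x y r = lerp y x (1 - r).
Proof. by apply: pt_eq; rewrite /lerp /=; ring. Qed.
Lemma lerp_lerp x y r q : lerp x (lerp x y r) q = lerp x y (q * r).
Proof. by apply: pt_eq; rewrite /lerp /=; ring. Qed.
Lemma lerp_lerp2 x y a b q : lerp (lerp x y a) (lerp x y b) q = lerp x y ((1 - q) * a + q * b).
Proof. by apply: pt_eq; rewrite /lerp /=; ring. Qed.

Lemma csegC x y : cseg x y = cseg y x.
Proof.
apply/seteqP; split=> z [r hr ->]; exists (1 - r); rewrite -?lerpC //; lra.
Qed.
Lemma osegC x y : oseg x y = oseg y x.
Proof.
apply/seteqP; split=> z [r hr ->]; exists (1 - r); rewrite -?lerpC //; lra.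
Qed.
Lemma cseg_l x y : cseg x y x.
Proof. by exists 0; rewrite ?lerp0 //; lra. Qed.
Lemma cseg_r x y : cseg x y y.
Proof. by exists 1; rewrite ?lerp1 //; lra. Qed.
Lemma oseg_cseg x y z : oseg x y z -> cseg x y z.
Proof. by case=> r hr ->; exists r => //; lra. Qed.
Lemma cseg_cases x y z : cseg x y z -> [\/ z = x, z = y | oseg x y z].
Proof.
case=> r hr ->.
case: (eqVneq r 0) => [->|r0]; first by apply: Or31; rewrite lerp0.
case: (eqVneq r 1) => [->|r1]; first by apply: Or32; rewrite lerp1.
apply: Or33; exists r => //; rewrite !lt_neqAle eq_sym r0 r1 /=; lra.
Qed.
Lemma cseg_sub x y a b : cseg x y a -> cseg x y b -> cseg a b `<=` cseg x y.
Proof.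
case=> p hp -> [q hq ->] z [r hr ->]; rewrite lerp_lerp2.
by exists ((1 - r) * p + r * q) => //; nra.
Qed.

(** The vertical ray going up from [x] meets [e]. The test on abscissae is half-open, so that a
    vertex above [x] is treated consistently by its two edges; the product is negative when [x] is
    below the line of [e], whatever the orientation of [e]. *)
Definition crosses e x : bool :=
  ((e.1.1 <= x.1) != (e.2.1 <= x.1)) && (det e.1 e.2 x * (e.2.1 - e.1.1) < 0).

Lemma chiC s t x : crosses (s, t) x = crosses (t, s) x.
Proof.
rewrite /crosses /= eq_sym; congr (_ && (_ < _)); rewrite /det; ring.
Qed.

Definition parity Q x : bool := \big[addb/false]_(e <- edges Q) crosses e x.
Definition on Q x : Prop := exists2 e, e \in edges Q & cseg e.1 e.2 x.
Definition odd_side Q x : Prop := ~ on Q x /\ parity Q x.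
Definition even_side Q x : Prop := ~ on Q x /\ ~~ parity Q x.

(* The second clause is the general position reached by the shear. *)
Definition simple_cycle Q : Prop := [/\ (2 < size Q)%N, uniq [seq z.1 | z <- Q] &
  forall e e', e \in edges Q -> e' \in edges Q -> e != e' ->
  forall z, cseg e.1 e.2 z -> cseg e'.1 e'.2 z ->
  (z = e.1 \/ z = e.2) /\ (z = e'.1 \/ z = e'.2)].

(* The half-open convention makes the vertical half-strip above [x, y] crossed
   by [s, t] through its two vertical sides as often, mod 2, as s and t lie on
   different sides of its boundary. *)
Definition strip x y s : bool :=
  ((s.1 <= x.1) != (s.1 <= y.1)) && (0 < det x y s * (y.1 - x.1)).

Definition btw (a b c : R) : Prop := (a <= c <= b) \/ (b <= c <= a).

Lemma range_btw (a b c : R) : (a <= c) != (b <= c) -> btw a b c.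
Proof.
by rewrite /btw; case: (leP a c) => h1; case: (leP b c) => h2 //= _;
  [left | right]; lra.
Qed.
Lemma range_btw2 (a b c : R) : (c <= a) != (c <= b) -> btw a b c.
Proof.
by rewrite /btw; case: (leP c a) => h1; case: (leP c b) => h2 //= _;
  [right | left]; lra.
Qed.

(** The ordinate at abscissa [c] of the line through [s] and [t]. *)
Definition hgt s t (c : R) : R := s.2 + (t.2 - s.2) * (c - s.1) / (t.1 - s.1).

Lemma hgt_cseg s t c : s.1 != t.1 -> btw s.1 t.1 c -> cseg s t (c, hgt s t c).
Proof.
move=> st h; have st' : t.1 - s.1 != 0 by rewrite subr_eq0 eq_sym.
exists ((c - s.1) / (t.1 - s.1)).
  case: h => h.
    have p : 0 < t.1 - s.1 by rewrite lt_def st'; lra.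
    by rewrite divr_ge0 ?ler_pdivrMr //; lra.
  have p : 0 < s.1 - t.1 by rewrite lt_def subr_eq0 st; lra.
  have -> : (c - s.1) / (t.1 - s.1) = (s.1 - c) / (s.1 - t.1).
    by field; rewrite st' subr_eq0 st.
  by rewrite divr_ge0 ?ler_pdivrMr //; lra.
by apply: pt_eq; rewrite /lerp /hgt /=; field.
Qed.

Lemma det_hgt s t x : s.1 != t.1 ->
  det s t x * (t.1 - s.1) = (t.1 - s.1) ^+ 2 * (x.2 - hgt s t x.1).
Proof.
move=> st; have st' : t.1 - s.1 != 0 by rewrite subr_eq0 eq_sym.
by rewrite /det /hgt; field.
Qed.

Lemma below_hgt s t x : s.1 != t.1 ->
  (det s t x * (t.1 - s.1) < 0) = (x.2 < hgt s t x.1).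
Proof.
move=> st; have st' : t.1 - s.1 != 0 by rewrite subr_eq0 eq_sym.
by rewrite det_hgt // pmulr_rlt0 ?subr_lt0 // exprn_even_gt0.
Qed.
Lemma above_hgt s t x : s.1 != t.1 ->
  (0 < det s t x * (t.1 - s.1)) = (hgt s t x.1 < x.2).
Proof.
move=> st; have st' : t.1 - s.1 != 0 by rewrite subr_eq0 eq_sym.
by rewrite det_hgt // pmulr_rgt0 ?subr_gt0 // exprn_even_gt0.
Qed.

Lemma hgt_l s t : hgt s t s.1 = s.2.
Proof. rewrite /hgt; ring. Qed.
Lemma hgt_r s t : s.1 != t.1 -> hgt s t t.1 = t.2.
Proof.
move=> st; have st' : t.1 - s.1 != 0 by rewrite subr_eq0 eq_sym.
by rewrite /hgt; field.
Qed.
Lemma hgt_lin s t (a b r : R) :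
  hgt s t ((1 - r) * a + r * b) = (1 - r) * hgt s t a + r * hgt s t b.
Proof. rewrite /hgt; ring. Qed.

Lemma btw_mix (a b c d r : R) : btw a b c -> btw a b d -> 0 <= r <= 1 ->
  btw a b ((1 - r) * c + r * d).
Proof.
by rewrite /btw => -[h|h] [h'|h'] hr; [left|left|left|right]; nra.
Qed.

(** Over their common range of abscissae the two segments never have equal height, so which one is
    above is a single boolean. All four tests share it, and what remains is an identity between four
    comparisons of abscissae. *)
Lemma chi_cross s t x y : s.1 != t.1 ->
  (forall z, cseg s t z -> cseg x y z -> False) ->
  crosses (s, t) x (+) crosses (s, t) y = strip x y s (+) strip x y t.
Proof.
move=> st no.
(* A vertical [[x, y]] has empty strips; if only one of its ends were below the edge, the edge would
   meet it. *)
have [xy|xy] := eqVneq x.1 y.1.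
  rewrite /strip xy !eqxx /= /crosses /= xy.
  case: (boolP (_ != _)) => //= /range_btw h.
  rewrite !below_hgt // xy.
  have hs := hgt_cseg st h.
  case: (ltP x.2 _) => hx; case: (ltP y.2 _) => hy //=.
    exfalso; apply: (no _ hs).
    rewrite csegC.
    have p : 0 < y.2 - x.2 by lra.
    exists ((y.2 - hgt s t y.1) / (y.2 - x.2)).
      by rewrite divr_ge0 ?ler_pdivrMr //=; lra.
    apply: pt_eq; rewrite /lerp /= ?xy; first ring.
    field; lra.
  exfalso; apply: (no _ hs).
  have p : 0 < x.2 - y.2 by lra.
  exists ((x.2 - hgt s t y.1) / (x.2 - y.2)).
    by rewrite divr_ge0 ?ler_pdivrMr //=; lra.
  apply: pt_eq; rewrite /lerp /= ?xy; first ring.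
  field; lra.
rewrite /crosses /strip /= !below_hgt // !above_hgt //.
pose I c := btw s.1 t.1 c /\ btw x.1 y.1 c.
pose g c := hgt s t c - hgt x y c.
(* A change of sign of [g] would give a common point, at the zero of [g] found by linear
   interpolation. *)
have key c c' : I c -> I c' -> 0 < g c -> g c' <= 0 -> False.
  move=> [i1 i2] [j1 j2] gc gc'.
  pose r := g c / (g c - g c').
  have p : 0 < g c - g c' by lra.
  have hr : 0 <= r <= 1.
    by rewrite /r divr_ge0 ?ler_pdivrMr //=; lra.
  pose c2 := (1 - r) * c + r * c'.
  have e : hgt s t c2 = hgt x y c2.
    apply/eqP; rewrite -subr_eq0; apply/eqP; rewrite /c2 !hgt_lin.
    have -> : forall a b a' b' : R, (1 - r) * a + r * b - ((1 - r) * a' + r * b')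
       = (1 - r) * (a - a') + r * (b - b') by move=> *; ring.
    rewrite -/(g c) -/(g c') /r; field; lra.
  apply: (no (c2, hgt s t c2)); first by apply: hgt_cseg => //; apply: btw_mix.
  by rewrite e; apply: hgt_cseg => //; apply: btw_mix.
have ax : btw x.1 y.1 x.1 by rewrite /btw; case: (leP x.1 y.1); [left|right]; lra.
have ay : btw x.1 y.1 y.1 by rewrite /btw; case: (leP x.1 y.1); [left|right]; lra.
have bs : btw s.1 t.1 s.1 by rewrite /btw; case: (leP s.1 t.1); [left|right]; lra.
have bt : btw s.1 t.1 t.1 by rewrite /btw; case: (leP s.1 t.1); [left|right]; lra.
(* If the common range is empty, [sg] is [false] by default; then all four tests on abscissae fail
   anyway. *)
have [sg hsg] : exists sg : bool, forall c, I c -> (0 < g c) = sg.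
  have [[c [ic gc]]|n] := pselect (exists c, I c /\ 0 < g c).
    exists true => c' ic'; apply/negP => /negP; rewrite -leNgt => h.
    exact: (key c c').
  exists false => c ic; apply/negP => h; apply: n; by exists c.
have gx : (x.2 < hgt s t x.1) = (0 < g x.1) by rewrite /g hgt_l subr_gt0.
have gy : (y.2 < hgt s t y.1) = (0 < g y.1) by rewrite /g hgt_r // subr_gt0.
have gs : (hgt x y s.1 < s.2) = (0 < g s.1) by rewrite /g hgt_l subr_gt0.
have gt : (hgt x y t.1 < t.2) = (0 < g t.1) by rewrite /g hgt_r // subr_gt0.
have H1 : ((s.1 <= x.1) != (t.1 <= x.1)) && (x.2 < hgt s t x.1) =
          ((s.1 <= x.1) != (t.1 <= x.1)) && sg.
  by case: (boolP (_ != _)) => //= /range_btw h; rewrite gx; apply: hsg.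
have H2 : ((s.1 <= y.1) != (t.1 <= y.1)) && (y.2 < hgt s t y.1) =
          ((s.1 <= y.1) != (t.1 <= y.1)) && sg.
  by case: (boolP (_ != _)) => //= /range_btw h; rewrite gy; apply: hsg.
have H3 : ((s.1 <= x.1) != (s.1 <= y.1)) && (hgt x y s.1 < s.2) =
          ((s.1 <= x.1) != (s.1 <= y.1)) && sg.
  by case: (boolP (_ != _)) => //= /range_btw2 h; rewrite gs; apply: hsg.
have H4 : ((t.1 <= x.1) != (t.1 <= y.1)) && (hgt x y t.1 < t.2) =
          ((t.1 <= x.1) != (t.1 <= y.1)) && sg.
  by case: (boolP (_ != _)) => //= /range_btw2 h; rewrite gt; apply: hsg.
rewrite H1 H2 H3 H4.
by do 4 case: (_ <= _); case: sg {hsg H1 H2 H3 H4}.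
Qed.

End Plane.

(** * Parity is constant off the polygon *)

Lemma head_split (T : eqType) (Q : seq T) z : z \in Q -> exists X Y, Q = X ++ z :: Y.
Proof. by case/splitPr => X Y; exists X, Y. Qed.

Lemma mem_edges_catC (T : eqType) (X Y : seq T) e :
  (e \in edges (X ++ Y)) = (e \in edges (Y ++ X)).
Proof. exact: perm_mem (edges_catC X Y) e. Qed.

(** A rotation brings the source of the edge to the head of the list, where its successor can be
    read off. [edge_asym] and [edge_no_triangle] use the same device. *)
Lemma edge_neq (T : eqType) (Q : seq T) e : uniq Q -> (1 < size Q)%N -> e \in edges Q ->
  e.1 != e.2.
Proof.
move=> u sz he; have [X [Y E]] := head_split (edge_src he).
have he' : e \in edges ((e.1 :: Y) ++ X) by rewrite mem_edges_catC -E.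
have u' : uniq (e.1 :: (Y ++ X)) by rewrite -cat_cons uniq_catC -E.
have sz' : (0 < size (Y ++ X))%N by move: sz; rewrite E !size_cat /= addnS addnC.
rewrite cat_cons in he'; case: (Y ++ X) u' he' sz' => // b Z u' he' _.
have := edge_src_inj u' he' (e' := (e.1, b)).
rewrite /= inE eqxx => /(_ isT erefl) ->.
by move: u'; rewrite /= inE negb_or => /andP[/andP[]].
Qed.

Lemma edge_asym (T : eqType) (Q : seq T) a b : uniq Q -> (2 < size Q)%N -> (a, b) \in edges Q ->
  (b, a) \notin edges Q.
Proof.
move=> u sz he; apply/negP => he2; have [X [Y E]] := head_split (edge_src he).
rewrite E mem_edges_catC /= in he; rewrite E mem_edges_catC /= in he2.
have u' : uniq (a :: (Y ++ X)) by rewrite -cat_cons uniq_catC -E.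
have sz' : (1 < size (Y ++ X))%N.
  by move: sz; rewrite E !size_cat /= addnS addnC.
case: (Y ++ X) u' he he2 sz' => [//|b' [//|c Z]] u' he he2 _.
have := edge_src_inj u' he (e' := (a, b')).
rewrite /= inE eqxx => /(_ isT erefl) [bb]; subst b'.
have := edge_src_inj u' he2 (e' := (b, c)).
rewrite /= !inE eqxx orbT => /(_ isT erefl) [ac].
by move: u'; rewrite ac /= !inE eqxx orbT.
Qed.

Section Parity.
Variable R : realType.
Local Notation pt := (R * R)%type.
Implicit Types (x y z s t u v w : pt) (Q A B : seq pt) (e : pt * pt).

Lemma on_catC A B z : on (A ++ B) z <-> on (B ++ A) z.
Proof. by split=> -[e he h]; exists e => //; rewrite mem_edges_catC. Qed.

Lemma par_catC A B z : parity (A ++ B) z = parity (B ++ A) z.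
Proof. exact: perm_big (edges_catC A B). Qed.

Lemma simp_catC A B : simple_cycle (A ++ B) -> simple_cycle (B ++ A).
Proof.
case=> h1 h2 h3; split.
- by rewrite size_cat addnC -size_cat.
- by rewrite map_cat uniq_catC -map_cat.
- by move=> e e' he he'; apply: h3; rewrite mem_edges_catC.
Qed.

Section Simple.
Variable Q : seq pt.
Hypothesis sQ : simple_cycle Q.

Lemma simp_uniq : uniq Q.
Proof. by case: sQ => _ /map_uniq. Qed.

Lemma simp_fst_inj z z' : z \in Q -> z' \in Q -> z.1 = z'.1 -> z = z'.
Proof. case: sQ => _ u _; exact: uniq_map_inj u. Qed.

Lemma simp_nv e : e \in edges Q -> e.1.1 != e.2.1.
Proof.
move=> he; case: sQ => sz _ _.
apply: contra (edge_neq simp_uniq (ltnW sz) he) => /eqP h.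
by apply/eqP/simp_fst_inj => //; [apply: edge_src | apply: edge_tgt].
Qed.

(** The edge leaving [z] also contains [z], so simplicity applies to it and [e]. *)
Lemma vertex_on z e : z \in Q -> e \in edges Q -> cseg e.1 e.2 z -> z = e.1 \/ z = e.2.
Proof.
move=> zQ he hz; have [y hy] := edge_from zQ.
have [->|ne] := eqVneq e (z, y); first by left.
have [_ _ h] := sQ.
by case: (h e (z, y) he hy ne z hz (cseg_l _ _)).
Qed.

Lemma vertex_on_Q z : z \in Q -> on Q z.
Proof. by move=> /edge_from[y hy]; exists (z, y) => //; apply: cseg_l. Qed.

End Simple.

(** By [chi_cross] each edge changes the count by the strip tests at its two ends, and these
    telescope around the cycle. *)
Lemma par_seg Q x y : (forall e, e \in edges Q -> e.1.1 != e.2.1) ->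
  (forall z, cseg x y z -> ~ on Q z) -> parity Q x = parity Q y.
Proof.
move=> nv no.
suff : parity Q x (+) parity Q y = false by case: (parity Q x); case: (parity Q y).
rewrite /parity -big_split /=.
rewrite (eq_big_seq (fun e => strip x y e.1 (+) strip x y e.2)) ?big_edges //.
move=> [s t] he; apply: chi_cross; first exact: nv he.
by move=> z z1 z2; apply: (no z z2); exists (s, t).
Qed.

Lemma par_simp Q x y : simple_cycle Q ->
  (forall z, cseg x y z -> ~ on Q z) -> parity Q x = parity Q y.
Proof. move=> sQ; apply: par_seg; exact: simp_nv. Qed.

(** An edge that is not vertical meets the vertical line through [m] at most at one height, and this
    height is not that of [m]; half the distance is safe. *)
Lemma vert_clear (L : seq (pt * pt)) m : (forall e, e \in L -> e.1.1 != e.2.1) ->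
  (forall e, e \in L -> ~ cseg e.1 e.2 m) ->
  exists2 r, 0 < r & forall q, `|q| <= r -> forall e, e \in L -> ~ cseg e.1 e.2 (m.1, m.2 + q).
Proof.
elim: L => [|e L IH] nv no; first by exists 1.
case: IH => [e' h|e' h|r r0 hr]; [by apply: nv; rewrite inE h orbT |
  by apply: no; rewrite inE h orbT |].
have ne := nv e (mem_head _ _); have noe := no e (mem_head _ _).
have hh q : cseg e.1 e.2 (m.1, m.2 + q) -> btw e.1.1 e.2.1 m.1 /\ hgt e.1 e.2 m.1 = m.2 + q.
  case=> t ht [E1 E2]; split.
    by rewrite E1 /btw /=; case: (leP e.1.1 e.2.1) => ?; [left|right]; nra.
  rewrite E1 E2 hgt_lin hgt_l hgt_r //.
have [b|nb] := pselect (btw e.1.1 e.2.1 m.1); last first.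
  exists r => // q hq e'; rewrite inE => /orP[/eqP-> /hh[]//|h]; exact: hr.
have d0 : 0 < `|hgt e.1 e.2 m.1 - m.2|.
  rewrite normr_gt0 subr_eq0; apply/negP => /eqP E; apply: noe.
  by have := hgt_cseg ne b; rewrite E; case: (m).
exists (Num.min r (`|hgt e.1 e.2 m.1 - m.2| / 2)).
  rewrite lt_min r0 /=; lra.
move=> q; rewrite le_min => /andP[q1 q2] e'; rewrite inE => /orP[/eqP-> /hh[_ E]|h].
  by move: q2 d0; rewrite E [m.2 + q]addrC addrK; lra.
exact: hr.
Qed.

Lemma oseg_ends s t m : s.1 != t.1 -> oseg s t m -> m <> s /\ m <> t.
Proof.
move=> st [q hq ->]; have q0 : q != 0 by apply/eqP; lra.
have q1 : 1 - q != 0 by apply/eqP; lra.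
split=> /(congr1 fst) /= E; move/negP: st; apply.
  have : q * (t.1 - s.1) == 0 by apply/eqP; lra.
  by rewrite mulf_eq0 (negPf q0) subr_eq0 eq_sym.
have : (1 - q) * (t.1 - s.1) == 0 by apply/eqP; lra.
by rewrite mulf_eq0 (negPf q1) subr_eq0 eq_sym.
Qed.

(** Two points just below and just above [m] differ in the crossing of [f] alone, hence in parity.
    The extra list [L] keeps the segment between them off a second polygon as well. *)
Lemma edge_sides Q f m (L : seq (pt * pt)) : simple_cycle Q -> f \in edges Q -> oseg f.1 f.2 m ->
  (forall e, e \in L -> e.1.1 != e.2.1) ->
  (forall e, e \in L -> ~ cseg e.1 e.2 m) ->
  exists a b, [/\ odd_side Q a, even_side Q b, cseg a b m,
    forall z, cseg a b z -> z <> m -> ~ on Q z &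
    forall z, cseg a b z -> forall e, e \in L -> ~ cseg e.1 e.2 z].
Proof.
move=> sQ fQ mf nvL noL.
pose L2 := L ++ [seq e <- edges Q | e != f].
have nvf := simp_nv sQ fQ.
have noQ e : e \in edges Q -> e != f -> ~ cseg e.1 e.2 m.
  case: sQ => _ _ h he ef hm.
  have [m1 m2] := oseg_ends nvf mf.
  by case: (h e f he fQ ef m hm (oseg_cseg mf)) => _ [].
have [||r r0 hr] := @vert_clear L2 m.
- move=> e; rewrite mem_cat mem_filter => /orP[/nvL//|/andP[_]]; exact: simp_nv.
- move=> e; rewrite mem_cat mem_filter => /orP[/noL//|/andP[/= ? ?]]; exact: noQ.
pose a := (m.1, m.2 - r); pose b := (m.1, m.2 + r).
have vz z : cseg a b z -> exists2 q, `|q| <= r & z = (m.1, m.2 + q).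
  case=> t ht ->; exists (- r + 2 * t * r); first by rewrite ler_norml; apply/andP; split; nra.
  apply: pt_eq; rewrite /lerp /=; ring.
have noL2 z e : cseg a b z -> e \in L2 -> ~ cseg e.1 e.2 z.
  move=> /vz[q hq ->]; exact: hr.
have mh : m.2 = hgt f.1 f.2 m.1.
  by case: mf => t ht ->; rewrite /lerp /= hgt_lin hgt_l hgt_r.
have off z : cseg a b z -> z <> m -> ~ on Q z.
  move=> hz zm [e he he2]; have [E|ne] := eqVneq e f; last first.
    by apply: (noL2 z e hz) => //; rewrite mem_cat mem_filter /= ne he orbT.
  apply: zm; case: (vz z hz) he2 => q _ -> ; rewrite E => -[t ht [E1 E2]].
  apply: pt_eq => //=; rewrite E2 mh E1 hgt_lin hgt_l hgt_r //.
have cam : cseg a b m.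
  exists (1 / 2); first lra.
  apply: pt_eq; rewrite /lerp /=; lra.
have am : a <> m by move=> /(congr1 snd) /=; lra.
have bm : b <> m by move=> /(congr1 snd) /=; lra.
have offa := off a (cseg_l _ _) am; have offb := off b (cseg_r _ _) bm.
have flip : parity Q a (+) parity Q b.
  rewrite /parity -big_split /= (eq_big_seq (fun e => e == f)).
    rewrite (bigD1_seq f) //=; last first.
      by apply: (@map_uniq _ _ fst); rewrite map_fst_edges; apply: simp_uniq.
    by rewrite eqxx big1 // => e /negPf.
  move=> [s t] he.
  have [E|ne] := eqVneq (s, t) f.
    subst f; rewrite /crosses /= !below_hgt //= -mh.
    have hb : (s.1 <= m.1) != (t.1 <= m.1).
      case: mf => q hq -> /=; case: (ltrP s.1 t.1) => h.
        have -> : s.1 <= (1 - q) * s.1 + q * t.1 by nra.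
        suff -> : (t.1 <= (1 - q) * s.1 + q * t.1) = false by [].
        apply/negbTE; rewrite -ltNge; nra.
      have {}h : t.1 < s.1 by rewrite lt_neqAle eq_sym nvf.
      have -> : t.1 <= (1 - q) * s.1 + q * t.1 by nra.
      suff -> : (s.1 <= (1 - q) * s.1 + q * t.1) = false by [].
      apply/negbTE; rewrite -ltNge; nra.
    rewrite hb /=.
    have -> : m.2 - r < m.2 by lra.
    suff -> : (m.2 + r < m.2) = false by [].
    apply/negbTE; rewrite -leNgt; lra.
  rewrite chi_cross.
  - by rewrite /strip /a /b /= !eqxx.
  - exact: simp_nv he.
  - move=> z h1 h2; apply: (noL2 z (s, t) h2) => //.
    by rewrite mem_cat mem_filter /= ne he orbT.
have LL z : cseg a b z -> forall e, e \in L -> ~ cseg e.1 e.2 z.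
  by move=> hz e he; apply: noL2 => //; rewrite mem_cat he.
case pa : (parity Q a) flip => /= pb.
  by exists a, b; split.
exists b, a; split => //; rewrite ?[cseg b a]csegC //.
by split=> //; rewrite pa.
Qed.

(** Strict separation by a line normal to [u]. Asking it of the vertices gives it for the edges and
    makes it pass to sublists. *)
Definition outer x Q := exists u, forall z, z \in Q -> dot u x < dot u z.
Definition comb u w (r : R) : pt := (u.1 + r * w.1, u.2 + r * w.2).

Lemma dot_comb u w r x : dot (comb u w r) x = dot u x + r * dot w x.
Proof. rewrite /dot /comb /=; ring. Qed.

Lemma mix_gt (k a b t : R) : 0 <= t <= 1 -> k < a -> k < b -> k < (1 - t) * a + t * b.
Proof. move=> ht ka kb; case: (lerP a b) => h; nra. Qed.

Lemma on_dot_gt u k Q q : (forall z, z \in Q -> k < dot u z) -> on Q q -> k < dot u q.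
Proof.
move=> h [e he [t ht ->]]; rewrite dot_lerp.
by apply: mix_gt => //; [have := h _ (edge_src he) | have := h _ (edge_tgt he)].
Qed.

Lemma outer_off x Q : outer x Q -> ~ on Q x.
Proof. by move=> [u h] /(on_dot_gt h); rewrite ltxx. Qed.

(** Lexicographic minimality in the directions [u], [w] becomes strict minimality in one direction,
    [u] turned slightly towards [w]. *)
Lemma tilt x u w Q :
  (forall z, z \in Q -> dot u x < dot u z \/ (dot u x = dot u z /\ dot w x < dot w z)) ->
  exists2 r, 0 < r & forall q, 0 < q <= r -> forall z, z \in Q ->
    dot (comb u w q) x < dot (comb u w q) z.
Proof.
elim: Q => [|a Q IH] h; first by exists 1.
case: IH => [z hz|r r0 hr]; first by apply: h; rewrite inE hz orbT.
suff [r' r'0 hr'] : exists2 r', 0 < r' & forall q, 0 < q <= r' ->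
    dot (comb u w q) x < dot (comb u w q) a.
  exists (Num.min r r'); first by rewrite lt_min r0.
  move=> q /andP[q0]; rewrite le_min => /andP[q1 q2] z.
  rewrite inE => /orP[/eqP->|hz]; [apply: hr' | apply: hr => //]; apply/andP; split=> //; lra.
case: (h a (mem_head _ _)) => [h1|[h1 h2]]; last first.
  exists 1 => // q hq; rewrite !dot_comb h1; nra.
(* [l] exceeds the possible loss in direction [w] by 1, so a factor of at most [k / l] costs less
   than the gain [k]. *)
pose k := dot u a - dot u x; pose l := `|dot w a - dot w x| + 1.
have k0 : 0 < k by rewrite /k; lra.
have l0 : 0 < l by rewrite /l; have := normr_ge0 (dot w a - dot w x); lra.
exists (k / l); first by rewrite divr_gt0.
move=> q /andP[q0]; rewrite ler_pdivlMr // => ql.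
rewrite !dot_comb.
have := ler_norm (- (dot w a - dot w x)); rewrite normrN => h3.
have : q * (l - 1) < k by nra.
have : q * (dot w x - dot w a) <= q * (l - 1) by rewrite ler_pM2l // /l; lra.
rewrite /k; lra.
Qed.

Lemma outer_tilt x u w Q :
  (forall z, z \in Q -> dot u x < dot u z \/ (dot u x = dot u z /\ dot w x < dot w z)) ->
  outer x Q.
Proof.
by move=> /tilt[r r0 h]; exists (comb u w r) => z; apply: h; lra.
Qed.

(** Moving against [u] preserves the separation. A [u] without horizontal part is tilted first,
    since [par_far] needs a large abscissa. *)
Lemma outer_ray x Q M : outer x Q ->
  exists2 y, M < `|y.1| & forall z, cseg x y z -> outer z Q.
Proof.
move=> [u hu].
have [u' u'1 hu'] : exists2 u', u'.1 != 0 & forall z, z \in Q -> dot u' x < dot u' z.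
  have [E|] := eqVneq u.1 0; last by exists u.
  have [|r r0 h] := @tilt x u (1, 0) Q; first by move=> z /hu; left.
  exists (comb u (1, 0) r); first by rewrite /comb /= E; apply/eqP; lra.
  by apply: h; lra.
pose T := (`|M| + `|x.1| + 1) / `|u'.1|.
have u0 : 0 < `|u'.1| by rewrite normr_gt0.
have T0 : 0 <= T by rewrite /T divr_ge0 //; have := normr_ge0 M; have := normr_ge0 x.1; lra.
exists (x.1 - T * u'.1, x.2 - T * u'.2) => /=.
  have h := lerB_dist (T * u'.1) x.1; rewrite distrC in h.
  have : `|T * u'.1| = `|M| + `|x.1| + 1.
    by rewrite normrM (ger0_norm T0) /T divfK // gt_eqF.
  have := ler_norm M; lra.
move=> z [t ht ->]; exists u' => z' /hu'.
apply: le_lt_trans; rewrite dot_lerp /dot /=.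
have : 0 <= T * (u'.1 ^+ 2 + u'.2 ^+ 2) by rewrite mulr_ge0 // addr_ge0 // sqr_ge0.
nra.
Qed.

Lemma bound Q : exists M : R, forall z, z \in Q -> `|z.1| <= M /\ `|z.2| <= M.
Proof.
elim: Q => [|a Q [M h]]; first by exists 0.
exists (Num.max M (Num.max `|a.1| `|a.2|)) => z; rewrite inE !le_max => /orP[/eqP->|/h[-> ->] //].
by rewrite !lexx !orbT.
Qed.

Lemma par_far Q y : (forall z, z \in Q -> `|z.1| < `|y.1|) -> parity Q y = false.
Proof.
move=> h; rewrite /parity big1_seq // => -[s t] /andP[_ he]; rewrite /crosses /=.
have := h _ (edge_src he); have := h _ (edge_tgt he) => /=.
rewrite !ltr_norml => /andP[a b] /andP[c d].
case: (lerP 0 y.1) => y0.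
  rewrite ger0_norm // in a b c d.
  by rewrite (ltW b) (ltW d).
rewrite ltr0_norm // in a b c d.
have -> : (s.1 <= y.1) = false by apply/negbTE; rewrite -ltNge; lra.
by have -> : (t.1 <= y.1) = false by apply/negbTE; rewrite -ltNge; lra.
Qed.

Lemma outer_par x Q : simple_cycle Q -> outer x Q -> parity Q x = false.
Proof.
move=> sQ ox; have [M hM] := bound Q.
have [y hy hz] := outer_ray M ox.
rewrite (par_simp (y := y) sQ); last by move=> z /hz /outer_off.
by apply: par_far => z /hM[h _]; apply: le_lt_trans h hy.
Qed.

Lemma outer_outs x Q : simple_cycle Q -> outer x Q -> even_side Q x.
Proof. by move=> sQ h; split; [apply: outer_off | rewrite outer_par]. Qed.

Lemma argmin (f : pt -> R) Q : Q != [::] -> exists2 v, v \in Q & forall z, z \in Q -> f v <= f z.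
Proof.
elim: Q => // a [|b Q] IH _; first by exists a; rewrite ?mem_head // => z; rewrite inE => /eqP->.
case: (IH isT) => v vQ h; case: (lerP (f a) (f v)) => h1.
  exists a; rewrite ?mem_head // => z; rewrite inE => /orP[/eqP->//|/h]; lra.
exists v; first by rewrite inE vQ orbT.
move=> z; rewrite inE => /orP[/eqP->|/h//]; lra.
Qed.

Lemma simp_size Q : simple_cycle Q -> (2 < size Q)%N.
Proof. by case. Qed.

Lemma simp_nnil Q : simple_cycle Q -> Q != [::].
Proof. by case=> h _ _; case: Q h. Qed.

Lemma leftmost Q : simple_cycle Q ->
  exists2 v, v \in Q & forall z, z \in Q -> z != v -> v.1 < z.1.
Proof.
move=> sQ; have [v vQ h] := argmin fst (simp_nnil sQ).
exists v => // z zQ zv; rewrite lt_neqAle h // andbT.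
by apply: contra zv => /eqP E; apply/eqP; apply: (simp_fst_inj sQ).
Qed.

Lemma corner_aux Q v w u : simple_cycle Q -> (v, w) \in edges Q \/ (w, v) \in edges Q ->
  u \in Q -> u != v -> u != w ->
  v.1 < u.1 -> u.1 <= w.1 -> det v w u != 0.
Proof.
move=> sQ e uQ uv uw h1 h2; apply/eqP => d0.
have p : 0 < w.1 - v.1 by lra.
have : cseg v w u.
  exists ((u.1 - v.1) / (w.1 - v.1)).
    by rewrite divr_ge0 ?ler_pdivrMr //=; lra.
  apply: pt_eq; rewrite /lerp /=; first by field; lra.
  move: d0; rewrite /det => /eqP; rewrite subr_eq0 => /eqP d0.
  have -> : u.2 = v.2 + (w.2 - v.2) * (u.1 - v.1) / (w.1 - v.1).
    by rewrite -d0; field; lra.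
  by field; lra.
case: e => e h.
  by case: (vertex_on sQ uQ e h) => /= /eqP; rewrite ?(negPf uv) ?(negPf uw).
rewrite csegC in h.
by case: (vertex_on sQ uQ e h) => /= /eqP; rewrite ?(negPf uv) ?(negPf uw).
Qed.

(** If the three were collinear, the neighbour of [v] with the smaller abscissa would lie on the
    edge from [v] to the other one. *)
Lemma corner Q u v w : simple_cycle Q -> (u, v) \in edges Q -> (v, w) \in edges Q ->
  (forall z, z \in Q -> z != v -> v.1 < z.1) -> det v w u != 0.
Proof.
move=> sQ e1 e2 h; have [sz _ _] := sQ; have uq := simp_uniq sQ.
have uQ := edge_src e1; have wQ := edge_tgt e2; rewrite /= in uQ wQ.
have uv := edge_neq uq (ltnW sz) e1; have vw := edge_neq uq (ltnW sz) e2.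
rewrite /= in uv vw; rewrite eq_sym in vw.
have uw : u != w.
  by apply/eqP => E; subst w; have := edge_asym uq sz e1; rewrite e2.
have hu := h u uQ uv; have hw := h w wQ vw.
case: (lerP u.1 w.1) => c; first by apply: (corner_aux sQ) => //; left.
have -> : det v w u = - det v u w by rewrite /det; ring.
rewrite oppr_eq0; apply: (corner_aux sQ) => //; [by right | by rewrite eq_sym | exact: ltW].
Qed.

(** Otherwise the corner at the leftmost vertex would degenerate: both components of [d - c]
    annihilate its determinant. *)
Lemma noncollinear Q c d : simple_cycle Q -> c != d -> exists2 z, z \in Q & det c d z != 0.
Proof.
move=> sQ cd; have [v vQ h] := leftmost sQ.
have [w e2] := edge_from vQ; have [u e1] := edge_to vQ.
have := corner sQ e1 e2 h => /eqP D.
apply: contrapT => no.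
have z0 z : z \in Q -> det c d z = 0.
  by move=> zQ; apply/eqP/negPn/negP => n; apply: no; exists z.
have := z0 _ (edge_src e1); have := z0 _ (edge_tgt e2); have := z0 _ vQ.
rewrite /det /= => a1 a2 a3.
have b1 : (d.1 - c.1) * (v.2 - c.2) = (d.2 - c.2) * (v.1 - c.1) by lra.
have b2 : (d.1 - c.1) * (w.2 - c.2) = (d.2 - c.2) * (w.1 - c.1) by lra.
have b3 : (d.1 - c.1) * (u.2 - c.2) = (d.2 - c.2) * (u.1 - c.1) by lra.
have k1 : (d.1 - c.1) * det v w u = 0.
  have -> : (d.1 - c.1) * det v w u =
    (w.1 - v.1) * ((d.1 - c.1) * (u.2 - c.2) - (d.1 - c.1) * (v.2 - c.2))
  - ((d.1 - c.1) * (w.2 - c.2) - (d.1 - c.1) * (v.2 - c.2)) * (u.1 - v.1) by rewrite /det; ring.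
  rewrite b1 b2 b3; ring.
have k2 : (d.2 - c.2) * det v w u = 0.
  have -> : (d.2 - c.2) * det v w u =
    ((d.2 - c.2) * (w.1 - c.1) - (d.2 - c.2) * (v.1 - c.1)) * (u.2 - v.2)
  - (w.2 - v.2) * ((d.2 - c.2) * (u.1 - c.1) - (d.2 - c.2) * (v.1 - c.1)) by rewrite /det; ring.
  rewrite -b1 -b2 -b3; ring.
move: k1 k2 => /eqP; rewrite mulf_eq0 => /orP[/eqP k1|/eqP//] /eqP.
rewrite mulf_eq0 => /orP[/eqP k2|/eqP//].
by case/eqP: cd; apply: pt_eq; lra.
Qed.

End Parity.

(** * Interior diagonals *)

Lemma edge_no_triangle (T : eqType) (Q : seq T) a b c : uniq Q -> (3 < size Q)%N ->
  (a, b) \in edges Q -> (b, c) \in edges Q -> (c, a) \notin edges Q.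
Proof.
move=> u sz he; have [X [Y E]] := head_split (edge_src he); rewrite /= in E.
have sw e : (e \in edges Q) = (e \in edges (a :: (Y ++ X))).
  by rewrite E mem_edges_catC.
rewrite !sw in he *.
have u' : uniq (a :: (Y ++ X)) by rewrite -cat_cons uniq_catC -E.
have sz' : (2 < size (Y ++ X))%N.
  by move: sz; rewrite E !size_cat /= addnS addnC.
case: (Y ++ X) u' he sz' => [//|b' [//|c' [//|d Z]]] u' he _ he2.
have [bb] := edge_src_inj u' he (e' := (a, b')) (mem_head _ _) erefl; subst b'.
have h2 : (b, c') \in edges [:: a, b, c', d & Z] by rewrite /= !inE eqxx orbT.
have [cc] := edge_src_inj u' he2 h2 erefl; subst c'.
apply/negP => he3.
have h3 : (c, d) \in edges [:: a, b, c, d & Z] by rewrite /= !inE eqxx !orbT.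
have [ad] := edge_src_inj u' he3 h3 erefl.
by move: u'; rewrite ad /= !inE eqxx !orbT.
Qed.

Lemma big_addb_eq (T : eqType) (r : seq T) f b : uniq r -> f \in r ->
  \big[addb/false]_(e <- r) ((e == f) && b) = b.
Proof.
move=> u fr; rewrite (bigD1_seq f) //= eqxx big1 ?addbF // => e /negPf -> //.
Qed.

Section Diagonals.
Variable R : realType.
Local Notation pt := (R * R)%type.
Implicit Types (x y z s t u v w : pt) (Q A B : seq pt) (e : pt * pt).

Lemma mix_le (k a b t : R) : 0 <= t <= 1 -> a <= k -> b <= k -> (1 - t) * a + t * b <= k.
Proof. move=> ht ka kb; nra. Qed.

Lemma mix_ge (k a b t : R) : 0 <= t <= 1 -> k <= a -> k <= b -> k <= (1 - t) * a + t * b.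
Proof. move=> ht ka kb; nra. Qed.

(** A segment leaving the open positive quadrant does so at the earlier of the zeros of its two
    coordinates. *)
Lemma first_exit (a0 b0 a1 b1 : R) : 0 < a0 -> 0 < b0 -> a1 < 0 \/ b1 < 0 ->
  exists2 q, 0 < q <= 1 &
   ((1 - q) * a0 + q * a1 = 0 /\ 0 <= (1 - q) * b0 + q * b1) \/
   ((1 - q) * b0 + q * b1 = 0 /\ 0 <= (1 - q) * a0 + q * a1).
Proof.
wlog : a0 b0 a1 b1 / a1 < 0.
  move=> H a b [c|c]; first by apply: H => //; left.
  by have [q hq [h|h]] := H b0 a0 b1 a1 c b a (or_introl c); exists q => //; [right|left].
move=> a1n a0p b0p _.
pose q := a0 / (a0 - a1).
have qE : q * (a0 - a1) = a0 by rewrite /q divfK //; apply/eqP; lra.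
have q0 : 0 < q by rewrite /q divr_gt0 //; lra.
have q1 : q <= 1 by rewrite /q ler_pdivrMr; lra.
have [h|h] := lerP 0 ((1 - q) * b0 + q * b1).
  by exists q; [lra | left; split=> //; lra].
have b1n : b1 < 0 by nra.
pose p := b0 / (b0 - b1).
have pE : p * (b0 - b1) = b0 by rewrite /p divfK //; apply/eqP; lra.
have p0 : 0 < p by rewrite /p divr_gt0 //; lra.
have p1 : p <= 1 by rewrite /p ler_pdivrMr; lra.
exists p; first lra.
right; split; first lra.
have : p <= q by nra.
nra.
Qed.

(** * The corner at the leftmost vertex *)

Section Corner.
Variables (Q : seq pt) (u v w : pt).
Hypotheses (sQ : simple_cycle Q) (euv : (u, v) \in edges Q) (evw : (v, w) \in edges Q).
Hypothesis vmin : forall z, z \in Q -> z != v -> v.1 < z.1.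

Let D := det v w u.
(** [al] and [be] are the affine coordinates with origin [v] and unit points [u] and [w]. The
    triangle of the corner is given by [al, be >= 0] and [g <= 1]. *)
Let al z := det v w z / D.
Let be z := det u v z / D.
Let g z := al z + be z.

Let D0 : D != 0. Proof. exact: corner vmin. Qed.
Let uQ : u \in Q := edge_src euv.
Let vQ : v \in Q := edge_src evw.
Let wQ : w \in Q := edge_tgt evw.
Let uniqQ : uniq Q := simp_uniq sQ.
Let sz1 : (1 < size Q)%N. Proof. by case: sQ => /ltnW. Qed.
Let uv : u != v := edge_neq uniqQ sz1 euv.
Let vw : v != w := edge_neq uniqQ sz1 evw.

Let al_lerp x y r : al (lerp x y r) = (1 - r) * al x + r * al y.
Proof. by rewrite /al det_lerp; field. Qed.
Let be_lerp x y r : be (lerp x y r) = (1 - r) * be x + r * be y.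
Proof. by rewrite /be det_lerp; field. Qed.
Let g_lerp x y r : g (lerp x y r) = (1 - r) * g x + r * g y.
Proof. rewrite /g al_lerp be_lerp; ring. Qed.

Let al_u : al u = 1. Proof. by rewrite /al divff. Qed.
Let al_v : al v = 0. Proof. rewrite /al (_ : det v w v = 0) ?mul0r // /det; ring. Qed.
Let al_w : al w = 0. Proof. rewrite /al (_ : det v w w = 0) ?mul0r // /det; ring. Qed.
Let be_u : be u = 0. Proof. rewrite /be (_ : det u v u = 0) ?mul0r // /det; ring. Qed.
Let be_v : be v = 0. Proof. rewrite /be (_ : det u v v = 0) ?mul0r // /det; ring. Qed.
Let be_w : be w = 1.
Proof. by rewrite /be (_ : det u v w = D) ?divff // /D /det; ring. Qed.
Let g_u : g u = 1. Proof. by rewrite /g al_u be_u addr0. Qed.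
Let g_w : g w = 1. Proof. by rewrite /g al_w be_w add0r. Qed.

Let recon z : z = (v.1 + al z * (u.1 - v.1) + be z * (w.1 - v.1),
                   v.2 + al z * (u.2 - v.2) + be z * (w.2 - v.2)).
Proof.
have D1 := D0; rewrite /D /det in D1.
by apply: pt_eq; rewrite /al /be /D /det /=; field.
Qed.

Let on_vw z : al z = 0 -> 0 <= be z <= 1 -> cseg v w z.
Proof.
move=> az bz; exists (be z) => //; rewrite {1}(recon z) az.
apply: pt_eq; rewrite /lerp /=; ring.
Qed.
Let on_uv z : be z = 0 -> 0 <= al z <= 1 -> cseg u v z.
Proof.
move=> bz az; rewrite csegC; exists (al z) => //; rewrite {1}(recon z) bz.
apply: pt_eq; rewrite /lerp /=; ring.
Qed.

(** On its way from [q] to an end [s] outside the cone at [v], the edge leaves the cone where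
    [g < 1], that is, on an edge at [v] short of its far end; simplicity forbids this. *)
Let exit_contra e s q : e \in edges Q -> e.1 != v -> e.2 != v -> s = e.1 \/ s = e.2 ->
  cseg e.1 e.2 q -> 0 < al q -> 0 < be q -> g q <= 1 -> g s < 1 ->
  al s < 0 \/ be s < 0 -> False.
Proof.
move=> he e1 e2 se hq aq bq gq gs out.
have [r hr H] := first_exit aq bq out.
rewrite -!al_lerp -!be_lerp in H.
have hs : cseg e.1 e.2 s by case: se => ->; [apply: cseg_l | apply: cseg_r].
have rE : cseg e.1 e.2 (lerp q s r) by apply: cseg_sub hq hs _ _; exists r => //; lra.
have gr : g (lerp q s r) < 1 by rewrite g_lerp; nra.
have [_ _ simple] := sQ.
have nvw : e != (v, w) by apply: contra e1 => /eqP ->.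
have nuv : e != (u, v) by apply: contra e2 => /eqP ->.
set p := lerp q s r in H rE gr.
case: H => -[H1 H2].
- have pvw : cseg v w p by apply: on_vw => //; rewrite /g in gr; lra.
  case: (simple e (v, w) he evw nvw p rE pvw) => /= h1 [] h2.
    by case: h1 => h1; [move/eqP: e1 | move/eqP: e2]; apply; rewrite -h1.
  by move: gr; rewrite h2 g_w ltxx.
- have pvw : cseg u v p by apply: on_uv => //; rewrite /g in gr; lra.
  case: (simple e (u, v) he euv nuv p rE pvw) => /= h1 [] h2.
    by move: gr; rewrite h2 g_u ltxx.
  by case: h1 => h1; [move/eqP: e1 | move/eqP: e2]; apply; rewrite -h1.
Qed.

Let edge_at_v e q : e \in edges Q -> cseg e.1 e.2 q -> 0 < al q -> 0 < be q ->
  e.1 != v /\ e.2 != v.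
Proof.
move=> he hq aq bq; split; apply/eqP => E.
  have := edge_src_inj uniqQ he evw E => Ee; rewrite Ee /= in hq.
  by case: hq aq => t _ ->; rewrite al_lerp al_v al_w; lra.
have := edge_tgt_inj uniqQ he euv E => Ee; rewrite Ee /= in hq.
by case: hq bq => t _ ->; rewrite be_lerp be_u be_v; lra.
Qed.

(** An edge through the open segment has an end with smaller [g] than [z0]. By minimality of [z0]
    this end lies outside the cone, against [exit_contra]. *)
Let cone_clear z0 : 0 < al z0 -> 0 < be z0 -> g z0 <= 1 ->
  (forall s, s \in Q -> s != v -> 0 <= al s -> 0 <= be s -> g z0 <= g s) ->
  forall q, oseg v z0 q -> ~ on Q q.
Proof.
move=> az bz gz hmin q [r hr qE] [e he hq].
have aq : 0 < al q by rewrite qE al_lerp al_v; nra.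
have bq : 0 < be q by rewrite qE be_lerp be_v; nra.
have gq : g q < g z0 by rewrite qE g_lerp /g al_v be_v; rewrite /g in gz; nra.
have [e1 e2] := edge_at_v he hq aq bq.
have [s se gs] : exists2 s, s = e.1 \/ s = e.2 & g s <= g q.
  case: (lerP (g e.1) (g q)) => h1; first by exists e.1; [left|].
  case: (lerP (g e.2) (g q)) => h2; first by exists e.2; [right|].
  case: hq h1 h2 => t ht ->; rewrite g_lerp => h1 h2; exfalso.
  by have := mix_gt ht h1 h2; rewrite ltxx.
have sQ' : s \in Q by case: se => ->; [apply: edge_src | apply: edge_tgt].
have sv : s != v by case: se => ->.
apply: (exit_contra he e1 e2 se hq) => //; try lra.
case: (ltrP (al s) 0) => ha; first by left.
case: (ltrP (be s) 0) => hb; first by right.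
by have := hmin s sQ' sv ha hb; lra.
Qed.

(** To the left of all vertices but [v], only the two edges at [v] can be crossed, and exactly one
    of them lies above a point of the cone. *)
Let tip z0 : 0 < al z0 -> 0 < be z0 -> exists2 q, oseg v z0 q & parity Q q.
Proof.
move=> az bz.
have u1 : v.1 < u.1 by apply: vmin.
have w1 : v.1 < w.1 by apply: vmin => //; rewrite eq_sym.
have z1 : v.1 < z0.1 by rewrite (recon z0) /=; nra.
have [|x0 x0Q hx0] := @argmin _ fst [seq z <- Q | z != v].
  by apply/eqP => E; have := mem_filter (fun z => z != v) u Q; rewrite E uv uQ.
rewrite mem_filter in x0Q; case/andP: x0Q => x0v x0Q.
have x1 := vmin x0Q x0v.
(* [x0] is the second leftmost vertex. The parameter [k / (2 * (k + l))] is below 1 and small enough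
   for the point to stay to the left of [x0]. *)
pose k := x0.1 - v.1; pose l := z0.1 - v.1.
have kl : 0 < k / (2 * (k + l)) by rewrite divr_gt0 // /k /l; lra.
exists (lerp v z0 (k / (2 * (k + l)))).
  exists (k / (2 * (k + l))) => //; rewrite kl /= ltr_pdivrMr /k /l; lra.
set r := k / _ in kl *; set q := lerp _ _ _.
have rE : r * (2 * (k + l)) = k by rewrite /r divfK //; apply/eqP; rewrite /k /l; lra.
have rl : r * l < k by rewrite /k /l in rE *; nra.
have q1 : v.1 < q.1 by rewrite /q /lerp /=; nra.
have q2 : q.1 < x0.1 by rewrite /q /lerp /=; rewrite /k /l in rl; lra.
have aq : 0 < al q by rewrite al_lerp al_v; nra.
have bq : 0 < be q by rewrite be_lerp be_v; nra.
have lt z : z \in Q -> z != v -> (z.1 <= q.1) = false.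
  move=> zQ zv; apply/negbTE; rewrite -ltNge; apply: lt_le_trans q2 _.
  by apply: hx0; rewrite mem_filter zv.
have ue : uniq (edges Q) by apply: (@map_uniq _ _ fst); rewrite map_fst_edges.
rewrite /parity (eq_big_seq (fun e => ((e == (v, w)) && crosses (v, w) q)
    (+) ((e == (u, v)) && crosses (u, v) q))); last first.
  move=> e he.
  have [-> /=|n1] := eqVneq e (v, w).
    have -> : ((v, w) == (u, v)) = false.
      by apply/negbTE; apply: contra uv => /eqP [<- _].
    by rewrite addbF.
  have [-> //=|n2] := eqVneq e (u, v).
  have e1 : e.1 != v by apply: contra n1 => /eqP E; rewrite (edge_src_inj uniqQ he evw E).
  have e2 : e.2 != v by apply: contra n2 => /eqP E; rewrite (edge_tgt_inj uniqQ he euv E).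
  by rewrite /crosses (lt _ (edge_src he)) // (lt _ (edge_tgt he)).
rewrite big_split /= !big_addb_eq // /crosses /= (ltW q1) !lt // 1?eq_sym //=.
have -> : det v w q = al q * D by rewrite /al divfK.
have -> : det u v q = be q * D by rewrite /be divfK.
case: (ltrP D 0) => hD.
  have -> : al q * D * (w.1 - v.1) < 0.
    by rewrite pmulr_llt0 ?subr_gt0 // pmulr_rlt0.
  suff -> : (be q * D * (v.1 - u.1) < 0) = false by [].
  have : be q * D < 0 by rewrite pmulr_rlt0.
  by move=> h; apply/negbTE; rewrite -leNgt; nra.
have {}hD : 0 < D by rewrite lt_neqAle eq_sym D0.
have -> : be q * D * (v.1 - u.1) < 0.
  by rewrite nmulr_llt0 ?subr_lt0 // mulr_gt0.
suff -> : (al q * D * (w.1 - v.1) < 0) = false by [].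
have : 0 < al q * D by rewrite mulr_gt0.
by move=> h; apply/negbTE; rewrite -leNgt; nra.
Qed.

(** If the triangle of the corner contains further vertices, the one with least [g] is joined to
    [v]; otherwise the third side [u w] is free. *)
Lemma corner_diagonal : (3 < size Q)%N ->
  exists c d, [/\ c \in Q, d \in Q, c != d, ((c, d) \notin edges Q) && ((d, c) \notin edges Q) &
   (forall z, oseg c d z -> ~ on Q z) /\ exists2 m, oseg c d m & parity Q m].
Proof.
move=> sz.
pose M := [seq s <- Q | [&& s != v, s != u, s != w, 0 <= al s, 0 <= be s & g s <= 1]].
have uw : u != w.
  by apply/eqP => E; have := edge_asym uniqQ (ltnW sz) evw; rewrite -E euv.
have [M0|Mn] := eqVneq M [::]; last first.
  have [z zM hz] := argmin g Mn.
  move: zM; rewrite mem_filter => /andP[/andP[zv /and5P[zu zw az bz gz]] zQ].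
  have az' : 0 < al z.
    rewrite lt_neqAle az andbT; apply/eqP => E.
    have : cseg v w z by apply: on_vw => //; rewrite /g -E in gz; lra.
    by case/(vertex_on sQ zQ evw) => /= /eqP; rewrite ?(negPf zv) ?(negPf zw).
  have bz' : 0 < be z.
    rewrite lt_neqAle bz andbT; apply/eqP => E.
    have : cseg u v z by apply: on_uv => //; rewrite /g -E in gz; lra.
    by case/(vertex_on sQ zQ euv) => /= /eqP; rewrite ?(negPf zv) ?(negPf zu).
  exists v, z; split=> //; first by rewrite eq_sym.
    apply/andP; split; apply/negP => h.
      have [E] := edge_src_inj uniqQ h evw erefl; by move/eqP: zw.
    have [E] := edge_tgt_inj uniqQ h euv erefl; by move/eqP: zu.
  split; last exact: tip.
  apply: cone_clear => // s sQ' sv as' bs.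
  have [->|su] := eqVneq s u; first by rewrite g_u.
  have [->|sw] := eqVneq s w; first by rewrite g_w.
  case: (lerP (g s) 1) => gs; last lra.
  by apply: hz; rewrite mem_filter sv su sw as' bs gs.
have none s : s \in Q -> s != v -> s != u -> s != w -> 0 <= al s -> 0 <= be s -> 1 < g s.
  move=> sQ' sv su sw as' bs; rewrite ltNge; apply/negP => gs.
  have : s \in M by rewrite mem_filter sv su sw as' bs gs.
  by rewrite M0.
(* Here the fourth vertex enters: in a triangle [(w, u)] is an edge. *)
have wu3 : (w, u) \notin edges Q by apply: edge_no_triangle euv evw.
have uw3 : (u, w) \notin edges Q.
  by apply/negP => h; have [E] := edge_src_inj uniqQ h euv erefl; move/eqP: vw; rewrite E.
have clear q : oseg u w q -> ~ on Q q.
  case=> r hr qE [e he hq].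
  have aq : al q = 1 - r by rewrite qE al_lerp al_u al_w; ring.
  have bq : be q = r by rewrite qE be_lerp be_u be_w; ring.
  have aq0 : 0 < al q by lra.
  have bq0 : 0 < be q by lra.
  have gq : g q = 1 by rewrite /g aq bq; ring.
  have [e1 e2] := edge_at_v he hq aq0 bq0.
  (* An end with [g < 1] would belong to the empty [M] if it were in the cone; outside the cone
     [exit_contra] applies. *)
  have big s : s = e.1 \/ s = e.2 -> 1 <= g s.
    move=> se; rewrite leNgt; apply/negP => gs.
    have sQ' : s \in Q by case: se => ->; [apply: edge_src | apply: edge_tgt].
    have sv : s != v by case: se => ->.
    apply: (exit_contra he e1 e2 se hq) => //; first lra.
    case: (ltrP (al s) 0) => ha; first by left.
    case: (ltrP (be s) 0) => hb; first by right.
    have su : s != u by apply/eqP => E; rewrite E g_u ltxx in gs.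
    have sw : s != w by apply/eqP => E; rewrite E g_w ltxx in gs.
    by have := none s sQ' sv su sw ha hb; lra.
  have g1 := big _ (or_introl erefl); have g2 := big _ (or_intror erefl).
  have ends s : s = e.1 \/ s = e.2 -> g s = 1 -> be s <= 0 \/ 1 <= be s.
    move=> se gs.
    have sQ' : s \in Q by case: se => ->; [apply: edge_src | apply: edge_tgt].
    have sv : s != v by case: se => ->.
    have [->|su] := eqVneq s u; first by left; rewrite be_u.
    have [->|sw] := eqVneq s w; first by right; rewrite be_w.
    case: (lerP (be s) 0) => hb; first by left.
    case: (lerP 1 (be s)) => hb1; first by right.
    rewrite /g in gs.
    have := none s sQ' sv su sw; rewrite /g gs ltxx => H; exfalso; apply: (notF (H _ _)); lra.
  have line s : g s = 1 -> s = lerp u w (be s).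
    rewrite /g => gs; rewrite {1}(recon s) (_ : al s = 1 - be s); last lra.
    apply: pt_eq; rewrite /lerp /=; ring.
  (* [q] lies on the line [g = 1], the ends on it or beyond it. As [q] is not an end, the whole edge
     runs along this line. *)
  have [g1' g2'] : g e.1 = 1 /\ g e.2 = 1.
    have noend s : s = e.1 \/ s = e.2 -> s <> q.
      by move=> se E; move: (ends s se); rewrite E bq => /(_ gq)[]; lra.
    case: hq (gq) => p hp pE; rewrite pE g_lerp => gg.
    have p0 : p != 0.
      by apply/eqP => E; apply: (noend e.1); [left | rewrite pE E lerp0].
    have p1 : p != 1.
      by apply/eqP => E; apply: (noend e.2); [right | rewrite pE E lerp1].
    have p0' : 0 < p by rewrite lt_neqAle eq_sym p0; lra.
    have p1' : p < 1 by rewrite lt_neqAle p1; lra.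
    split; nra.
  have b1 := ends _ (or_introl erefl) g1'; have b2 := ends _ (or_intror erefl) g2'.
  (* The ends lie outside the open segment [u w] while [q] is inside, so the edge covers [u] and
     [w], which must then be its ends. *)
  have cover (r' : R) : 0 <= r' <= 1 -> cseg e.1 e.2 (lerp u w r').
    move=> hr'; case: hq => p hp pE.
    have : be q = (1 - p) * be e.1 + p * be e.2 by rewrite pE be_lerp.
    rewrite bq => hb.
    have nz : be e.2 - be e.1 != 0.
      apply/eqP => h0; have h1 : be e.2 = be e.1 by lra.
      have h2 : r = be e.1 by rewrite hb h1; ring.
      by case: b1; lra.
    exists ((r' - be e.1) / (be e.2 - be e.1)).
      case: b1 b2 => b1 [] b2.
      - by have := mix_le hp b1 b2; lra.
      - by rewrite divr_ge0 ?ler_pdivrMr //=; lra.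
      - by rewrite -[be e.2 - _]opprB -[r' - _]opprB invrN mulrNN divr_ge0 ?ler_pdivrMr //=; lra.
      - by have := mix_ge hp b1 b2; lra.
    have El (t : R) : lerp e.1 e.2 t = lerp u w ((1 - t) * be e.1 + t * be e.2).
      by rewrite {1}(line e.1 g1') {1}(line e.2 g2') lerp_lerp2.
    rewrite El; congr (lerp u w _); by field.
  have hu : cseg e.1 e.2 u by rewrite -[u](lerp0 u w); apply: cover; lra.
  have hw : cseg e.1 e.2 w by rewrite -[w](lerp1 u w); apply: cover; lra.
  case: (vertex_on sQ uQ he hu) => Eu; case: (vertex_on sQ wQ he hw) => Ew.
  - by move/eqP: uw; rewrite Eu Ew.
  - by move/negP: uw3; rewrite Eu Ew; case: e he {big ends hq e1 e2 g1 g2 g1' g2' b1 b2 cover hu hw Eu Ew}.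
  - by move/negP: wu3; rewrite Eu Ew; case: e he {big ends hq e1 e2 g1 g2 g1' g2' b1 b2 cover hu hw Eu Ew}.
  - by move/eqP: uw; rewrite Eu Ew.
exists u, w; split=> //; first by rewrite uw3.
split=> //.
pose m := lerp u w (1 / 2).
have mo : oseg u w m by exists (1 / 2) => //; lra.
have am : al m = 1 / 2 by rewrite al_lerp al_u al_w; lra.
have bm : be m = 1 / 2 by rewrite be_lerp be_u be_w; lra.
have am0 : 0 < al m by lra.
have bm0 : 0 < be m by lra.
have gm : g m = 1 by rewrite /g; lra.
(* The parity found near [v] is carried along the segment from [v] to [m]. *)
exists m => //; have [q qo pq] := tip am0 bm0.
rewrite -(par_simp (x := q) sQ) // => z.
have vm : forall z, oseg v m z -> ~ on Q z.
  apply: cone_clear => //; first lra.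
  move=> s sQ' sv as' bs.
  have [->|su] := eqVneq s u; first by rewrite g_u; lra.
  have [->|sw] := eqVneq s w; first by rewrite g_w; lra.
  by have := none s sQ' sv su sw as' bs; lra.
case=> p hp ->; case: qo => r hr ->.
have -> : lerp (lerp v m r) m p = lerp v m ((1 - p) * r + p).
  by rewrite -{2}(lerp1 v m) lerp_lerp2 mulr1.
have [->|p1] := eqVneq p 1; first by rewrite subrr mul0r add0r lerp1; apply: clear.
have p1' : p < 1 by rewrite lt_neqAle p1; lra.
apply: vm; exists ((1 - p) * r + p) => //; nra.
Qed.

End Corner.

Lemma inner_diagonal Q : simple_cycle Q -> (3 < size Q)%N ->
  exists c d, [/\ c \in Q, d \in Q, c != d, ((c, d) \notin edges Q) && ((d, c) \notin edges Q) &
   (forall z, oseg c d z -> ~ on Q z) /\ exists2 m, oseg c d m & parity Q m].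
Proof.
move=> sQ; have [v vQ h] := leftmost sQ.
have [w e2] := edge_from vQ; have [u e1] := edge_to vQ.
exact: corner_diagonal e1 e2 h.
Qed.

End Diagonals.

(** * Cutting along a chord *)

Section Cuts.
Variable R : realType.
Local Notation pt := (R * R)%type.
Implicit Types (x y z s t u v w : pt) (Q A B : seq pt) (e : pt * pt).

(** The equivalence generated by segments in [S], that is, polygonal connection; invariance of
    parity is an induction on it. *)
Inductive link (S : set pt) : pt -> pt -> Prop :=
| link_refl x : link S x x
| link_seg x y : cseg x y `<=` S -> link S x y
| link_sym x y : link S x y -> link S y x
| link_trans x y z : link S x y -> link S y z -> link S x z.

Lemma link_mono (S S' : set pt) x y : S `<=` S' -> link S x y -> link S' x y.
Proof.
move=> h; elim=> {x y}.
- by move=> x; apply: link_refl.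
- by move=> x y k; apply: link_seg => z /k /h.
- by move=> x y _; apply: link_sym.
- by move=> x y z _ h1 _; apply: link_trans.
Qed.

Lemma link_par (S : set pt) Q x y : simple_cycle Q -> (forall z, S z -> ~ on Q z) ->
  link S x y -> parity Q x = parity Q y.
Proof.
move=> sQ h; elim=> {x y} //.
- by move=> x y k; apply: par_simp => // z /k /h.
- by move=> x y z _ -> _ ->.
Qed.

Definition connected_odd_side Q := forall x y, odd_side Q x -> odd_side Q y -> link (odd_side Q) x y.

Definition perp c d : pt := (- (d.2 - c.2), d.1 - c.1).
Lemma det_dot c d q : det c d q = dot (perp c d) q - dot (perp c d) c.
Proof. rewrite /det /dot /perp /=; ring. Qed.
Definition scale (k : R) u : pt := (k * u.1, k * u.2).
Lemma dot_scale k u q : dot (scale k u) q = k * dot u q.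
Proof. rewrite /dot /scale /=; ring. Qed.

Lemma outer_sub x Q Q' : {subset Q' <= Q} -> outer x Q -> outer x Q'.
Proof. by move=> s [u h]; exists u => z /s; apply: h. Qed.

(** A vertex farthest from the line [c d], on a side that contains vertices, with ties broken by the
    abscissa; [outer_tilt] separates it from all others. *)
Lemma extreme_vertex Q c d : simple_cycle Q -> c != d ->
  exists z, [/\ z \in Q, z != c, z != d & outer z [seq q <- Q | q != z]].
Proof.
move=> sQ cd; have [z0 z0Q n0] := noncollinear sQ cd.
have [k hk] : exists k : R, k * det c d z0 < 0.
  case: (ltrP (det c d z0) 0) => h; first by exists 1; lra.
  by exists (-1); have : 0 < det c d z0; [rewrite lt_neqAle eq_sym n0 | lra].
have [v vQ hv] := argmin (fun q => k * det c d q) (simp_nnil sQ).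
have [|z] := @argmin _ fst [seq q <- Q | k * det c d q == k * det c d v].
  apply/eqP => E; have := mem_filter (fun q => k * det c d q == k * det c d v) v Q.
  by rewrite E eqxx vQ.
rewrite mem_filter => /andP[/eqP zE zQ] hz.
have neg : k * det c d z < 0 by rewrite zE; apply: le_lt_trans hk; apply: hv.
exists z; split=> //.
- apply/eqP => E; move: neg; rewrite E (_ : det c d c = 0) ?mulr0 ?ltxx // /det; ring.
- apply/eqP => E; move: neg; rewrite E (_ : det c d d = 0) ?mulr0 ?ltxx // /det; ring.
apply: (@outer_tilt _ z (scale k (perp c d)) (1, 0)) => q; rewrite mem_filter => /andP[qz qQ].
have := hv q qQ; rewrite -zE !det_dot !dot_scale le_eqVlt => /orP[/eqP E|]; last by left; lra.
right; split; first by lra.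
have : z.1 <= q.1 by apply: hz; rewrite mem_filter qQ andbT -zE !det_dot; apply/eqP; lra.
rewrite le_eqVlt => /orP[/eqP E1|]; last by rewrite /dot /=; lra.
by move: qz; rewrite (simp_fst_inj sQ zQ qQ E1) eqxx.
Qed.

Lemma cseg_beyond s t y z : s.1 != t.1 -> cseg s t z -> z != t -> cseg s z y -> y != t.
Proof.
move=> st [r hr ->] zt [q hq ->]; apply/eqP; rewrite lerp_lerp => E.
have r1 : r != 1 by apply: contra zt => /eqP ->; rewrite lerp1.
have : (1 - q * r) * (s.1 - t.1) == 0.
  by move/(congr1 fst): E => /= E; apply/eqP; lra.
rewrite mulf_eq0 [_ - t.1 == 0]subr_eq0 (negPf st) orbF => /eqP h.
have : r < 1 by rewrite lt_neqAle r1; lra.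
nra.
Qed.

Lemma oseg_not_vertex Q e m : simple_cycle Q -> e \in edges Q -> oseg e.1 e.2 m -> m \notin Q.
Proof.
move=> sQ he hm; apply/negP => mQ.
have [h1 h2] := oseg_ends (simp_nv sQ he) hm.
by case: (vertex_on sQ mQ he (oseg_cseg hm)).
Qed.

Definition on_arc c A d z := exists2 e, e \in path_edges c A d & cseg e.1 e.2 z.
Definition arc_par P c A d (k : bool) :=
  forall z, on_arc c A d z -> z != c -> z != d -> parity P z = k.

(** * The two parts of a polygon with a chord *)

Section Split.
Variables (c d : pt) (A B : seq pt).
Let Q := c :: A ++ d :: B.
Let P1 := c :: A ++ [:: d].
Let P2 := d :: B ++ [:: c].
Hypotheses (sQ : simple_cycle Q) (An : A != [::]) (Bn : B != [::]).
Hypothesis clear : forall z, oseg c d z -> ~ on Q z.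

Let uQ : uniq Q := simp_uniq sQ.
Let eQ : edges Q = path_edges c A d ++ path_edges d B c. Proof. exact: edges_split. Qed.
Let eP1 : edges P1 = path_edges c A d ++ [:: (d, c)]. Proof. exact: edges_chord. Qed.
Let eP2 : edges P2 = path_edges d B c ++ [:: (c, d)]. Proof. exact: edges_chord. Qed.
Let cQ : c \in Q. Proof. exact: mem_head. Qed.
Let dQ : d \in Q. Proof. by rewrite inE mem_cat mem_head !orbT. Qed.

Lemma chord_clear z : cseg c d z -> on Q z -> z = c \/ z = d.
Proof. by move=> /cseg_cases[->|->|/clear h //]; [left|right]. Qed.

(** The chord meets the edges only in [c] and [d], and by [vertex_on] these are ends of every edge
    containing them. *)
Lemma split_simp1 : simple_cycle P1.
Proof.
have ee e : e \in path_edges c A d -> e \in edges Q by rewrite eQ mem_cat => ->.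
have aux e z : e \in path_edges c A d -> cseg e.1 e.2 z -> cseg d c z ->
    (z = e.1 \/ z = e.2) /\ (z = d \/ z = c).
  move=> he hz; rewrite csegC => hz'.
  have oz : on Q z by exists e => //; apply: ee.
  case: (chord_clear hz' oz) => E; (split; last by [left|right]);
    by apply: (vertex_on sQ) (ee _ he) hz; rewrite E.
have [_ u h] := sQ; split.
- by rewrite /= size_cat /= addn1; case: (A) An.
- have : Q = P1 ++ B by rewrite /Q /P1 /= -catA.
  by move=> E; move: u; rewrite E map_cat cat_uniq => /andP[].
move=> e e'; rewrite eP1 !mem_cat !inE => /orP[he|/eqP->] /orP[he'|/eqP->] ne z h1 h2.
- by apply: (h e e') => //; apply: ee.
- exact: aux.
- by have [] := aux _ _ he' h2 h1.
- by move: ne; rewrite eqxx.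
Qed.

(** The chord is an edge of both parts, so its crossings cancel. *)
Lemma par_split z : parity Q z = parity P1 z (+) parity P2 z.
Proof.
rewrite /parity eQ eP1 eP2 !big_cat /= !big_seq1 (chiC d c) addbACA addbb addbF //.
Qed.

Lemma on_split z : on Q z <-> on_arc c A d z \/ on_arc d B c z.
Proof.
split; first by case=> e; rewrite eQ mem_cat => /orP[] he h; [left|right]; exists e.
by case=> -[e he h]; exists e => //; rewrite eQ mem_cat he ?orbT.
Qed.

Lemma on_split1 z : on P1 z <-> on_arc c A d z \/ cseg c d z.
Proof.
split.
  case=> e; rewrite eP1 mem_cat inE => /orP[he h|/eqP -> /=]; first by left; exists e.
  by rewrite csegC; right.
case=> [[e he h]|h]; first by exists e => //; rewrite eP1 mem_cat he.
by exists (d, c); [rewrite eP1 mem_cat inE eqxx orbT | rewrite csegC].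
Qed.

(** A common point would be an end of an edge in either arc, hence a vertex in both [A] and [B]. *)
Lemma arc2_off1 z : on_arc d B c z -> z != c -> z != d -> ~ on P1 z.
Proof.
move=> [e he hz] zc zd /on_split1[[e' he' hz']|hc]; last first.
  have oz : on Q z by apply/on_split; right; exists e.
  by case: (chord_clear hc oz) => /eqP; rewrite ?(negPf zc) ?(negPf zd).
have := uQ; rewrite /Q -cat_cons cat_uniq => /and3P[_ /hasPn dis _].
have ne : e != e'.
  apply/eqP => E; have := dis _ (mem_pe1 he); rewrite E.
  by have := mem_pe1 he'; rewrite -topredE /= => ->.
have [_ _ h] := sQ.
have [||] := h e e' _ _ ne z hz hz'; rewrite ?eQ ?mem_cat ?he ?he' ?orbT //.
move=> H1 H2.
have zB : z \in B.
  case: H1 => E; [have := mem_pe1 he | have := mem_pe2 he];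
  by rewrite -E ?inE ?mem_cat ?inE ?(negPf zd) ?(negPf zc) ?orbF.
have zA : z \in A.
  case: H2 => E; [have := mem_pe1 he' | have := mem_pe2 he'];
  by rewrite -E ?inE ?mem_cat ?inE ?(negPf zd) ?(negPf zc) ?orbF.
have zB' : z \in d :: B by rewrite inE zB orbT.
have zA' : z \in c :: A by rewrite inE zA orbT.
by have := dis z zB'; rewrite /= zA'.
Qed.

(** The other end of the edge may be [c] or [d]; the piece from [s] to [z] stops short of it and so
    stays off the first part. *)
Lemma arc2_step e s z : e \in path_edges d B c -> s = e.1 \/ s = e.2 -> s != c -> s != d ->
  cseg e.1 e.2 z -> z != c -> z != d -> parity P1 z = parity P1 s.
Proof.
move=> he se sc sd hz zc zd; apply/esym/par_simp; first exact: split_simp1.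
have eQ' : e \in edges Q by rewrite eQ mem_cat he orbT.
have nv := simp_nv sQ eQ'.
have hs : cseg e.1 e.2 s by case: se => ->; [apply: cseg_l | apply: cseg_r].
move=> y hy; have hy' := cseg_sub hs hz hy.
have ne q : q \in Q -> q != s -> z != q -> y != q.
  move=> qQ qs zq; apply/eqP => E; subst y.
  case: (vertex_on sQ qQ eQ' hy') => E.
    case: se => se; first by move: qs; rewrite E se eqxx.
    have nv' : e.2.1 != e.1.1 by rewrite eq_sym.
    have hz' : cseg e.2 e.1 z by rewrite csegC.
    have zq' : z != e.1 by rewrite -E.
    by rewrite se in hy; move: (cseg_beyond nv' hz' zq' hy); rewrite E eqxx.
  case: se => se; last by move: qs; rewrite E se eqxx.
  have zq' : z != e.2 by rewrite -E.
  by rewrite se in hy; move: (cseg_beyond nv hz zq' hy); rewrite E eqxx.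
apply: arc2_off1; first by exists e.
  by apply: ne => //; rewrite eq_sym.
by apply: ne => //; rewrite eq_sym.
Qed.

(** The parity is carried along the arc, vertex by vertex, from the first vertex of [B]. *)
Lemma arc2_const : exists k, arc_par P1 d B c k.
Proof.
have uB : c \notin B /\ d \notin B.
  move: uQ => /=; rewrite mem_cat inE cat_uniq /= !negb_or => /andP[/and3P[_ _ ->]].
  by case/and4P=> _ _ ->.
have [b [B' E]] : exists b B', B = b :: B' by case: (B) Bn => // b B' _; exists b, B'.
exists (parity P1 b).
have key B2 s z : {subset s :: B2 <= B} -> {subset path_edges s B2 c <= path_edges d B c} ->
    on_arc s B2 c z -> z != c -> z != d -> parity P1 z = parity P1 s.
  elim: B2 s => [|x B2 IH] s sB se [e he hz] zc zd.
    have sB' := sB s (mem_head _ _).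
    have sc : s != c by apply/eqP => E'; move: uB.1; rewrite -E' sB'.
    have sd : s != d by apply/eqP => E'; move: uB.2; rewrite -E' sB'.
    apply: (arc2_step (se _ he)) => //.
    by left; move: he; rewrite /= inE => /eqP->.
  have sB' := sB s (mem_head _ _).
  have sc : s != c by apply/eqP => E'; move: uB.1; rewrite -E' sB'.
  have sd : s != d by apply/eqP => E'; move: uB.2; rewrite -E' sB'.
  have xB' : x \in B by apply: sB; rewrite !inE eqxx orbT.
  have xc : x != c by apply/eqP => E'; move: uB.1; rewrite -E' xB'.
  have xd : x != d by apply/eqP => E'; move: uB.2; rewrite -E' xB'.
  have h1 : (s, x) \in path_edges d B c by apply: se; rewrite /= mem_head.
  move: he; rewrite /= inE => /orP[/eqP Ee|he].
    by apply: (arc2_step h1) => //; [left | rewrite Ee in hz].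
  have -> : parity P1 s = parity P1 x.
    by apply: (arc2_step h1) => //; [right | apply: cseg_l].
  apply: IH => //; last by exists e.
  - by move=> q hq; apply: sB; rewrite inE hq orbT.
  - by move=> q hq; apply: se; rewrite /= inE hq orbT.
move=> z [e he hz] zd zc.
move: he; rewrite E /= inE => /orP[/eqP Ee|he].
  have bB : b \in B by rewrite E mem_head.
  have bc : b != c by apply/eqP => E'; move: uB.1; rewrite -E' bB.
  have bd : b != d by apply/eqP => E'; move: uB.2; rewrite -E' bB.
  apply: (@arc2_step (d, b)) => //; first by rewrite E /= mem_head.
    by right.
  by rewrite Ee in hz.
apply: (key B') => //; last by exists e.
- by rewrite E.
- by move=> q hq; rewrite E /= inE hq orbT.
Qed.

Lemma arc2_vertex z : z \in B -> on_arc d B c z.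
Proof.
move=> zB; have : z \in [seq e.1 | e <- path_edges d B c] by rewrite map_fst_pe inE zB orbT.
by case/mapP => e he ->; exists e => //; apply: cseg_l.
Qed.

(* If the second arc runs outside P1, walking inside P1 from the chord to the
   first arc never meets P2. *)
Lemma flat_ins1 : connected_odd_side P1 -> simple_cycle P2 -> arc_par P1 d B c false ->
  (forall z, on_arc c A d z -> z != c -> z != d -> ~ on P2 z) ->
  forall k, arc_par P2 c A d k ->
  forall z, odd_side P1 z -> ~ on P2 z /\ parity P2 z = k.
Proof.
move=> con sP2 flat off2 k hk.
have sP1 := split_simp1.
have off z : odd_side P1 z -> ~ on P2 z.
  move=> [n1 p1] [e]; rewrite eP2 mem_cat inE => /orP[he hz|/eqP-> /= hz].
    have [E|zc] := eqVneq z c; first by apply: n1; apply: vertex_on_Q; rewrite E mem_head.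
    have [E|zd] := eqVneq z d.
      by apply: n1; apply: vertex_on_Q; rewrite E /P1 inE mem_cat inE eqxx !orbT.
    by move: p1; rewrite (flat z) //; exists e.
  by apply: n1; apply/on_split1; right.
move=> z hz; split; first exact: off.
have [a [A' EA]] : exists a A', A = a :: A' by case: (A) An => // a A' _; exists a, A'.
have he : (c, a) \in edges P1 by rewrite eP1 EA /= mem_head.
have heQ : (c, a) \in edges Q by rewrite eQ EA /= mem_head.
(* [m] lies on the first arc, away from [c] and [d]. Giving [edges P2] to [edge_sides] yields a
   point of the odd side of [P1] that has the same parity for [P2] as [m]. *)
pose m := lerp c a (1 / 2).
have hm : oseg c a m by exists (1 / 2) => //; lra.
have mQ := oseg_not_vertex sQ heQ hm.
have mc : m != c by apply: contraNneq mQ => ->.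
have md : m != d by apply: contraNneq mQ => ->.
have arcm : on_arc c A d m by exists (c, a); [rewrite EA /= mem_head | apply: oseg_cseg].
have [||p [q [ip _ pm _ cl]]] := @edge_sides _ P1 (c, a) m (edges P2) sP1 he hm.
- by move=> e; apply: simp_nv.
- by move=> e he2 h; apply: (off2 m) => //; exists e.
rewrite (link_par sP2 off (con _ _ hz ip)) -(hk m) //.
apply: par_simp => // y hy [e e2 h]; apply: (cl y _ e e2) => //.
exact: (cseg_sub (cseg_l _ _) pm).
Qed.

Lemma chord_near1 m : oseg c d m ->
  exists2 a, odd_side P1 a & cseg a m `<=` [set z | ~ on Q z].
Proof.
move=> hm; rewrite osegC in hm.
have h : (d, c) \in edges P1 by rewrite eP1 mem_cat inE eqxx orbT.
have [||p [q [ip _ pm _ cl]]] := @edge_sides _ P1 (d, c) m (edges Q) split_simp1 h hm.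
- by move=> e; apply: simp_nv.
- by move=> e he2 k; apply: (clear (z := m)); [rewrite osegC | exists e].
exists p => // y hy [e e2 k]; apply: (cl y _ e e2) => //.
exact: (cseg_sub (cseg_l _ _) pm).
Qed.

Lemma chord_near_out1 m : oseg c d m ->
  exists2 b, even_side P1 b & cseg b m `<=` [set z | ~ on Q z].
Proof.
move=> hm; rewrite osegC in hm.
have h : (d, c) \in edges P1 by rewrite eP1 mem_cat inE eqxx orbT.
have [||p [q [_ oq pm _ cl]]] := @edge_sides _ P1 (d, c) m (edges Q) split_simp1 h hm.
- by move=> e; apply: simp_nv.
- by move=> e he2 k; apply: (clear (z := m)); [rewrite osegC | exists e].
exists q => // y hy [e e2 k]; apply: (cl y _ e e2) => //.
exact: (cseg_sub (cseg_r _ _) pm).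
Qed.

Lemma chord_par m m' : oseg c d m -> oseg c d m' -> parity Q m = parity Q m'.
Proof.
case=> r hr -> [r' hr' ->]; apply: par_simp => // z [q hq ->].
rewrite lerp_lerp2; apply: clear; exists ((1 - q) * r + q * r') => //.
apply/andP; split; first by apply: mix_gt; lra.
(* The upper bound is [mix_gt] for the negated parameters. *)
have := @mix_gt R (-1) (- r) (- r') q hq; lra.
Qed.

End Split.

End Cuts.

Section Splits.
Variable R : realType.
Local Notation pt := (R * R)%type.
Implicit Types (x y z s t u v w : pt) (Q A B X Y : seq pt) (e : pt * pt).

(** Nonempty [A] and [B] say that [c] and [d] are not adjacent, so that both parts have at least
    three vertices. *)
Definition chord c A d B := [/\ simple_cycle (c :: A ++ d :: B), A != [::], B != [::] &
  forall z, oseg c d z -> ~ on (c :: A ++ d :: B) z].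

Lemma chord_sym c A d B : chord c A d B -> chord d B c A.
Proof.
case=> sQ An Bn cl; split=> //; first exact: (@simp_catC _ (c :: A) (d :: B)).
move=> z; rewrite osegC => /cl h /(@on_catC _ (d :: B) (c :: A)); exact: h.
Qed.

Lemma chord_simp1 c A d B : chord c A d B -> simple_cycle (c :: A ++ [:: d]).
Proof. case=> sQ An Bn cl; exact: split_simp1 cl. Qed.

Lemma chord_simp2 c A d B : chord c A d B -> simple_cycle (d :: B ++ [:: c]).
Proof. by move=> /chord_sym /chord_simp1. Qed.

Lemma chord_parE c A d B z : chord c A d B ->
  parity (c :: A ++ d :: B) z = parity (c :: A ++ [:: d]) z (+) parity (d :: B ++ [:: c]) z.
Proof. by case=> sQ An Bn cl; apply: par_split. Qed.

Lemma par_rot2 c A d B z : parity (d :: B ++ c :: A) z = parity (c :: A ++ d :: B) z.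
Proof. exact: (@par_catC _ (d :: B) (c :: A)). Qed.

Lemma on_rot2 c A d B z : on (d :: B ++ c :: A) z <-> on (c :: A ++ d :: B) z.
Proof. exact: (@on_catC _ (d :: B) (c :: A)). Qed.

Lemma chord_const c A d B : chord c A d B -> exists k, arc_par (c :: A ++ [:: d]) d B c k.
Proof. case=> sQ An Bn cl; exact: arc2_const. Qed.

(** Beside the chord, in the odd side of the first part, the whole polygon has parity [true (+) k],
    and no edge separates that place from the chord. *)
Lemma chord_flat c A d B : chord c A d B -> connected_odd_side (c :: A ++ [:: d]) ->
  arc_par (c :: A ++ [:: d]) d B c false ->
  forall k, arc_par (d :: B ++ [:: c]) c A d k ->
  (forall z, odd_side (c :: A ++ [:: d]) z -> ~ on (d :: B ++ [:: c]) z /\ parity (d :: B ++ [:: c]) z = k)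
  /\ forall m, oseg c d m -> parity (c :: A ++ d :: B) m = ~~ k.
Proof.
move=> ch con fl k hk; have s2 := chord_simp2 ch; have ch' := chord_sym ch.
have [sQ An Bn cl] := ch; have [sQ' _ _ cl'] := ch'.
have F := flat_ins1 sQ An cl con s2 fl _ hk.
have off z : on_arc c A d z -> z != c -> z != d -> ~ on (d :: B ++ [:: c]) z.
  by move=> h zc zd; apply: (arc2_off1 sQ' cl').
split; first exact: F.
move=> m hm; have [a ia am] := chord_near1 sQ An cl hm.
have [_ pa] := ia; have [_ p2] := F off a ia.
by rewrite -(par_simp sQ am) (chord_parE _ ch) pa p2.
Qed.

(** The extreme vertex is separated from the part that does not contain it; as the parity is
    constant along its arc, this one vertex decides. *)
Lemma chord_extreme c A d B k1 k2 : chord c A d B ->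
  arc_par (c :: A ++ [:: d]) d B c k1 -> arc_par (d :: B ++ [:: c]) c A d k2 ->
  k1 = false \/ k2 = false.
Proof.
have aux c' A' d' B' k z : chord c' A' d' B' -> arc_par (d' :: B' ++ [:: c']) c' A' d' k ->
   z \in A' -> z != c' -> z != d' -> outer z [seq q <- c' :: A' ++ d' :: B' | q != z] -> k = false.
  move=> ch h zA zc zd oz; rewrite -(h z) //; last exact: arc2_vertex.
  apply: outer_par; first exact: chord_simp2 ch.
  apply: outer_sub oz => q hq; rewrite mem_filter; apply/andP; split; last first.
    by move: hq; rewrite !inE !mem_cat !inE => /or3P[->|->|->]; rewrite ?orbT.
  apply/eqP => E; subst q; move: hq; rewrite inE mem_cat inE (negPf zc) (negPf zd) /= orbF => zB.
  case: ch => /simp_uniq /=; rewrite mem_cat cat_uniq => /andP[_ /and3P[_ /hasPn hh _]] _ _ _.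
  have zB' : z \in d' :: B' by rewrite inE zB orbT.
  by have := hh z zB'; rewrite /= zA.
move=> ch h1 h2; have [sQ _ _ _] := ch.
have cd : c != d.
  by have := simp_uniq sQ; rewrite /= mem_cat inE !negb_or => /andP[/and3P[_ ->]].
have [z [zQ zc zd oz]] := extreme_vertex sQ cd.
move: (zQ); rewrite inE mem_cat inE (negPf zc) (negPf zd) /= => /orP[zA|zB].
  right; exact: (aux _ _ _ _ _ _ ch h2 zA zc zd oz).
left; apply: (aux _ _ _ _ _ _ (chord_sym ch) h1 zB zd zc).
by apply: outer_sub oz => q; rewrite !mem_filter !inE !mem_cat !inE => /andP[->]; case/or4P => ->; rewrite ?orbT.
Qed.

Definition inner_split c A d B := [/\ forall z, odd_side (c :: A ++ [:: d]) z -> odd_side (c :: A ++ d :: B) z,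
  forall z, odd_side (d :: B ++ [:: c]) z -> odd_side (c :: A ++ d :: B) z,
  forall z, oseg c d z -> odd_side (c :: A ++ d :: B) z &
  forall z, odd_side (c :: A ++ d :: B) z ->
   [\/ odd_side (c :: A ++ [:: d]) z, odd_side (d :: B ++ [:: c]) z | oseg c d z]].

Lemma chord_on c A d B z : chord c A d B ->
  on (c :: A ++ d :: B) z -> on (c :: A ++ [:: d]) z \/ on (d :: B ++ [:: c]) z.
Proof.
move=> [sQ An Bn cl] /on_split[] h; [left | right]; apply/on_split1; by left.
Qed.

Lemma chord_on1 c A d B z : chord c A d B ->
  on (c :: A ++ [:: d]) z -> on (c :: A ++ d :: B) z \/ oseg c d z.
Proof.
move=> [sQ An Bn cl] /on_split1[h|/cseg_cases[->|->|]]; [left|left|left|by right].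
- by apply/on_split; left.
- by apply: vertex_on_Q; rewrite mem_head.
- by apply: vertex_on_Q; rewrite inE mem_cat mem_head !orbT.
Qed.

(** [chord_extreme] makes one arc even for the other part. By [chord_flat] an odd chord then makes
    the other arc even too, so each odd side lies in the even side of the other part. *)
Lemma split_ins c A d B m : chord c A d B ->
  connected_odd_side (c :: A ++ [:: d]) -> connected_odd_side (d :: B ++ [:: c]) ->
  oseg c d m -> parity (c :: A ++ d :: B) m -> inner_split c A d B.
Proof.
move=> ch con1 con2 hm pm; have ch' := chord_sym ch.
have [sQ An Bn cl] := ch.
have [k1 h1] := chord_const ch; have [k2 h2] := chord_const ch'.
have k12 : k1 = false /\ k2 = false.
  case: (chord_extreme ch h1 h2) => E; subst.
    by have [_ /(_ m hm)] := chord_flat ch con1 h1 h2; rewrite pm; case: (k2).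
  have [_ /(_ m)] := chord_flat ch' con2 h2 h1.
  by rewrite osegC par_rot2 pm => /(_ hm); case: (k1).
case: k12 => E1 E2; subst.
have [f1 _] := chord_flat ch con1 h1 h2; have [f2 _] := chord_flat ch' con2 h2 h1.
split.
- move=> z hz; have [n1 p1] := hz; have [n2 p2] := f1 z hz; split.
    by case/(chord_on ch).
  by rewrite (chord_parE _ ch) p1 p2.
- move=> z hz; have [n1 p1] := hz; have [n2 p2] := f2 z hz; split.
    by case/(chord_on ch).
  by rewrite (chord_parE _ ch) p1 p2.
- move=> z hz; split; first exact: cl.
  by rewrite -(chord_par sQ cl hm hz).
move=> z [nz pz].
have [ocd|nocd] := pselect (oseg c d z); first by apply: Or33.
have n1 : ~ on (c :: A ++ [:: d]) z by case/(chord_on1 ch).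
have n2 : ~ on (d :: B ++ [:: c]) z.
  by case/(chord_on1 ch'); [move/on_rot2 | rewrite osegC].
move: pz; rewrite (chord_parE _ ch).
case p1 : (parity (c :: A ++ _) z) => /= p2; first by apply: Or31.
by apply: Or32.
Qed.

(** The first part is the pocket and the second is the polygon with the pocket filled; hence the arc
    [A] runs through the odd side of the latter. *)
Definition pocket c A d B := [/\ forall z, odd_side (c :: A ++ [:: d]) z -> even_side (c :: A ++ d :: B) z,
  forall z, oseg c d z -> even_side (c :: A ++ d :: B) z,
  forall z, even_side (d :: B ++ [:: c]) z -> even_side (c :: A ++ d :: B) z,
  forall z, even_side (c :: A ++ d :: B) z ->
   [\/ odd_side (c :: A ++ [:: d]) z, even_side (d :: B ++ [:: c]) z | oseg c d z] &
  forall z, z \in A -> parity (d :: B ++ [:: c]) z].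

(** By [chord_flat] an even chord forces [k2 = true]: the arc [A] and the odd side of the first part
    are odd for the second part. *)
Lemma split_pocket c A d B m : chord c A d B ->
  connected_odd_side (c :: A ++ [:: d]) -> oseg c d m -> ~~ parity (c :: A ++ d :: B) m ->
  arc_par (c :: A ++ [:: d]) d B c false -> pocket c A d B.
Proof.
move=> ch con1 hm pm h1; have ch' := chord_sym ch.
have [sQ An Bn cl] := ch; have [sQ' _ _ cl'] := ch'.
have [k2 h2] := chord_const ch'.
have [f1 fm] := chord_flat ch con1 h1 h2.
have E : k2 = true by have := fm m hm; rewrite (negPf pm); case: (k2).
subst.
have uQ := simp_uniq sQ.
have cA z : z \in A -> z != c /\ z != d.
  move=> zA; move: uQ => /=; rewrite mem_cat cat_uniq negb_or => /andP[/andP[cA _] /and3P[_ hh _]].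
  split; first by apply: contraNneq cA => <-.
  by move/hasPn: hh => /(_ d (mem_head _ _)) /=; apply: contraNneq => <-.
split.
- move=> z hz; have [n1 p1] := hz; have [n2 p2] := f1 z hz; split.
    by case/(chord_on ch).
  by rewrite (chord_parE _ ch) p1 p2.
- move=> z hz; split; first exact: cl.
  by rewrite -(chord_par sQ cl hm hz).
- move=> z [n2 p2].
  have n1 : ~ on (c :: A ++ [:: d]) z.
    case/on_split1 => h; last by apply: n2; apply/on_split1; right; rewrite csegC.
    have [E|zc] := eqVneq z c.
      by apply: n2; apply: vertex_on_Q; rewrite E inE mem_cat mem_head !orbT.
    have [E|zd] := eqVneq z d; first by apply: n2; apply: vertex_on_Q; rewrite E mem_head.
    by move: p2; rewrite (h2 z).
  split; first by case/(chord_on ch).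
  rewrite (chord_parE _ ch) (negPf p2) addbF; apply/negP => p1.
  by have [_] := f1 z (conj n1 p1); rewrite (negPf p2).
- move=> z [nz pz].
  have [ocd|nocd] := pselect (oseg c d z); first by apply: Or33.
  have n1 : ~ on (c :: A ++ [:: d]) z by case/(chord_on1 ch).
  have n2 : ~ on (d :: B ++ [:: c]) z.
    by case/(chord_on1 ch'); [move/on_rot2 | rewrite osegC].
  move: pz; rewrite (chord_parE _ ch).
  case p1 : (parity (c :: A ++ _) z) => /= p2; first by apply: Or31.
  by apply: Or32.
move=> z zA; have [zc zd] := cA z zA.
by rewrite (h2 z) //; apply: arc2_vertex.
Qed.

Lemma split_outs c A d B m : chord c A d B ->
  connected_odd_side (c :: A ++ [:: d]) -> connected_odd_side (d :: B ++ [:: c]) ->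
  oseg c d m -> ~~ parity (c :: A ++ d :: B) m -> pocket c A d B \/ pocket d B c A.
Proof.
move=> ch con1 con2 hm pm; have ch' := chord_sym ch.
have [k1 h1] := chord_const ch; have [k2 h2] := chord_const ch'.
case: (chord_extreme ch h1 h2) => E; subst.
  by left; apply: (split_pocket ch con1 hm).
right; apply: (split_pocket ch' con2 (m := m)) => //; first by rewrite osegC.
by rewrite par_rot2.
Qed.

(** In either part the odd side is connected and reaches up to the chord, so [m] serves as a hub. *)
Lemma link_chord c A d B m x : chord c A d B -> inner_split c A d B ->
  connected_odd_side (c :: A ++ [:: d]) -> connected_odd_side (d :: B ++ [:: c]) ->
  oseg c d m -> odd_side (c :: A ++ d :: B) x -> link (odd_side (c :: A ++ d :: B)) x m.
Proof.
move=> ch [i1 i2 io cov] con1 con2 hm /cov hx.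
have [sQ An Bn cl] := ch; have [sQ' _ _ cl'] := chord_sym ch.
have seg a : cseg a m `<=` [set z | ~ on (c :: A ++ d :: B) z] ->
   cseg a m `<=` odd_side (c :: A ++ d :: B).
  move=> h y hy; split; first exact: h.
  rewrite (par_simp (y := m) sQ) ?(io m hm).2 // => z hz; apply: h.
  exact: (cseg_sub hy (cseg_r _ _)).
case: hx => hx.
- have [a ia am] := chord_near1 sQ An cl hm.
  apply: link_trans (link_mono i1 (con1 _ _ hx ia)) _.
  by apply: link_seg; apply: seg.
- have [|a ia am] := chord_near1 sQ' Bn cl' (m := m); first by rewrite osegC.
  apply: link_trans (link_mono i2 (con2 _ _ hx ia)) _.
  by apply: link_seg; apply: seg => y /am /= h /on_rot2.
- apply: link_seg => y [q hq ->]; apply: io.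
  case: hx hm => r hr -> [r' hr' ->]; rewrite lerp_lerp2.
  exists ((1 - q) * r + q * r') => //.
  apply/andP; split; first by apply: mix_gt; lra.
  have := @mix_gt R (-1) (- r) (- r') q hq; lra.
Qed.

(** * Triangles in barycentric coordinates *)

Section Triangle.
Variables a b c : pt.
Let T := [:: a; b; c].
Hypothesis sT : simple_cycle T.
Let D := det a b c.
Let la z := det b c z / D.
Let lb z := det c a z / D.
Let lc z := det a b z / D.

Let D0 : D != 0.
Proof.
have [_ u _] := sT; have := simp_uniq sT; rewrite /= inE negb_or => /andP[/andP[ab _] _].
have [z] := noncollinear sT ab; rewrite !inE => /or3P[] /eqP -> //.
  by rewrite (_ : det a b a = 0) ?eqxx // /det; ring.
by rewrite (_ : det a b b = 0) ?eqxx // /det; ring.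
Qed.

Let la_lerp x y r : la (lerp x y r) = (1 - r) * la x + r * la y.
Proof. by rewrite /la det_lerp; field. Qed.
Let lb_lerp x y r : lb (lerp x y r) = (1 - r) * lb x + r * lb y.
Proof. by rewrite /lb det_lerp; field. Qed.
Let lc_lerp x y r : lc (lerp x y r) = (1 - r) * lc x + r * lc y.
Proof. by rewrite /lc det_lerp; field. Qed.
Let la_a : la a = 1. Proof. by rewrite /la (_ : det b c a = D) ?divff // /D /det; ring. Qed.
Let la_b : la b = 0. Proof. by rewrite /la (_ : det b c b = 0) ?mul0r // /det; ring. Qed.
Let la_c : la c = 0. Proof. by rewrite /la (_ : det b c c = 0) ?mul0r // /det; ring. Qed.
Let lb_a : lb a = 0. Proof. by rewrite /lb (_ : det c a a = 0) ?mul0r // /det; ring. Qed.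
Let lb_b : lb b = 1. Proof. by rewrite /lb (_ : det c a b = D) ?divff // /D /det; ring. Qed.
Let lb_c : lb c = 0. Proof. by rewrite /lb (_ : det c a c = 0) ?mul0r // /det; ring. Qed.
Let lc_a : lc a = 0. Proof. by rewrite /lc (_ : det a b a = 0) ?mul0r // /det; ring. Qed.
Let lc_b : lc b = 0. Proof. by rewrite /lc (_ : det a b b = 0) ?mul0r // /det; ring. Qed.
Let lc_c : lc c = 1. Proof. by rewrite /lc divff. Qed.
Let sum1 z : la z + lb z + lc z = 1.
Proof.
have D1 := D0; rewrite /D /det in D1.
by rewrite /la /lb /lc /D /det; field.
Qed.
Let recon z : z = (la z * a.1 + lb z * b.1 + lc z * c.1, la z * a.2 + lb z * b.2 + lc z * c.2).
Proof.
have D1 := D0; rewrite /D /det in D1.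
by apply: pt_eq; rewrite /la /lb /lc /D /det /=; field.
Qed.

Let neg_outer s t z : det s t z / D < 0 -> (forall v, v \in T -> 0 <= det s t v / D) -> outer z T.
Proof.
move=> hz hv; exists (scale D^-1 (perp s t)) => v vT; rewrite !dot_scale.
have := hv v vT; rewrite !det_dot in hz *; lra.
Qed.

(** An odd point is not separated from the triangle, so no coordinate is negative, and none vanishes
    off the edges. Conversely, the open triangle is convex, avoids the edges and contains the odd
    point that [edge_sides] finds beside an edge. *)
Lemma triangle_ins z : odd_side T z <-> [/\ 0 < la z, 0 < lb z & 0 < lc z].
Proof.
have pos z' : odd_side T z' -> [/\ 0 < la z', 0 < lb z' & 0 < lc z'].
  move=> [nz pz].
  have no : ~ outer z' T by move=> /(outer_par sT); rewrite pz.
  have a0 : 0 <= la z'.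
    rewrite leNgt; apply/negP => h; apply: no; apply: neg_outer h _ => v.
    by rewrite !inE -/(la v) => /or3P[] /eqP->; rewrite ?la_a ?la_b ?la_c.
  have b0 : 0 <= lb z'.
    rewrite leNgt; apply/negP => h; apply: no; apply: neg_outer h _ => v.
    by rewrite !inE -/(lb v) => /or3P[] /eqP->; rewrite ?lb_a ?lb_b ?lb_c.
  have c0 : 0 <= lc z'.
    rewrite leNgt; apply/negP => h; apply: no; apply: neg_outer h _ => v.
    by rewrite !inE -/(lc v) => /or3P[] /eqP->; rewrite ?lc_a ?lc_b ?lc_c.
  have s1 := sum1 z'; have rz := recon z'.
  split; rewrite lt_neqAle ?a0 ?b0 ?c0 andbT; apply/eqP => E; apply: nz.
  - exists (b, c); first by rewrite /= !inE eqxx orbT.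
    exists (lc z'); first lra.
    by rewrite {1}rz -E (_ : lb z' = 1 - lc z'); [apply: pt_eq; rewrite /lerp /=; ring | lra].
  - exists (c, a); first by rewrite /= !inE eqxx !orbT.
    exists (la z'); first lra.
    by rewrite {1}rz -E (_ : lc z' = 1 - la z'); [apply: pt_eq; rewrite /lerp /=; ring | lra].
  - exists (a, b); first by rewrite /= !inE eqxx.
    exists (lb z'); first lra.
    by rewrite {1}rz -E (_ : la z' = 1 - lb z'); [apply: pt_eq; rewrite /lerp /=; ring | lra].
split=> [/pos//|[ha hb hc]].
have off y : 0 < la y -> 0 < lb y -> 0 < lc y -> ~ on T y.
  move=> ya yb yc [e]; rewrite /= !inE => /or3P[] /eqP -> /= [r _ E].
  - by move: yc; rewrite E lc_lerp lc_a lc_b; lra.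
  - by move: ya; rewrite E la_lerp la_b la_c; lra.
  - by move: yb; rewrite E lb_lerp lb_a lb_c; lra.
split; first exact: off.
have eab : (a, b) \in edges T by rewrite /= inE eqxx.
have hm : oseg a b (lerp a b (1 / 2)) by exists (1 / 2) => //; lra.
have [//|//|p [_ [ip _ _ _ _]]] := @edge_sides _ T (a, b) (lerp a b (1 / 2)) [::] sT eab hm.
rewrite (par_simp (y := p) sT) ?ip.2 // => y [r hr ->].
have [pa pb pc] := pos p ip.
by apply: off; rewrite ?la_lerp ?lb_lerp ?lc_lerp; apply: mix_gt.
Qed.

Lemma triangle_connected : connected_odd_side T.
Proof.
move=> x y /triangle_ins[xa xb xc] /triangle_ins[ya yb yc].
apply: link_seg => z [r hr ->]; apply/triangle_ins.
by split; rewrite ?la_lerp ?lb_lerp ?lc_lerp; apply: mix_gt.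
Qed.

Lemma triangle_sees x v z : odd_side T x -> v \in T -> oseg x v z -> odd_side T z.
Proof.
move=> /triangle_ins[xa xb xc] vT [r hr ->]; apply/triangle_ins.
move: vT; rewrite !inE => /or3P[] /eqP ->;
  split; rewrite ?la_lerp ?lb_lerp ?lc_lerp ?la_a ?la_b ?la_c ?lb_a ?lb_b ?lb_c ?lc_a ?lc_b ?lc_c; nra.
Qed.

Lemma triangle_edge_sees e x v z : e \in edges T -> oseg e.1 e.2 x -> v \in T ->
  v != e.1 -> v != e.2 -> oseg x v z -> odd_side T z.
Proof.
rewrite /= !inE => /or3P[] /eqP -> /= [q hq ->] /or3P[] /eqP ->; rewrite ?eqxx // => _ _ [r hr ->];
apply/triangle_ins;
split; rewrite ?la_lerp ?lb_lerp ?lc_lerp ?la_a ?la_b ?la_c ?lb_a ?lb_b ?lb_c ?lc_a ?lc_b ?lc_c; nra.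
Qed.

End Triangle.

End Splits.

(** * Visibility from interior points *)

Lemma mem_edges_mid (T : eqType) (X A Y : seq T) c d e :
  (e \in edges (X ++ c :: A ++ d :: Y)) = (e \in path_edges c A d) || (e \in path_edges d (Y ++ X) c).
Proof.
rewrite mem_edges_catC /= -catA cat_cons pe_cat mem_cat //.
Qed.

Lemma mem_edges_mid1 (T : eqType) (A : seq T) c d e :
  (e \in edges (c :: A ++ [:: d])) = (e \in path_edges c A d) || (e == (d, c)).
Proof. by rewrite edges_chord mem_cat inE. Qed.

Lemma mem_edges_mid2 (T : eqType) (X Y : seq T) c d e :
  (e \in edges (X ++ c :: d :: Y)) = (e \in path_edges d (Y ++ X) c) || (e == (c, d)).
Proof. by rewrite (@mem_edges_mid _ X [::] Y) /= inE orbC. Qed.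

Section Inner.
Variable R : realType.
Local Notation pt := (R * R)%type.
Implicit Types (x y z s t u v w : pt) (Q A B X Y : seq pt) (e : pt * pt).

Lemma ins_catC A B z : odd_side (A ++ B) z <-> odd_side (B ++ A) z.
Proof. by rewrite /odd_side par_catC; split=> -[h1 h2]; split=> // /on_catC. Qed.
Lemma outs_catC A B z : even_side (A ++ B) z <-> even_side (B ++ A) z.
Proof. by rewrite /even_side par_catC; split=> -[h1 h2]; split=> // /on_catC. Qed.

Lemma rot_mid c A d X Y : c :: A ++ d :: (Y ++ X) = (c :: A ++ d :: Y) ++ X.
Proof. by rewrite /= -catA. Qed.
Lemma rot_mid2 c d X Y : d :: (Y ++ X) ++ [:: c] = (d :: Y) ++ (X ++ [:: c]).
Proof. by rewrite /= catA. Qed.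
Lemma rot_mid2' c d X Y : X ++ c :: d :: Y = (X ++ [:: c]) ++ (d :: Y).
Proof. by rewrite -catA. Qed.

(** [X] and [Y] are kept apart rather than rotating [Q], because [X ++ c :: d :: Y] preserves the
    order of the vertices, on which the count of edges relies. The ends may be exchanged, hence the
    equality of open segments. *)
Lemma split_chord Q c d : simple_cycle Q -> c \in Q -> d \in Q -> c != d ->
  (c, d) \notin edges Q -> (d, c) \notin edges Q -> (forall z, oseg c d z -> ~ on Q z) ->
  exists X c' A d' Y, [/\ Q = X ++ c' :: A ++ d' :: Y, chord c' A d' (Y ++ X) &
    oseg c' d' = oseg c d].
Proof.
move=> sQ cQ dQ cd n1 n2 cl.
wlog [X [A [Y E]]] : c d cQ dQ cd n1 n2 cl / exists X A Y, Q = X ++ c :: A ++ d :: Y.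
  move=> H; have [X [A [Y [E|E]]]] := mem_split2 cQ dQ cd.
    by apply: H => //; exists X, A, Y.
  rewrite osegC; apply: H => //; [by rewrite eq_sym | by move=> z; rewrite osegC; apply: cl |].
  by exists X, A, Y.
exists X, c, A, d, Y; split=> //; rewrite E in n1 n2 sQ cl.
rewrite !mem_edges_mid in n1 n2.
split.
- by rewrite rot_mid; apply: simp_catC.
- by apply: contraNneq n1 => ->; rewrite /= inE eqxx.
- by apply: contraNneq n2 => ->; rewrite /= inE eqxx orbT.
- move=> z /cl h; rewrite rot_mid => k; apply: h; exact/on_catC.
Qed.

Lemma triangle_of_size Q : size Q = 3%N -> exists a b c, Q = [:: a; b; c].
Proof. by case: Q => [|a [|b [|c [|]]]] // _; exists a, b, c. Qed.

Lemma chord_sizes c A d X Y : chord c A d (Y ++ X) ->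
  (size (c :: A ++ [:: d]) < size (X ++ c :: A ++ d :: Y))%N /\
  (size (X ++ c :: d :: Y) < size (X ++ c :: A ++ d :: Y))%N.
Proof.
case=> _ An Bn _.
have hA : (0 < size A)%N by case: (A) An.
have hB : (0 < size X + size Y)%N by rewrite addnC -size_cat; case: (Y ++ X) Bn.
by rewrite /= !size_cat /= !size_cat /=; lia.
Qed.

Lemma chord_simp2s c A d X Y : chord c A d (Y ++ X) -> simple_cycle (X ++ c :: d :: Y).
Proof.
by move=> /chord_simp2; rewrite rot_mid2 rot_mid2'; apply: simp_catC.
Qed.

Lemma connected_rot A B : connected_odd_side (A ++ B) -> connected_odd_side (B ++ A).
Proof.
move=> h x y /ins_catC hx /ins_catC hy; apply: link_mono (h x y hx hy).
by move=> z /ins_catC.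
Qed.

(** Both parts beside an inner diagonal have fewer vertices. Their connectedness is what [split_ins]
    asks for and also what leads every point to the diagonal. *)
Lemma odd_side_connected Q : simple_cycle Q -> connected_odd_side Q.
Proof.
move: {2}(size Q) (leqnn (size Q)) => n; elim: n Q => [|n IH] Q sz sQ.
  by case: sQ; rewrite leqn0 in sz; move/eqP: sz => ->.
have [h3 _ _] := sQ; have [E|n3] := eqVneq (size Q) 3%N.
  have [a [b [c EQ]]] := triangle_of_size E; subst; exact: triangle_connected.
have h4 : (3 < size Q)%N by lia.
have [c [d [cQ dQ cd /andP[n1 n2] [cl [m mo pm]]]]] := inner_diagonal sQ h4.
have [X [c' [A [d' [Y [E ch oE]]]]]] := split_chord sQ cQ dQ cd n1 n2 cl; subst Q.
have [s1 s2] := chord_sizes ch.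
have con1 : connected_odd_side (c' :: A ++ [:: d']) by apply: IH (chord_simp1 ch); lia.
have con2 : connected_odd_side (d' :: (Y ++ X) ++ [:: c']).
  rewrite rot_mid2; apply: connected_rot; rewrite -rot_mid2'.
  by apply: IH (chord_simp2s ch); lia.
rewrite -oE in mo.
have pm' : parity (c' :: A ++ d' :: (Y ++ X)) m by rewrite rot_mid par_catC.
have spl := split_ins ch con1 con2 mo pm'.
apply: connected_rot; rewrite -rot_mid => x y hx hy.
have lx := link_chord ch spl con1 con2 mo hx; have ly := link_chord ch spl con1 con2 mo hy.
exact: link_trans lx (link_sym ly).
Qed.

Definition inner_step X c A d Y := [/\ forall z, odd_side (c :: A ++ [:: d]) z -> odd_side (X ++ c :: A ++ d :: Y) z,
  forall z, odd_side (X ++ c :: d :: Y) z -> odd_side (X ++ c :: A ++ d :: Y) z,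
  forall z, oseg c d z -> odd_side (X ++ c :: A ++ d :: Y) z &
  forall z, odd_side (X ++ c :: A ++ d :: Y) z ->
   [\/ odd_side (c :: A ++ [:: d]) z, odd_side (X ++ c :: d :: Y) z | oseg c d z]].

(** Triangulation in the form of an induction principle. *)
Lemma inner_ind (Phi : seq pt -> Prop) :
  (forall a b c, simple_cycle [:: a; b; c] -> Phi [:: a; b; c]) ->
  (forall X c A d Y, simple_cycle (c :: A ++ [:: d]) -> simple_cycle (X ++ c :: d :: Y) ->
    inner_step X c A d Y -> Phi (c :: A ++ [:: d]) -> Phi (X ++ c :: d :: Y) ->
    Phi (X ++ c :: A ++ d :: Y)) ->
  forall Q, simple_cycle Q -> Phi Q.
Proof.
move=> base step Q; move: {2}(size Q) (leqnn (size Q)) => n.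
elim: n Q => [|n IH] Q sz sQ.
  by case: sQ; rewrite leqn0 in sz; move/eqP: sz => ->.
have [h3 _ _] := sQ; have [E|n3] := eqVneq (size Q) 3%N.
  have [a [b [c EQ]]] := triangle_of_size E; subst; exact: base.
have h4 : (3 < size Q)%N by lia.
have [c [d [cQ dQ cd /andP[n1 n2] [cl [m mo pm]]]]] := inner_diagonal sQ h4.
have [X [c' [A [d' [Y [E ch oE]]]]]] := split_chord sQ cQ dQ cd n1 n2 cl; subst Q.
have [s1 s2] := chord_sizes ch.
have sP1 := chord_simp1 ch; have sP2 := chord_simp2s ch.
apply: step => //; [| by apply: IH sP1; lia | by apply: IH sP2; lia].
rewrite -oE in mo.
have pm' : parity (c' :: A ++ d' :: (Y ++ X)) m by rewrite rot_mid par_catC.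
have [i1 i2 io cov] := split_ins ch (odd_side_connected sP1) (odd_side_connected (chord_simp2 ch)) mo pm'.
rewrite rot_mid in i1 i2 io cov; rewrite rot_mid2 in i2 cov; split=> z hz.
- by apply/ins_catC; apply: i1.
- by apply/ins_catC; apply: i2; apply/ins_catC; rewrite -rot_mid2'.
- by apply/ins_catC; apply: io.
- case: (cov z) => [|h|h|h]; first exact/ins_catC.
  + by apply: Or31.
  + by apply: Or32; rewrite rot_mid2'; apply/ins_catC.
  + by apply: Or33.
Qed.

Definition odd_or_edge Q x : Prop := odd_side Q x \/ exists2 e, e \in edges Q & oseg e.1 e.2 x.
(** A point on an open edge may also look along this edge. When the edge is a diagonal of a larger
    polygon, it belongs to the odd side there. *)
Definition view Q x : set pt :=
  [set z | odd_side Q z \/ exists2 e, e \in edges Q & oseg e.1 e.2 x /\ oseg e.1 e.2 z].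

Lemma oseg_end s t x z : oseg s t x -> oseg x s z -> oseg s t z.
Proof.
move=> [r hr ->]; rewrite osegC => -[q hq ->]; rewrite lerp_lerp.
by exists (q * r) => //; nra.
Qed.

Lemma triangle_view a b c x v : simple_cycle [:: a; b; c] -> odd_or_edge [:: a; b; c] x -> v \in [:: a; b; c] ->
  oseg x v `<=` view [:: a; b; c] x.
Proof.
move=> sT hx vT z hz; case: hx => [hx|[e he hx]].
  by left; apply: triangle_sees hx vT hz.
have [E|n1] := eqVneq v e.1.
  by right; exists e => //; split=> //; apply: oseg_end hx _; rewrite -E.
have [E|n2] := eqVneq v e.2.
  right; exists e => //; split=> //; rewrite osegC; apply: (oseg_end (x := x)).
    by rewrite osegC.
  by rewrite -E.
by left; apply: triangle_edge_sees he hx vT n1 n2 hz.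
Qed.

Lemma view_step1 X c A d Y x : inner_step X c A d Y ->
  view (c :: A ++ [:: d]) x `<=` view (X ++ c :: A ++ d :: Y) x.
Proof.
move=> [i1 i2 io _] z [hz|[e he [hx hz]]]; first by left; apply: i1.
move: he; rewrite mem_edges_mid1 // => /orP[he|/eqP E].
  by right; exists e => //; rewrite mem_edges_mid he.
by left; apply: io; rewrite osegC; rewrite E in hz.
Qed.

Lemma view_step2 X c A d Y x : inner_step X c A d Y ->
  view (X ++ c :: d :: Y) x `<=` view (X ++ c :: A ++ d :: Y) x.
Proof.
move=> [i1 i2 io _] z [hz|[e he [hx hz]]]; first by left; apply: i2.
move: he; rewrite mem_edges_mid2 // => /orP[he|/eqP E].
  by right; exists e => //; rewrite mem_edges_mid he orbT.
by left; apply: io; rewrite E in hz.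
Qed.

(** A point on the diagonal is assigned to the second part. *)
Lemma dom_step X c A d Y x : inner_step X c A d Y -> odd_or_edge (X ++ c :: A ++ d :: Y) x ->
  odd_or_edge (c :: A ++ [:: d]) x \/ odd_or_edge (X ++ c :: d :: Y) x.
Proof.
move=> [_ _ _ cov] [/cov[h|h|h]|[e he hx]].
- by left; left.
- by right; left.
- by right; right; exists (c, d) => //; rewrite mem_edges_mid2 // eqxx orbT.
- move: he; rewrite mem_edges_mid => /orP[he|he].
    by left; right; exists e => //; rewrite mem_edges_mid1 // he.
  by right; right; exists e => //; rewrite mem_edges_mid2 // he.
Qed.

Lemma mid_sub1 X c A d Y : {subset c :: A ++ [:: d] <= X ++ c :: A ++ d :: Y}.
Proof. by move=> z; rewrite !(mem_cat, inE) => /or3P[->|->|->]; rewrite ?orbT. Qed.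
Lemma mid_sub2 X c A d Y : {subset X ++ c :: d :: Y <= X ++ c :: A ++ d :: Y}.
Proof. by move=> z; rewrite !(mem_cat, inE) => /or4P[->|->|->|->]; rewrite ?orbT. Qed.

Definition sees (W : set pt) (V : pt -> Prop) x (k : nat) :=
  exists r : seq pt, [/\ uniq r, size r = k & forall v, v \in r -> V v /\ oseg x v `<=` W].

Lemma sees_mono (W W' : set pt) (V V' : pt -> Prop) x k : W `<=` W' -> (forall v, V v -> V' v) ->
  sees W V x k -> sees W' V' x k.
Proof.
move=> hW hV [r [u s h]]; exists r; split=> // v /h[Vv o]; split; first exact: hV.
by move=> z /o /hW.
Qed.

Lemma inner_sees Q x : simple_cycle Q -> odd_or_edge Q x -> sees (view Q x) (fun v => v \in Q) x 3.
Proof.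
move=> sQ; move: Q sQ x; apply: inner_ind => [a b c sT x hx|X c A d Y _ _ st IH1 IH2 x hx].
  exists [:: a; b; c]; split=> //; first exact: simp_uniq.
  by move=> v hv; split=> //; apply: triangle_view.
case: (dom_step st hx) => h.
  apply: sees_mono (IH1 x h); [exact: view_step1 | exact: mid_sub1].
apply: sees_mono (IH2 x h); [exact: view_step2 | exact: mid_sub2].
Qed.

(** * Pairs of points and ranges of indices *)

Section Keys.
Variable key : pt -> nat.

(** Ranges of indices for the two arcs cut by a chord; its ends, at [lo] and [hi], count for
    both. *)
Definition insideI Q (lo hi : nat) v := v \in Q /\ (lo <= key v <= hi)%N.
Definition outsideI Q (lo hi : nat) v := v \in Q /\ ((key v <= lo) || (hi <= key v))%N.

(** [K] bounds the sum because only the sum enters the length of the gaps: it is 3 + 3 in the odd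
    side and 3 + 2 in the even side. *)
Definition pair_sees (Wx Wy : set pt) Q x y (K : nat) :=
  (exists2 v, v \in Q & oseg x v `<=` Wx /\ oseg y v `<=` Wy) \/
  exists lo hi k1 k2, [/\ (K <= k1 + k2)%N, (1 < k1)%N, (1 < k2)%N &
    (sees Wx (insideI Q lo hi) x k1 /\ sees Wy (outsideI Q lo hi) y k2) \/
    (sees Wx (outsideI Q lo hi) x k1 /\ sees Wy (insideI Q lo hi) y k2)].

Lemma pair_sees_mono (Wx Wy Wx' Wy' : set pt) Q Q' x y K : Wx `<=` Wx' -> Wy `<=` Wy' ->
  {subset Q <= Q'} -> pair_sees Wx Wy Q x y K -> pair_sees Wx' Wy' Q' x y K.
Proof.
move=> hx hy hQ [[v vQ [h1 h2]]|[lo [hi [k1 [k2 [hK h1 h2 h]]]]]].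
  left; exists v; first exact: hQ.
  by split=> z; [move/h1/hx | move/h2/hy].
right; exists lo, hi, k1, k2; split=> //.
have iQ v : insideI Q lo hi v -> insideI Q' lo hi v by case=> /hQ ? ?; split.
have oQ v : outsideI Q lo hi v -> outsideI Q' lo hi v by case=> /hQ ? ?; split.
by case: h => -[a b]; [left|right]; split; (apply: sees_mono; [| |eassumption]).
Qed.

Definition incr Q := sorted ltn (map key Q).

Lemma incr_sub Q Q' : subseq Q' Q -> incr Q -> incr Q'.
Proof. by move=> h; apply: subseq_sorted; [exact: ltn_trans | exact: map_subseq]. Qed.

Lemma mid_subseq1 X c A d Y : subseq (c :: A ++ [:: d]) (X ++ c :: A ++ d :: Y).
Proof.
apply: subseq_trans (suffix_subseq X _); rewrite -!cat_cons; apply: cat_subseq => //.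
exact: (prefix_subseq [:: d] Y).
Qed.
Lemma mid_subseq2 X c A d Y : subseq (X ++ c :: d :: Y) (X ++ c :: A ++ d :: Y).
Proof.
apply: cat_subseq => //; rewrite -[c :: d :: Y]cat1s -[c :: A ++ _]cat1s.
by apply: cat_subseq => //; apply: suffix_subseq.
Qed.

Lemma incr_mid1 X c A d Y v : incr (X ++ c :: A ++ d :: Y) -> v \in c :: A ++ [:: d] ->
  (key c <= key v <= key d)%N.
Proof.
move=> /(incr_sub (mid_subseq1 X c A d Y)); rewrite /incr (sorted_pairwise ltn_trans) /= map_cat.
rewrite pairwise_cat all_cat /= andbT => /andP[/andP[h1 h2] /andP[h3 _]].
rewrite !inE mem_cat inE => /or3P[/eqP->|vA|/eqP->]; rewrite ?leqnn ?(ltnW h2) //.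
have kv : key v \in map key A by apply: map_f.
have := allP h1 _ kv; move: h3; rewrite allrel1r => /allP /(_ _ kv) a b.
by apply/andP; split; apply: ltnW.
Qed.

Lemma incr_mid2 X c A d Y v : incr (X ++ c :: A ++ d :: Y) -> v \in X ++ c :: d :: Y ->
  ((key v <= key c) || (key d <= key v))%N.
Proof.
move=> /(incr_sub (mid_subseq2 X c A d Y)); rewrite /incr (sorted_pairwise ltn_trans) map_cat /=.
rewrite pairwise_cat /= => /and3P[h1 _ /and3P[_ h2 _]].
rewrite mem_cat !inE => /or4P[vX|/eqP->|/eqP->|vY]; rewrite ?leqnn ?orbT //.
  have kv : key v \in map key X by apply: map_f.
  by have := allrelP h1 (key v) (key c) kv (mem_head _ _) => /ltnW ->.
have kv : key v \in map key Y by apply: map_f.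
by have := allP h2 _ kv => /ltnW ->; rewrite orbT.
Qed.

(** The two points are followed through the triangulation until a diagonal separates them; if none
    does, they end in one triangle and share its vertices. *)
Lemma inner_pair Q x y : simple_cycle Q -> incr Q -> odd_or_edge Q x -> odd_or_edge Q y ->
  pair_sees (view Q x) (view Q y) Q x y 6.
Proof.
move=> sQ; move: Q sQ x y; apply: inner_ind => [a b c sT x y _ hx hy|X c A d Y s1 s2 st IH1 IH2 x y iQ hx hy].
  by left; exists a; rewrite ?mem_head //; split; apply: triangle_view; rewrite ?mem_head.
have i1 : incr (c :: A ++ [:: d]) := incr_sub (mid_subseq1 X c A d Y) iQ.
have i2 : incr (X ++ c :: d :: Y) := incr_sub (mid_subseq2 X c A d Y) iQ.
have sees1 z : odd_or_edge (c :: A ++ [:: d]) z ->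
    sees (view (X ++ c :: A ++ d :: Y) z) (insideI (X ++ c :: A ++ d :: Y) (key c) (key d)) z 3.
  move=> hz; apply: sees_mono (inner_sees s1 hz); first exact: view_step1.
  by move=> v hv; split; [exact: mid_sub1 hv | apply: incr_mid1 iQ hv].
have sees2 z : odd_or_edge (X ++ c :: d :: Y) z ->
    sees (view (X ++ c :: A ++ d :: Y) z) (outsideI (X ++ c :: A ++ d :: Y) (key c) (key d)) z 3.
  move=> hz; apply: sees_mono (inner_sees s2 hz); first exact: view_step2.
  by move=> v hv; split; [exact: mid_sub2 hv | apply: incr_mid2 iQ hv].
case: (dom_step st hx) => h1; case: (dom_step st hy) => h2.
- apply: pair_sees_mono (IH1 x y i1 h1 h2); [exact: view_step1.. | exact: mid_sub1].
- right; exists (key c), (key d), 3%N, 3%N; split=> //; left; split; [exact: sees1 | exact: sees2].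
- right; exists (key c), (key d), 3%N, 3%N; split=> //; right; split; [exact: sees2 | exact: sees1].
- apply: pair_sees_mono (IH2 x y i2 h1 h2); [exact: view_step2.. | exact: mid_sub2].
Qed.

End Keys.
End Inner.

(** * Convex hull and lids *)

Lemma path_closed (T : eqType) (E : seq (T * T)) (Pr : T -> T -> Prop) (d : T) (A : seq T) (c : T) :
  {subset path_edges c A d <= E} ->
  (forall s t t', (s, t) \in E -> (t, t') \in E -> Pr s t -> Pr t t') ->
  (forall t, (c, t) \in path_edges c A d -> exists2 s, (s, c) \in E & Pr s c) ->
  forall e, e \in path_edges c A d -> Pr e.1 e.2.
Proof.
move=> sub step.
have aux : forall c s, {subset path_edges c A d <= E} -> (s, c) \in E -> Pr s c ->
    forall e, e \in path_edges c A d -> Pr e.1 e.2.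
  elim: A {sub} => [|x A IH] c' s sub' he hP e.
    by rewrite inE => /eqP -> /=; apply: step he _ hP; apply: sub'; rewrite /= mem_head.
  have h1 : (c', x) \in E by apply: sub'; rewrite /= mem_head.
  have P1 : Pr c' x by apply: step he h1 hP.
  rewrite /= inE => /orP[/eqP->//|]; apply: (IH x c') => // f hf.
  by apply: sub'; rewrite /= inE hf orbT.
move=> first.
have [t ht] : exists t, (c, t) \in path_edges c A d.
  by case: (A) => [|x A']; [exists d | exists x]; rewrite /= mem_head.
by have [s h1 h2] := first t ht; apply: aux h1 h2.
Qed.

Section Hull.
Variable R : realType.
Local Notation pt := (R * R)%type.
Implicit Types (x y z s t u v w : pt) (Q A B X Y : seq pt) (e : pt * pt).

(** Seen from [v], all of [L] lies in an open half-plane, so its directions are ordered by the slope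
    [b / a] in the frame of [u]. An extreme slope gives a tangent, and the sign of [k] tells which;
    ties go to the first point along [u]. *)
Lemma tangent (L : seq pt) (k : R) v u : L != [::] -> k != 0 ->
  (forall z, z \in L -> dot u v < dot u z) ->
  exists2 e, e \in L & forall z, z \in L -> 0 <= k * det v e z /\
     (det v e z = 0 -> dot u e <= dot u z).
Proof.
move=> Ln k0 hu.
pose a z := dot u z - dot u v.
pose b z := u.1 * (z.2 - v.2) - u.2 * (z.1 - v.1).
pose sl z := k * b z / a z.
have a0 z : z \in L -> 0 < a z by move=> /hu; rewrite /a; lra.
have [v1 v1L hv1] := argmin sl Ln.
have [|e] := @argmin _ (dot u) [seq q <- L | sl q == sl v1].
  apply/eqP => E; have := mem_filter (fun q => sl q == sl v1) v1 L.
  by rewrite E eqxx v1L.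
rewrite mem_filter => /andP[/eqP se eL] he.
have N : 0 < u.1 ^+ 2 + u.2 ^+ 2.
  rewrite lt_neqAle addr_ge0 ?sqr_ge0 // andbT eq_sym paddr_eq0 ?sqr_ge0 // !sqrf_eq0.
  apply/negP => /andP[/eqP E1 /eqP E2]; have := a0 e eL; rewrite /a /dot E1 E2; lra.
(* [u] and its rotation form an orthogonal frame of scale [|u|^2], which turns a difference of
   slopes into a determinant. *)
have key z : z \in L -> (u.1 ^+ 2 + u.2 ^+ 2) * (k * det v e z) = a e * a z * (sl z - sl e).
  move=> zL; have -> : a e * a z * (sl z - sl e) = k * (a e * b z - b e * a z).
    rewrite /sl; have := a0 z zL; have := a0 e eL => h1 h2; field.
    by rewrite !gt_eqF.
  rewrite /a /b /dot /det; ring.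
exists e => // z zL; have := key z zL; have h : sl e <= sl z by rewrite se; apply: hv1.
have ae := a0 e eL; have az := a0 z zL; split.
  rewrite -(pmulr_rge0 _ N) H //; apply: mulr_ge0; last lra.
  by apply: mulr_ge0; apply: ltW.
move=> d0; apply: he; rewrite mem_filter zL andbT -se; apply/eqP.
move: H; rewrite d0 !mulr0 => /esym/eqP; rewrite !mulf_eq0 (gt_eqF ae) (gt_eqF az) /= subr_eq0.
by move/eqP.
Qed.

Lemma mix0 (a b r : R) : 0 <= r <= 1 -> 0 <= a -> 0 <= b -> (1 - r) * a + r * b = 0 ->
  [\/ a = 0 /\ b = 0, a = 0 /\ r = 0 | b = 0 /\ r = 1].
Proof.
move=> hr ha hb E.
have E1 : (1 - r) * a = 0 by nra.
have E2 : r * b = 0 by nra.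
move/eqP: E1; rewrite mulf_eq0 => /orP[/eqP r1|/eqP a0].
  by apply: Or33; split; [move: E2; rewrite (_ : r = 1); lra | lra].
move/eqP: E2; rewrite mulf_eq0 => /orP[/eqP r0|/eqP b0]; first exact: Or32.
exact: Or31.
Qed.

(** The line [v e] supports [Q], so an edge meeting it does so at an end or lies along it. The ends
    on this line are not nearer to [v] than [e], in direction [u]. *)
Lemma tangent_clear Q L (k : R) v u (e : pt) : k != 0 -> {subset Q <= v :: L} -> v \notin Q ->
  e \in Q ->
  (forall z, z \in L -> dot u v < dot u z) ->
  (forall z, z \in L -> 0 <= k * det v e z /\ (det v e z = 0 -> dot u e <= dot u z)) ->
  forall q, oseg v e q -> ~ on Q q.
Proof.
move=> k0 sub vQ eQ hu h q [r hr ->] [f he [t ht E]].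
have inL z : z \in Q -> z \in L.
  by move=> zQ; move: (sub z zQ); rewrite inE => /orP[/eqP E'|//]; move: vQ; rewrite -E' zQ.
have h1 := h _ (inL _ (edge_src he)); have h2 := h _ (inL _ (edge_tgt he)).
have D : (1 - t) * (k * det v e f.1) + t * (k * det v e f.2) = 0.
  have E1 : det v e (lerp v e r) = 0 by rewrite det_lerp /det; ring.
  rewrite [LHS](_ : _ = k * ((1 - t) * det v e f.1 + t * det v e f.2)); last by ring.
  by rewrite -det_lerp -E E1 mulr0.
have ue := hu e (inL e eQ).
have U : dot u (lerp v e r) < dot u e by rewrite dot_lerp; nra.
have Z z : k * det v e z = 0 -> det v e z = 0.
  by move/eqP; rewrite mulf_eq0 (negPf k0) => /eqP.
case: (mix0 ht h1.1 h2.1 D) => -[e1 e2]; move: U; rewrite E.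
- by rewrite dot_lerp; have := mix_ge ht (h1.2 (Z _ e1)) (h2.2 (Z _ e2)); lra.
- by rewrite e2 lerp0; have := h1.2 (Z _ e1); lra.
- by rewrite e2 lerp1; have := h2.2 (Z _ e1); lra.
Qed.

(** [[c, d]] joins neighbouring vertices on the boundary of the convex hull; the sign of [k] tells
    on which side the hull lies. *)
Definition hullpair Q (k : R) c d := [/\ c \in Q, d \in Q, c != d,
  forall z, z \in Q -> 0 <= k * det c d z & forall z, z \in Q -> ~ oseg c d z].

Lemma hull_tangent Q (k : R) v : simple_cycle Q -> k != 0 -> v \in Q ->
  outer v [seq z <- Q | z != v] -> exists e : pt, hullpair Q k v e.
Proof.
move=> sQ k0 vQ [u hu].
have Ln : [seq z <- Q | z != v] != [::].
  have [w hw] := edge_from vQ; have [sz _ _] := sQ.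
  have := edge_neq (simp_uniq sQ) (ltnW sz) hw => /= vw; have wQ := edge_tgt hw.
  apply/eqP => E; have := mem_filter (fun z => z != v) w Q.
  by rewrite E in_nil /= eq_sym vw wQ.
have [e eL he] := tangent Ln k0 hu.
have := eL; rewrite mem_filter => /andP[ev eQ].
exists e; split=> //; first by rewrite eq_sym.
  move=> z zQ; have [->|zv] := eqVneq z v.
    by rewrite (_ : det v e v = 0) ?mulr0 // /det; ring.
  by apply: (he z _).1; rewrite mem_filter zv.
move=> z zQ [r hr zE]; have ue := hu e eL.
have U : dot u z < dot u e by rewrite zE dot_lerp; nra.
have V : dot u v < dot u z by rewrite zE dot_lerp; nra.
have zv : z != v by apply: contraTneq V => ->; rewrite ltxx.
have : dot u e <= dot u z.
  apply: (he z _).2; first by rewrite mem_filter zv.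
  by rewrite zE det_lerp /det; ring.
lra.
Qed.

(** If there are vertices on the line [c d] beyond [d], the nearest of them comes next; otherwise
    [d] is separated from the other vertices and a tangent at [d] continues the boundary. *)
Lemma hull_step Q (k : R) c d : simple_cycle Q -> k != 0 -> hullpair Q k c d ->
  exists e : pt, hullpair Q k d e.
Proof.
move=> sQ k0 [cQ dQ cd hk no].
have cd1 : c.1 != d.1 by apply: contra cd => /eqP E; apply/eqP; apply: (simp_fst_inj sQ).
pose ah z := (d.1 - c.1) * (z.1 - d.1).
have [L0|Ln] := eqVneq [seq z <- Q | (det c d z == 0) && (0 < ah z)] [::].
  apply: hull_tangent => //.
  apply: (@outer_tilt _ d (scale k (perp c d)) (- (d.1 - c.1), 0)) => z.
  rewrite mem_filter => /andP[zd zQ]; rewrite !dot_scale.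
  have := hk z zQ; have := det_dot c d z; have := det_dot c d d.
  rewrite (_ : det c d d = 0); last by rewrite /det; ring.
  move=> E1 E2; rewrite le_eqVlt => /orP[/eqP E|h]; last by left; rewrite E2 in h; nra.
  right; split; first by rewrite E2 in E; nra.
  have dz : det c d z = 0 by apply/eqP; move/esym/eqP: E; rewrite mulf_eq0 (negPf k0).
  have : ah z <= 0.
    rewrite leNgt; apply/negP => h; have := mem_filter (fun z => (det c d z == 0) && (0 < ah z)) z Q.
    by rewrite L0 dz eqxx h zQ.
  rewrite le_eqVlt => /orP[|]; last by rewrite /ah /dot /=; nra.
  rewrite mulf_eq0 !subr_eq0 eq_sym (negPf cd1) /= => /eqP E3.
  by move: zd; rewrite (simp_fst_inj sQ zQ dQ E3) eqxx.
have [e] := argmin ah Ln; rewrite mem_filter => /andP[/andP[/eqP de ae] eQ] he.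
have ed : d != e by apply: contraTneq ae => <-; rewrite /ah subrr mulr0 ltxx.
pose q := (e.1 - d.1) / (d.1 - c.1).
have nz : d.1 - c.1 != 0 by rewrite subr_eq0 eq_sym.
have q0 : 0 < q.
  have -> : q = ah e / (d.1 - c.1) ^+ 2 by rewrite /q /ah; field.
  by rewrite divr_gt0 // exprn_even_gt0.
have dE z : det d e z = q * det c d z.
  have h : e.2 = d.2 + (d.2 - c.2) * (e.1 - d.1) / (d.1 - c.1).
    have E : (d.1 - c.1) * (e.2 - c.2) = (d.2 - c.2) * (e.1 - c.1) by move: de; rewrite /det; lra.
    have -> : e.2 = c.2 + (d.1 - c.1) * (e.2 - c.2) / (d.1 - c.1) by field.
    by rewrite E; field.
  by rewrite /q /det h; field.
exists e; split=> //.
  by move=> z zQ; rewrite dE mulrCA; apply: mulr_ge0; [apply: ltW | apply: hk].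
move=> z zQ [r hr zE].
have d0 : det c d z = 0.
  by rewrite zE det_lerp de (_ : det c d d = 0) ?mulr0 ?addr0 // /det; ring.
have az : ah z = r * ah e by rewrite zE /ah /lerp /=; ring.
have : ah e <= ah z by apply: he; rewrite mem_filter d0 eqxx az zQ andbT /=; nra.
rewrite az; nra.
Qed.

Lemma det_line c d z : c.1 != d.1 -> det c d z = 0 -> z = lerp c d ((z.1 - c.1) / (d.1 - c.1)).
Proof.
move=> cd1 dz; have nz : d.1 - c.1 != 0 by rewrite subr_eq0 eq_sym.
have E : (d.1 - c.1) * (z.2 - c.2) = (d.2 - c.2) * (z.1 - c.1) by move: dz; rewrite /det; lra.
apply: pt_eq; rewrite /lerp /=; first by field.
have -> : z.2 = c.2 + (d.1 - c.1) * (z.2 - c.2) / (d.1 - c.1) by field.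
by rewrite E; field.
Qed.

Lemma straddle (a b t q : R) : 0 <= t <= 1 -> (a <= 0 \/ 1 <= a) -> (b <= 0 \/ 1 <= b) ->
  0 < (1 - t) * a + t * b < 1 -> 0 <= q <= 1 -> exists2 r, 0 <= r <= 1 & (1 - r) * a + r * b = q.
Proof.
move=> ht ha hb hab hq; exists ((q - a) / (b - a)); last first.
  field; rewrite subr_eq0; apply/eqP => E; rewrite E in hab ha.
  have h : (1 - t) * a + t * a = a by ring.
  by rewrite h in hab; case: ha; lra.
case: ha hb => ha [] hb.
- by have := mix_le ht ha hb; lra.
- by rewrite divr_ge0 ?ler_pdivrMr //=; lra.
- rewrite -[b - a]opprB -[q - a]opprB invrN mulrNN.
  by rewrite divr_ge0 ?ler_pdivrMr //=; lra.
- by have := mix_ge ht ha hb; lra.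
Qed.

(** The line supports [Q] and no vertex lies between [c] and [d], so an edge meeting the open
    segment lies along the line and covers it. Then [c] and [d] are the ends of this edge. *)
Lemma hull_clear Q (k : R) c d : simple_cycle Q -> k != 0 -> hullpair Q k c d ->
  (c, d) \notin edges Q -> (d, c) \notin edges Q -> forall z, oseg c d z -> ~ on Q z.
Proof.
move=> sQ k0 [cQ dQ cd hk no] n1 n2 z hz [e he [t ht E]].
have cd1 : c.1 != d.1 by apply: contra cd => /eqP E'; apply/eqP; apply: (simp_fst_inj sQ).
have nz : d.1 - c.1 != 0 by rewrite subr_eq0 eq_sym.
have sE := edge_src he; have tE := edge_tgt he.
have dz : det c d z = 0.
  by case: hz => r hr ->; rewrite det_lerp /det; ring.
have D : (1 - t) * (k * det c d e.1) + t * (k * det c d e.2) = 0.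
  rewrite [LHS](_ : _ = k * ((1 - t) * det c d e.1 + t * det c d e.2)); last by ring.
  by rewrite -det_lerp -E dz mulr0.
have Z q : k * det c d q = 0 -> det c d q = 0.
  by move/eqP; rewrite mulf_eq0 (negPf k0) => /eqP.
case: (mix0 ht (hk _ sE) (hk _ tE) D) => -[/Z e1 e2]; last first.
- by apply: (no _ tE); move: hz; rewrite E e2 lerp1.
- by apply: (no _ sE); move: hz; rewrite E e2 lerp0.
move/Z in e2.
have [a aE] : exists a, e.1 = lerp c d a by exists ((e.1.1 - c.1) / (d.1 - c.1)); apply: det_line.
have [b bE] : exists b, e.2 = lerp c d b by exists ((e.2.1 - c.1) / (d.1 - c.1)); apply: det_line.
have ends q : lerp c d q \in Q -> q <= 0 \/ 1 <= q.
  move=> qQ; case: (lerP q 0) => h1; first by left.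
  case: (lerP 1 q) => h2; first by right.
  by case: (no _ qQ); exists q => //; lra.
have ha : a <= 0 \/ 1 <= a by apply: ends; rewrite -aE.
have hb : b <= 0 \/ 1 <= b by apply: ends; rewrite -bE.
have hr : 0 < (1 - t) * a + t * b < 1.
  case: hz => r hr zE; move: E; rewrite zE aE bE lerp_lerp2 => /(congr1 fst) /= E.
  have : (r - ((1 - t) * a + t * b)) * (d.1 - c.1) == 0 by apply/eqP; lra.
  by rewrite mulf_eq0 (negPf nz) orbF subr_eq0 => /eqP <-.
have cov q : 0 <= q <= 1 -> cseg e.1 e.2 (lerp c d q).
  by move=> hq; have [r' hr' <-] := straddle ht ha hb hr hq; exists r'; rewrite // aE bE lerp_lerp2.
have hc : cseg e.1 e.2 c by rewrite -[c](lerp0 c d); apply: cov; lra.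
have hd : cseg e.1 e.2 d by rewrite -[d](lerp1 c d); apply: cov; lra.
case: e he E {D sE tE e1 e2 aE bE cov} hc hd => s t' /= he _ hc hd.
case: (vertex_on sQ cQ he hc) => /= Ec; case: (vertex_on sQ dQ he hd) => /= Ed; subst.
- by rewrite eqxx in cd.
- by rewrite he in n1.
- by rewrite he in n2.
- by rewrite eqxx in cd.
Qed.

(** Moving [m] outwards, against the normal of the supporting line, separates it from [Q] at
    once. *)
Lemma hull_even Q (k : R) c d m : simple_cycle Q -> k != 0 -> hullpair Q k c d -> oseg c d m ->
  ~ on Q m -> ~~ parity Q m.
Proof.
move=> sQ k0 [cQ dQ cd hk no] hm nm.
have dm : det c d m = 0 by case: hm => r hr ->; rewrite det_lerp /det; ring.
pose u := scale k (perp c d); pose m' : pt := (m.1 - u.1, m.2 - u.2).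
have N : 0 < u.1 ^+ 2 + u.2 ^+ 2.
  rewrite lt_neqAle addr_ge0 ?sqr_ge0 // andbT eq_sym paddr_eq0 ?sqr_ge0 // !sqrf_eq0.
  rewrite /u /scale /perp /= !mulf_eq0 (negPf k0) /= oppr_eq0 !subr_eq0.
  by apply/negP => /andP[/eqP E2 /eqP E1]; move/eqP: cd; apply; apply: pt_eq.
have out r : 0 < r -> outer (lerp m m' r) Q.
  move=> r0; exists u => z zQ; have := hk z zQ; rewrite det_dot mulrBr -!dot_scale -/u.
  have : k * det c d m = dot u m - dot u c by rewrite det_dot mulrBr -!dot_scale.
  rewrite dm mulr0.
  have -> : dot u (lerp m m' r) = dot u m - r * (u.1 ^+ 2 + u.2 ^+ 2).
    by rewrite /m' /dot /lerp /=; ring.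
  have : 0 < r * (u.1 ^+ 2 + u.2 ^+ 2) by rewrite mulr_gt0.
  lra.
rewrite (par_simp (y := m') sQ).
  by rewrite outer_par // -(lerp1 m m'); apply: out.
move=> z [r hr ->]; have [->|r0] := eqVneq r 0; first by rewrite lerp0.
by apply: outer_off; apply: out; rewrite lt_neqAle eq_sym r0; lra.
Qed.

(** A point violating the half-plane of an edge is separated by that edge. Any other point off [Q]
    is joined, off [Q], to a point [g] strictly inside all half-planes, and so is an odd point found
    beside an edge; hence it is odd. *)
Lemma convex_outer Q (k : R) x : simple_cycle Q -> k != 0 ->
  (forall e, e \in edges Q -> forall z, z \in Q -> 0 <= k * det e.1 e.2 z) ->
  even_side Q x -> outer x Q.
Proof.
move=> sQ k0 cv ox.
have [[e he hx]|nx] := pselect (exists2 e, e \in edges Q & k * det e.1 e.2 x < 0).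
  exists (scale k (perp e.1 e.2)) => z zQ; rewrite !dot_scale.
  by have := cv e he z zQ; rewrite !det_dot in hx *; lra.
have out p : odd_side Q p -> forall e, e \in edges Q -> 0 <= k * det e.1 e.2 p.
  move=> [_ pp] e he; rewrite leNgt; apply/negP => h.
  suff : parity Q p = false by rewrite pp.
  apply: outer_par => //; exists (scale k (perp e.1 e.2)) => z zQ; rewrite !dot_scale.
  by have := cv e he z zQ; rewrite !det_dot in h *; lra.
have px e : e \in edges Q -> 0 <= k * det e.1 e.2 x.
  by move=> he; rewrite leNgt; apply/negP => h; apply: nx; exists e.
have [v vQ _] := leftmost sQ.
have [w evw] := edge_from vQ; set f := (v, w) in evw.
(* Averaging with a vertex off the line of [e] makes the inequality for [e] strict and keeps those
   already strict. *)
have [g hg1] : exists g, forall e, e \in edges Q -> 0 < k * det e.1 e.2 g.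
  suff H (L : seq (pt * pt)) : {subset L <= edges Q} -> exists2 g, (forall e, e \in L -> 0 < k * det e.1 e.2 g) &
      forall e, e \in edges Q -> 0 <= k * det e.1 e.2 g.
    by have [//|g h _] := H (edges Q); exists g.
  elim: L => [|e L IH] sub; first by exists v => // e he; apply: cv.
  have [|g h1 h2] := IH; first by move=> q hq; apply: sub; rewrite inE hq orbT.
  have he := sub e (mem_head _ _).
  have ne := edge_neq (simp_uniq sQ) (ltnW (simp_size sQ)) he.
  have [z zQ dz] := noncollinear sQ ne.
  have pz : 0 < k * det e.1 e.2 z.
    by rewrite lt_neqAle cv // andbT eq_sym mulf_eq0 negb_or k0.
  have E (q : pt * pt) : k * det q.1 q.2 (lerp g z (1 / 2)) =
      (k * det q.1 q.2 g) / 2 + (k * det q.1 q.2 z) / 2.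
    by rewrite det_lerp; field.
  exists (lerp g z (1 / 2)) => q hq; rewrite E.
    move: hq; rewrite inE => /orP[/eqP ->|hq]; first by have := h2 e he; lra.
    have hq' : q \in edges Q by apply: sub; rewrite inE hq orbT.
    by have := h1 q hq; have := cv q hq' z zQ; lra.
  by have := h2 q hq; have := cv q hq z zQ; lra.
have seg p : ~ on Q p -> (forall e, e \in edges Q -> 0 <= k * det e.1 e.2 p) -> parity Q p = parity Q g.
  move=> np hp; apply: par_simp => // q [r hr qE] [e he [t ht E]].
  have d0 : k * det e.1 e.2 q = 0 by rewrite E det_lerp /det; ring.
  move: d0; rewrite qE det_lerp => d0.
  have r0 : r = 0.
    have h1 := hp e he; have h2 := hg1 e he.
    have : r * (k * det e.1 e.2 g) = 0 by nra.
    by move/eqP; rewrite mulf_eq0 (gt_eqF h2) orbF => /eqP.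
  by apply: np; exists e => //; exists t => //; rewrite -E qE r0 lerp0.
have hm : oseg v w (lerp v w (1 / 2)) by exists (1 / 2) => //; lra.
have [//|//|p [_ [ip _ _ _ _]]] := @edge_sides _ Q f (lerp v w (1 / 2)) [::] sQ evw hm.
case: ox => nox pox; move: pox.
rewrite (seg x) // -(seg p) ?ip.2 //; first exact: ip.1.
exact: out.
Qed.

Definition lid Q c d := [/\ c \in Q, d \in Q, c != d,
  ((c, d) \notin edges Q) && ((d, c) \notin edges Q) &
  (forall z, oseg c d z -> ~ on Q z) /\ exists2 m, oseg c d m & ~~ parity Q m].

(** Without lids every side of the hull is an edge. Following the hull from the leftmost vertex,
    edge by edge, shows that [Q] is convex. *)
Lemma lid_or_outer Q : simple_cycle Q -> (exists c d, lid Q c d) \/ (forall x, even_side Q x -> outer x Q).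
Proof.
move=> sQ; have [|nolid] := pselect (exists c d, lid Q c d); [by left | right].
have adj (k : R) c d : k != 0 -> hullpair Q k c d -> (c, d) \in edges Q \/ (d, c) \in edges Q.
  move=> k0 hp; apply: contrapT => /not_orP[/negP n1 /negP n2]; apply: nolid; exists c, d.
  have [cQ dQ cd _ _] := hp; split=> //; first by rewrite n1.
  have cl := hull_clear sQ k0 hp n1 n2; split=> //.
  have mo : oseg c d (lerp c d (1 / 2)) by exists (1 / 2) => //; lra.
  by exists (lerp c d (1 / 2)) => //; apply: (hull_even sQ k0 hp mo); apply: cl.
have uQ := simp_uniq sQ.
have [v vQ hv] := leftmost sQ.
have ov : outer v [seq z <- Q | z != v].
  by exists (1, 0) => z; rewrite mem_filter => /andP[zv zQ]; rewrite /dot /=; have := hv z zQ zv; lra.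
have k1 : (1 : R) != 0 by apply/eqP; lra.
have k2 : (- 1 : R) != 0 by apply/eqP; lra.
(* The two tangents at [v] cannot both be the edge entering [v], as all vertices would then be
   collinear; so some sign of [k] follows the orientation of [Q]. *)
have [k [k0 [w [hp evw]]]] : exists k : R, k != 0 /\ exists w, hullpair Q k v w /\ (v, w) \in edges Q.
  have [e1 h1] := hull_tangent sQ k1 vQ ov; have [e2 h2] := hull_tangent sQ k2 vQ ov.
  case: (adj _ _ _ k1 h1) => a1; first by exists 1; split=> //; exists e1.
  case: (adj _ _ _ k2 h2) => a2; first by exists (-1); split=> //; exists e2.
  have [E] := edge_tgt_inj uQ a1 a2 erefl; subst e2.
  have [_ _ ne p1 _] := h1; have [_ _ _ p2 _] := h2.
  have [z zQ /eqP dz] := noncollinear sQ ne.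
  by have := p1 z zQ; have := p2 z zQ; lra.
(* The next side of the hull cannot turn back along the edge just used, again because the vertices
   are not collinear. *)
have step s t t' : (s, t) \in edges Q -> (t, t') \in edges Q -> hullpair Q k s t -> hullpair Q k t t'.
  move=> e1 e2 h; have [e he] := hull_step sQ k0 h.
  case: (adj _ _ _ k0 he) => a; first by have [->] := edge_src_inj uQ e2 a erefl.
  have [E] := edge_tgt_inj uQ a e1 erefl; subst e.
  have [_ _ ne p1 _] := h; have [_ _ _ p2 _] := he.
  have [z zQ dz] := noncollinear sQ ne.
  have E : det t s z = - det s t z by rewrite /det; ring.
  have /eqP : k * det s t z = 0.
    by have := p1 z zQ; have := p2 z zQ; rewrite E; lra.
  by rewrite mulf_eq0 (negPf k0) (negPf dz).
have all e : e \in edges Q -> hullpair Q k e.1 e.2.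
  have wQ := edge_tgt evw; rewrite /= in wQ.
  have [X [Y E]] := head_split wQ.
  have ee f : (f \in edges Q) = (f \in path_edges w (Y ++ X) w) by rewrite E mem_edges_catC.
  rewrite ee; apply: (@path_closed _ (edges Q)).
  - by move=> f; rewrite ee.
  - exact: step.
  - by move=> t _; exists v.
move=> x ox; apply: (convex_outer sQ k0) => // e he z zQ.
by have [_ _ _ h _] := all e he; apply: h.
Qed.

End Hull.

(** * Visibility from exterior points *)

Section Outer.
Variable R : realType.
Local Notation pt := (R * R)%type.
Implicit Types (x y z s t u v w c d : pt) (Q A B X Y S P : seq pt) (e : pt * pt).

(* P is a pocket cut off from Q by the lid [c, d], and S is Q with this pocket
   filled. *)
Definition outer_step Q P S c d := [/\ forall z, odd_side P z -> even_side Q z,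
  forall z, oseg c d z -> even_side Q z,
  forall z, even_side S z -> even_side Q z,
  forall z, even_side Q z -> odd_or_edge P z \/ even_side S z &
  forall z, outer z S -> outer z Q].

Definition cut_edges Q P c d :=
  (forall e, e \in edges P -> e \in edges Q \/ oseg e.1 e.2 = oseg c d) /\
  (forall m, oseg c d m -> (exists2 a, odd_side P a & cseg a m `<=` [set z | ~ on Q z])).

(** Either arc at the lid may be the pocket, so either list may occupy the inner range of
    indices. *)
Definition separated (key : pt -> nat) P S := exists lo hi,
  (forall v, v \in P -> (lo <= key v <= hi)%N) /\
    (forall v, v \in S -> ((key v <= lo) || (hi <= key v))%N) \/
  (forall v, v \in S -> (lo <= key v <= hi)%N) /\
    (forall v, v \in P -> ((key v <= lo) || (hi <= key v))%N).

(** If a vertex were as low as [z] in direction [u], the lowest one would belong to [A] and be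
    separated from the filled polygon, for which [A] is odd. *)
Lemma pocket_outer c A d B z : chord c A d B -> pocket c A d B ->
  outer z (d :: B ++ [:: c]) -> outer z (c :: A ++ d :: B).
Proof.
move=> ch [_ _ _ _ pA] [u hu].
have sS := chord_simp2 ch; have [sQ _ _ _] := ch.
have [q qQ hq] := argmin (dot u) (simp_nnil sQ).
exists u => v vQ; apply: lt_le_trans (hq v vQ).
rewrite ltNge; apply/negP => h.
have qA : q \in A.
  move: qQ; rewrite !inE mem_cat inE => /or4P[/eqP E|//|/eqP E|qB]; exfalso.
  - by have := hu c; rewrite !inE mem_cat inE eqxx !orbT => /(_ isT); rewrite -E; lra.
  - by have := hu d (mem_head _ _); rewrite -E; lra.
  - by have := hu q; rewrite !inE mem_cat qB orbT => /(_ isT); lra.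
have := pA q qA; rewrite outer_par //; exists u => v' /hu; lra.
Qed.

(** Only the filled polygon [S] carries an induction hypothesis; in the pocket [P] the results on
    odd sides apply. *)
Lemma outer_ind (Phi : seq pt -> Prop) :
  (forall Q, simple_cycle Q -> (forall x, even_side Q x -> outer x Q) -> Phi Q) ->
  (forall Q P S c d, simple_cycle Q -> simple_cycle P -> simple_cycle S -> outer_step Q P S c d -> cut_edges Q P c d ->
    (forall m, oseg c d m -> exists2 b, even_side S b & cseg b m `<=` [set z | ~ on Q z]) ->
    subseq P Q -> subseq S Q -> (forall key, incr key Q -> separated key P S) ->
    Phi S -> Phi Q) ->
  forall Q, simple_cycle Q -> Phi Q.
Proof.
move=> base step Q; move: {2}(size Q) (leqnn (size Q)) => n.
elim: n Q => [|n IH] Q sz sQ.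
  by case: sQ; rewrite leqn0 in sz; move/eqP: sz => ->.
have [[c [d [cQ dQ cd /andP[n1 n2] [cl [m mo pm]]]]]|] := lid_or_outer sQ; last exact: base.
have [X [c' [A [d' [Y [E ch oE]]]]]] := split_chord sQ cQ dQ cd n1 n2 cl; subst Q.
have [s1 s2] := chord_sizes ch.
have sP1 := chord_simp1 ch; have sP2 := chord_simp2s ch; have sP2r := chord_simp2 ch.
rewrite -oE in mo; have ch' := chord_sym ch.
have pm' : ~~ parity (c' :: A ++ d' :: (Y ++ X)) m by rewrite rot_mid par_catC.
have sub1 := mid_subseq1 X c' A d' Y; have sub2 := mid_subseq2 X c' A d' Y.
have [sQr An Bn clr] := ch; have [sQr' _ _ clr'] := ch'.
have onQ z : on (c' :: A ++ d' :: (Y ++ X)) z <-> on (X ++ c' :: A ++ d' :: Y) z.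
  by rewrite rot_mid; apply: on_catC.
have onQ' z : on (d' :: (Y ++ X) ++ c' :: A) z <-> on (X ++ c' :: A ++ d' :: Y) z.
  by apply: iff_trans (onQ z); apply: on_rot2.
have outQ z : even_side (c' :: A ++ d' :: (Y ++ X)) z <-> even_side (X ++ c' :: A ++ d' :: Y) z.
  by rewrite rot_mid; apply: outs_catC.
have outQ' z : even_side (d' :: (Y ++ X) ++ c' :: A) z <-> even_side (X ++ c' :: A ++ d' :: Y) z.
  apply: iff_trans (outQ z); exact: (@outs_catC _ (d' :: (Y ++ X)) (c' :: A)).
have outS z : even_side (d' :: (Y ++ X) ++ [:: c']) z <-> even_side (X ++ c' :: d' :: Y) z.
  by rewrite rot_mid2 rot_mid2'; apply: outs_catC.
have insS z : odd_side (d' :: (Y ++ X) ++ [:: c']) z <-> odd_side (X ++ c' :: d' :: Y) z.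
  by rewrite rot_mid2 rot_mid2'; apply: ins_catC.
have mQ : c' :: A ++ d' :: (Y ++ X) =i X ++ c' :: A ++ d' :: Y.
  by move=> z; rewrite rot_mid !mem_cat orbC.
have mQ' : d' :: (Y ++ X) ++ c' :: A =i X ++ c' :: A ++ d' :: Y.
  by move=> z; rewrite -mQ -cat_cons mem_cat orbC -mem_cat.
have mS : d' :: (Y ++ X) ++ [:: c'] =i X ++ c' :: d' :: Y.
  by move=> z; rewrite rot_mid2 rot_mid2' !mem_cat orbC.
have outerE Q1 Q2 z : Q1 =i Q2 -> outer z Q1 -> outer z Q2.
  by move=> h; apply: outer_sub => q; rewrite h.
have con1 := odd_side_connected sP1; have con2 := odd_side_connected sP2r.
case: (split_outs ch con1 con2 mo pm') => pk.
  have [p1 p2 p3 p4 p5] := pk.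
  apply: (step _ (c' :: A ++ [:: d']) (X ++ c' :: d' :: Y) c' d') => //.
  - split=> z hz.
    + by apply/outQ/p1.
    + by apply/outQ/p2.
    + by apply/outQ/p3/outS.
    + case/outQ/p4: hz => h; [by left; left | by right; apply/outS |].
      left; right; exists (d', c'); first by rewrite mem_edges_mid1 // eqxx orbT.
      by rewrite /= osegC.
    + apply: (outerE _ _ _ mQ); apply: (pocket_outer ch pk).
      by apply: (outerE _ _ _ _ hz) => q; rewrite mS.
  - split.
      move=> e; rewrite mem_edges_mid1 // => /orP[h|/eqP->]; [left|right].
        by rewrite mem_edges_mid h.
      by rewrite /= osegC.
    move=> q hq; have [a ia am] := chord_near1 sQr An clr hq.
    by exists a => // y /am /= h /onQ.
  - move=> q; rewrite osegC => hq; have [b ob bm] := chord_near_out1 sQr' Bn clr' hq.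
    by exists b; [apply/outS | move=> y /bm /= h /onQ'].
  - move=> key iQ; exists (key c'), (key d'); left; split=> v hv.
      exact: incr_mid1 iQ hv.
    exact: incr_mid2 iQ hv.
  - by apply: IH sP2; rewrite -ltnS; apply: leq_trans s2 sz.
have [p1 p2 p3 p4 p5] := pk.
apply: (step _ (X ++ c' :: d' :: Y) (c' :: A ++ [:: d']) d' c') => //.
- split=> z hz.
  + by apply/outQ'/p1/insS.
  + by apply/outQ'/p2.
  + by apply/outQ'/p3.
  + case/outQ'/p4: hz => h; [by left; left; apply/insS | by right |].
    left; right; exists (c', d'); first by rewrite mem_edges_mid2 // eqxx orbT.
    by rewrite /= osegC.
  + by apply: (outerE _ _ _ mQ'); apply: (pocket_outer ch' pk).
- split.
    move=> e; rewrite mem_edges_mid2 // => /orP[h|/eqP->]; [left|right].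
      by rewrite mem_edges_mid h orbT.
    by rewrite /= osegC.
  move=> q hq; have [a ia am] := chord_near1 sQr' Bn clr' hq.
  by exists a; [apply/insS | move=> y /am /= h /onQ'].
- move=> q; rewrite osegC => hq; have [b ob bm] := chord_near_out1 sQr An clr hq.
  by exists b => // y /bm /= h /onQ.
- move=> key iQ; exists (key c'), (key d'); right; split=> v hv.
    exact: incr_mid1 iQ hv.
  exact: incr_mid2 iQ hv.
- by apply: IH sP1; rewrite -ltnS; apply: leq_trans s1 sz.
Qed.

(** An even point is not on [Q], so the lid is the only edge of the pocket along which it can look,
    and the lid is even. *)
Lemma pocket_view Q P c d x : cut_edges Q P c d -> (forall z, odd_side P z -> even_side Q z) ->
  (forall z, oseg c d z -> even_side Q z) -> even_side Q x -> view P x `<=` even_side Q.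
Proof.
move=> [ce _] h1 h2 [nx _] z [/h1 //|[e he [hx hz]]].
case: (ce e he) => [eQ|E]; last by apply: h2; rewrite -E.
by case: nx; exists e => //; apply: oseg_cseg.
Qed.

Lemma sees_le (W : set pt) (V : pt -> Prop) x k k' : (k' <= k)%N -> sees W V x k -> sees W V x k'.
Proof.
move=> h [r [u s hr]]; exists (take k' r); split.
- exact: take_uniq.
- by rewrite size_takel // s.
- by move=> v /mem_take; apply: hr.
Qed.

(** The two tangents from [x] touch [Q] at different vertices, since the vertices do not all lie on
    one line through [x]. *)
Lemma outer_sees Q x : simple_cycle Q -> outer x Q -> sees (even_side Q) (fun v => v \in Q) x 2.
Proof.
move=> sQ ox; have [u hu] := ox.
have [nx px] := outer_outs sQ ox.
have xQ : x \notin Q by apply/negP => /vertex_on_Q.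
have k1 : (1 : R) != 0 by apply/eqP; lra.
have k2 : (- 1 : R) != 0 by apply/eqP; lra.
have [a aQ ha] := tangent (simp_nnil sQ) k1 hu.
have [b bQ hb] := tangent (simp_nnil sQ) k2 hu.
have sub : {subset Q <= x :: Q} by move=> z zQ; rewrite inE zQ orbT.
have ca := tangent_clear k1 sub xQ aQ hu ha.
have cb := tangent_clear k2 sub xQ bQ hu hb.
have vis v : (forall q, oseg x v q -> ~ on Q q) -> oseg x v `<=` even_side Q.
  move=> cl z hz; split; first exact: cl.
  rewrite -(par_simp (x := x) sQ) // => q.
  case/cseg_cases => [->//|->|hq]; first exact: cl.
  apply: cl; case: hz hq => r hr -> [p hp ->]; rewrite lerp_lerp; exists (p * r) => //; nra.
exists [:: a; b]; split=> //.
  rewrite /= inE andbT; apply/eqP => E; subst b.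
  have xa : x != a by apply: contraNneq xQ => ->.
  have [z zQ /eqP dz] := noncollinear sQ xa.
  by have := (ha z zQ).1; have := (hb z zQ).1; lra.
by move=> v; rewrite !inE => /orP[] /eqP->; split=> //; apply: vis.
Qed.

Lemma outs_sees Q x : simple_cycle Q -> even_side Q x -> sees (even_side Q) (fun v => v \in Q) x 2.
Proof.
move=> sQ; move: Q sQ x; apply: outer_ind => [Q sQ h x /h|Q P S c d sQ sP sS st ce _ sP' sS' _ IH x ox].
  exact: outer_sees.
have [h1 h2 h3 h4 h5] := st.
case: (h4 x ox) => hx.
  apply: (@sees_le _ _ _ 3) => //; apply: sees_mono (inner_sees sP hx).
    exact: pocket_view ce h1 h2 ox.
  exact: mem_subseq.
apply: sees_mono (IH x hx); [exact: h3 | exact: mem_subseq].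
Qed.

(** Two points in the pocket share a vertex or get 3 + 3 from [inner_pair]; one in the pocket and
    one beyond it get 3 + 2; two points beyond it are left to [S]. *)
Lemma outs_pair key Q x y : simple_cycle Q -> incr key Q -> even_side Q x -> even_side Q y ->
  (outer x Q /\ outer y Q) \/ pair_sees key (even_side Q) (even_side Q) Q x y 5.
Proof.
move=> sQ; move: Q sQ x y; apply: outer_ind => [Q sQ h x y _ /h ? /h ?|Q P S c d sQ sP sS st ce _ sP' sS' sep IH x y iQ ox oy].
  by left.
have [h1 h2 h3 h4 h5] := st.
have [lo [hi lh]] := sep key iQ.
have PQ := mem_subseq sP'; have SQ := mem_subseq sS'.
have mS z : even_side S z -> sees (even_side Q) (fun v => v \in S) z 2.
  by move=> hz; apply: sees_mono (outs_sees sS hz).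
have mP z : even_side Q z -> odd_or_edge P z -> sees (even_side Q) (fun v => v \in P) z 3.
  by move=> oz hz; apply: sees_mono (inner_sees sP hz); first exact: pocket_view ce h1 h2 oz.
case: (h4 x ox) => hx; case: (h4 y oy) => hy.
- right; have := inner_pair sP (incr_sub sP' iQ) hx hy.
  move/(pair_sees_mono (pocket_view ce h1 h2 ox) (pocket_view ce h1 h2 oy) PQ).
  case=> [?|[l [k [k1 [k2 [hk a b e]]]]]]; first by left.
  by right; exists l, k, k1, k2; split=> //; apply: ltnW.
- right; right; exists lo, hi, 3%N, 2%N; split=> //.
  case: lh => -[l1 l2]; [left|right]; split.
  + by apply: sees_mono (mP x ox hx) => // v hv; split; [apply: PQ | apply: l1].
  + by apply: sees_mono (mS y hy) => // v hv; split; [apply: SQ | apply: l2].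
  + by apply: sees_mono (mP x ox hx) => // v hv; split; [apply: PQ | apply: l2].
  + by apply: sees_mono (mS y hy) => // v hv; split; [apply: SQ | apply: l1].
- right; right; exists lo, hi, 2%N, 3%N; split=> //.
  case: lh => -[l1 l2]; [right|left]; split.
  + by apply: sees_mono (mS x hx) => // v hv; split; [apply: SQ | apply: l2].
  + by apply: sees_mono (mP y oy hy) => // v hv; split; [apply: PQ | apply: l1].
  + by apply: sees_mono (mS x hx) => // v hv; split; [apply: SQ | apply: l1].
  + by apply: sees_mono (mP y oy hy) => // v hv; split; [apply: PQ | apply: l2].
- case: (IH x y (incr_sub sS' iQ) hx hy) => [[a b]|h].
    by left; split; apply: h5.
  by right; apply: pair_sees_mono h.
Qed.

(** A point of a pocket escapes through the lid and goes on as a point beyond it; once no lid is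
    left, a ray leads away. *)
Lemma outs_unbounded Q x M : simple_cycle Q -> even_side Q x -> exists2 y, link (even_side Q) x y & M < `|y.1|.
Proof.
move=> sQ; move: Q sQ x; apply: outer_ind => [Q sQ h x /h ox|Q P S c d sQ sP sS st ce co sP' sS' _ IH x ox].
  have [y hy hz] := outer_ray M ox; exists y => //.
  by apply: link_seg => z /hz; apply: outer_outs.
have [h1 h2 h3 h4 h5] := st.
have base z : even_side S z -> exists2 y, link (even_side Q) z y & M < `|y.1|.
  by move=> /IH[y l hy]; exists y => //; apply: link_mono l.
have [hx|/base //] := h4 x ox.
have off a m : oseg c d m -> cseg a m `<=` [set z | ~ on Q z] -> link (even_side Q) a m.
  move=> hm h; apply: link_seg => y hy; split; first exact: h.
  have [_ pm] := h2 m hm.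
  rewrite (par_simp (y := m) sQ) // => z hz; apply: h.
  exact: (cseg_sub hy (cseg_r _ _)).
have [m hm lm] : exists2 m, oseg c d m & link (even_side Q) x m.
  case: hx => [hx|[e he hx]].
    have hm : oseg c d (lerp c d (1 / 2)) by exists (1 / 2) => //; lra.
    have [a ia am] := ce.2 _ hm; exists (lerp c d (1 / 2)) => //.
    apply: link_trans (off _ _ hm am).
    exact: link_mono h1 (odd_side_connected sP hx ia).
  case: (ce.1 e he) => [eQ|E]; last by exists x; [rewrite -E | apply: link_refl].
  by case: ox => nx _; case: nx; exists e => //; apply: oseg_cseg.
have [b ob bm] := co m hm; have [y ly hy] := base b ob.
exists y => //; apply: link_trans lm _; apply: link_trans _ ly.
by apply: link_sym; apply: off.
Qed.

(** All points of the line through [x] parallel to its separating line are separated from [Q], and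
    likewise for [y]. A tilt makes the two lines intersect. *)
Lemma outer_link2 Q x y : simple_cycle Q -> outer x Q -> outer y Q ->
  exists2 q, cseg x q `<=` even_side Q & cseg q y `<=` even_side Q.
Proof.
move=> sQ [u hu] [v hv].
have out (w p : pt) : (forall z, z \in Q -> dot w p < dot w z) -> even_side Q p.
  by move=> h; apply: outer_outs => //; exists w.
have [v' hv' nd] : exists2 v', (forall z, z \in Q -> dot v' y < dot v' z) &
    u.1 * v'.2 - u.2 * v'.1 != 0.
  have [E|] := eqVneq (u.1 * v.2 - u.2 * v.1) 0; last by exists v.
  pose w : pt := (- u.2, u.1).
  have [|r r0 hr] := @tilt _ y v w Q; first by move=> z /hv; left.
  exists (comb v w r); first by apply: hr; lra.
  have [z zQ] : exists z, z \in Q.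
    by case: (Q) (simp_nnil sQ) => // z Q' _; exists z; rewrite mem_head.
  have N : 0 < u.1 ^+ 2 + u.2 ^+ 2.
    rewrite lt_neqAle addr_ge0 ?sqr_ge0 // andbT eq_sym paddr_eq0 ?sqr_ge0 // !sqrf_eq0.
    by apply/negP => /andP[/eqP E1 /eqP E2]; have := hu z zQ; rewrite /dot E1 E2; lra.
  have -> : u.1 * (comb v w r).2 - u.2 * (comb v w r).1 = r * (u.1 ^+ 2 + u.2 ^+ 2).
    rewrite -[RHS]add0r -E /comb /w /=; ring.
  by rewrite mulf_neq0 // gt_eqF.
pose a := dot u x; pose b := dot v' y.
pose D := u.1 * v'.2 - u.2 * v'.1.
(* Cramer's rule for the lines [dot u = a] and [dot v' = b]. *)
pose q : pt := ((a * v'.2 - u.2 * b) / D, (u.1 * b - a * v'.1) / D).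
have qu : dot u q = a by rewrite /dot /q /= /D; field.
have qv : dot v' q = b by rewrite /dot /q /= /D; field.
exists q => z [r hr ->].
  apply: (out u) => p /hu; rewrite dot_lerp qu /a; lra.
apply: (out v') => p /hv'; rewrite dot_lerp qv /b; lra.
Qed.

End Outer.

(** * Connected components and indices *)

Section Components.
Variable R : realType.
Local Notation pt := (R * R)%type.
Implicit Types (x y z : pt) (Q : seq pt).
Lemma lerp_cont (x y : R * R) : continuous (lerp x y : R -> R * R).
Proof.
move=> t.
have h (a b : R) : (1 - s) * a + s * b @[s --> t] --> (1 - t) * a + t * b.
  apply: cvgD.
    by apply: cvgM; [apply: cvgB; [exact: cvg_cst | exact: cvg_id] | exact: cvg_cst].
  by apply: cvgM; [exact: cvg_id | exact: cvg_cst].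
exact: cvg_pair (h _ _) (h _ _).
Qed.
Definition shear (r : R) (z : R * R) : R * R := (z.1 + r * z.2, z.2).
Lemma shear_cont r : continuous (shear r).
Proof.
move=> w.
have h : z.1 + r * z.2 @[z --> w] --> w.1 + r * w.2.
  by apply: cvgD; [exact: cvg_fst | apply: cvgM; [exact: cvg_cst | exact: cvg_snd]].
have h2 : z.2 @[z --> w] --> w.2 by exact: cvg_snd.
exact: cvg_pair h h2.
Qed.
Lemma cseg_compact (x y : R * R) : compact (cseg x y).
Proof.
have -> : cseg x y = lerp x y @` `[0, 1].
  apply/seteqP; split=> z [t]; rewrite /= ?in_itv /=; first by move=> h ->; exists t; rewrite //= in_itv.
  by move=> h <-; exists t.
apply: continuous_compact; last exact: segment_compact.
exact: continuous_subspaceT (@lerp_cont x y).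
Qed.
Lemma cseg_connected (x y : R * R) : @connected (R * R)%type (cseg x y).
Proof.
have -> : cseg x y = lerp x y @` `[0, 1].
  apply/seteqP; split=> z [t]; rewrite /= ?in_itv /=; first by move=> h ->; exists t; rewrite //= in_itv.
  by move=> h <-; exists t.
apply: connected_continuous_connected; first exact: segment_connected.
exact: continuous_subspaceT (@lerp_cont x y).
Qed.
Lemma cseg_closed (x y : R * R) : closed (cseg x y).
Proof. apply: compact_closed; [exact: norm_hausdorff | exact: cseg_compact]. Qed.

Lemma ball_cseg (x y z : R * R) r : ball x r y -> cseg x y z -> ball x r z.
Proof.
move=> [h1 h2] [t ht ->].
have aux (a b : R) : `|a - b| < r -> `|a - ((1 - t) * a + t * b)| < r.
  move=> h; have -> : a - ((1 - t) * a + t * b) = t * (a - b) by ring.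
  rewrite normrM ger0_norm; last lra.
  by have := normr_ge0 (a - b); nra.
by split; rewrite /ball /=; apply: aux.
Qed.

Lemma on_closed Q : closed (on Q).
Proof.
have -> : on Q = \big[setU/set0]_(e <- edges Q) cseg e.1 e.2.
  apply/seteqP; split=> z.
    by move=> [e he hz]; rewrite -bigcup_seq; exists e.
  by rewrite -bigcup_seq => -[e he hz]; exists e.
by apply: closed_bigsetU => e _; apply: cseg_closed.
Qed.

Lemma par_open Q k : simple_cycle Q -> open [set y | ~ on Q y /\ parity Q y = k].
Proof.
move=> sQ; rewrite openE => y [ny py].
have : nbhs y (~` on Q) by apply: open_nbhs_nbhs; split=> //; rewrite openC; apply: on_closed.
move/nbhs_ballP => [r r0 hr]; apply/nbhs_ballP; exists r => // z hz; split; first exact: hr.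
by rewrite -py; apply/esym/par_simp => // q hq; apply: hr; apply: ball_cseg hz hq.
Qed.

(** Both parity classes are open, so a connected set off [Q] lies in one of them. *)
Lemma component_par Q x y : simple_cycle Q -> @connected_component pt (~` on Q) x y -> parity Q y = parity Q x.
Proof.
move=> sQ [C [Cx CQ con] Cy].
have CE : C `&` [set z | ~ on Q z /\ parity Q z = parity Q x] = C.
  apply: con.
  - by exists x; split=> //; split=> //; apply: CQ.
  - by exists [set z | ~ on Q z /\ parity Q z = parity Q x] => //; apply: par_open.
  - exists (~` [set z | ~ on Q z /\ parity Q z = ~~ parity Q x]).
      by rewrite closedC; apply: par_open.
    apply/seteqP; split=> z [Cz].
      by move=> [nz pz]; split=> // -[_]; rewrite pz; case: (parity Q x).
    move=> h; split=> //; split; first exact: CQ.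
    have nz := CQ _ Cz; apply/eqP; apply: contrapT => ne; apply: h; split=> //.
    by move: ne; case: (parity Q z); case: (parity Q x).
by have : C y by []; rewrite -CE => -[_ []].
Qed.

Lemma link_component (A S : set pt) x y : S `<=` A -> A x -> link S x y ->
  @connected_component pt A x y.
Proof.
move=> SA Ax l.
(* [link_refl] holds for any point, even outside [A]; hence the case [x = y]. *)
suff H : forall x y, link S x y -> x = y \/ @connected_component pt A x y.
  by case: (H _ _ l) => // <-; apply: connected_component_refl.
move=> {x y Ax l} x y; elim=> {x y}.
- by move=> x; left.
- move=> x y h; right; apply: (connected_component_max (B := cseg x y)).
  + exact: cseg_l.
  + by move=> z /h /SA.
  + exact: cseg_connected.
  + exact: cseg_r.
- by move=> x y _ [->|h]; [left | right; apply: connected_component_sym].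
- move=> x y z _ [->//|h1] _ [<-|h2]; right => //.
  exact: connected_component_trans h1 h2.
Qed.

Lemma seg_component (A : set pt) x y : cseg x y `<=` A -> @connected_component pt A x y.
Proof. by move=> h; apply: link_component (link_seg h) => //; apply: h; apply: cseg_l. Qed.

Section Poly.
Variables (n : nat) (p : 'I_n -> pt).
Let Q := [seq p i | i <- enum 'I_n].

Lemma path_edges_zip (T : eqType) (c : T) s d : path_edges c s d = zip (c :: s) (rcons s d).
Proof. by elim: s c => //= x s IH c; rewrite IH. Qed.

Lemma size_vertices : size Q = n.
Proof. by rewrite size_map size_enum_ord. Qed.

Lemma nth_vertices x0 (i : 'I_n) : nth x0 Q i = p i.
Proof. by rewrite (nth_map i) ?size_enum_ord // nth_ord_enum. Qed.

Lemma succ_val (i : 'I_n) : val (succ_idx i) = (i.+1 %% n)%N.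
Proof. by case: n i => [[]//|m] i; rewrite /succ_idx /= inordK // ltn_mod. Qed.

Lemma edges_vertices e : e \in edges Q <-> exists i, e = (p i, p (succ_idx i)).
Proof.
have E x0 : forall i, (i < size Q)%N -> nth (x0, x0) (edges Q) i =
    (nth x0 Q i, nth x0 Q (i.+1 %% size Q)).
  case: (Q) => // c s i hi; rewrite /= path_edges_zip nth_zip; last by rewrite /= size_rcons.
  congr pair; rewrite nth_rcons; move: hi; rewrite /= ltnS leq_eqVlt => /orP[/eqP->|hi].
    by rewrite ltnn eqxx modnn.
  by rewrite hi modn_small.
have S : size (edges Q) = size Q by rewrite -[RHS](congr1 size (map_fst_edges Q)) size_map.
split.
  move=> he; have x0 := e.1; have := nth_index (x0, x0) he.
  have hi : (index e (edges Q) < size Q)%N by rewrite -S index_mem.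
  rewrite E // => <-; rewrite size_vertices in hi *.
  pose i := Ordinal hi; exists i.
  by rewrite -(nth_vertices x0 i) -(nth_vertices x0 (succ_idx i)) succ_val.
case=> i ->; have x0 := p i.
have hi : (i < size Q)%N by rewrite size_vertices.
have := E x0 i hi; rewrite [X in (_ %% X)%N]size_vertices -succ_val !nth_vertices => <-.
by rewrite mem_nth // S.
Qed.

Lemma polygon_on : polygon p = on Q.
Proof.
apply/seteqP; split=> z.
  by move=> [i _ hz]; exists (p i, p (succ_idx i)) => //; apply/edges_vertices; exists i.
by move=> [e /edges_vertices[i ->] hz]; exists i.
Qed.

Lemma mem_vertices v : v \in Q -> exists i, v = p i.
Proof. by case/mapP => i _ ->; exists i. Qed.

Hypothesis sp : simple_polygon p.
Hypothesis gen : forall i j, (p i).1 = (p j).1 -> i = j.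

Lemma vertices_simple_cycle : simple_cycle Q.
Proof.
have [n3 [pinj h]] := sp; split.
- by rewrite size_vertices.
- rewrite -map_comp map_inj_uniq ?enum_uniq //; exact: gen.
- move=> e e' /edges_vertices[i ->] /edges_vertices[j ->] ne z hi hj.
  have ij : i != j by apply: contraNneq ne => ->.
  by case: (h i j ij z hi hj) => -[-> ->]; split; [right|left|left|right].
Qed.

Let key v := index v Q.

Lemma index_vertex i : key (p i) = i :> nat.
Proof.
have [_ [pinj _]] := sp.
by rewrite /key index_map // index_enum_ord.
Qed.

Lemma vertices_incr : incr key Q.
Proof.
have uQ := simp_uniq vertices_simple_cycle.
rewrite /incr; suff -> : map key Q = iota 0 (size Q) by apply: iota_ltn_sorted.
case E : Q => [//|x0 s]; rewrite -E.
apply: (@eq_from_nth _ 0%N); first by rewrite size_map size_iota.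
move=> i; rewrite size_map => hi.
by rewrite (nth_map x0) // nth_iota // /key index_uniq.
Qed.

(** An even point is linked to points of arbitrarily large abscissa, so its component is
    unbounded. *)
Lemma int_ins x : int_poly p x -> odd_side Q x.
Proof.
rewrite /int_poly /= polygon_on => -[nx [M hM]]; split=> //.
apply/negPn/negP => px.
have [y ly hy] := outs_unbounded M vertices_simple_cycle (conj nx px).
have : @connected_component pt (~` on Q) x y.
  by apply: link_component ly => // z [].
by move/hM => [h _]; move: (lt_le_trans hy h); rewrite ltxx.
Qed.

(** An unbounded component leaves the box of the vertices; a point outside the box is separated from
    [Q] by a side of the box. *)
Lemma ext_outs x : ext_poly p x -> even_side Q x.
Proof.
rewrite /ext_poly /= polygon_on => -[nx nb]; split=> //.
have [M hM] := bound Q.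
have [y [cy hy]] : exists y, @connected_component pt (~` on Q) x y /\ ~ (`|y.1| <= M /\ `|y.2| <= M).
  apply: contrapT => h; apply: nb; exists M => z cz; apply: contrapT => hz.
  by apply: h; exists z.
rewrite -(component_par vertices_simple_cycle cy) outer_par //; first exact: vertices_simple_cycle.
have [h|h] : M < `|y.1| \/ M < `|y.2|.
  have [h1|h1] := lerP `|y.1| M; last by left.
  by have [h2|h2] := lerP `|y.2| M; [case: hy | right].
- have [h0|h0] := lerP 0 y.1.
    exists (-1, 0) => z /hM[hz _]; rewrite /dot /=; move: h hz.
    by rewrite (ger0_norm h0) ler_norml => ? /andP[]; lra.
  exists (1, 0) => z /hM[hz _]; rewrite /dot /=; move: h hz.
  by rewrite (ltr0_norm h0) ler_norml => ? /andP[]; lra.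
- have [h0|h0] := lerP 0 y.2.
    exists (0, -1) => z /hM[_ hz]; rewrite /dot /=; move: h hz.
    by rewrite (ger0_norm h0) ler_norml => ? /andP[]; lra.
  exists (0, 1) => z /hM[_ hz]; rewrite /dot /=; move: h hz.
  by rewrite (ltr0_norm h0) ler_norml => ? /andP[]; lra.
Qed.

Lemma int_same x y : @connected_component pt (~` polygon p) x y -> int_poly p x -> int_poly p y.
Proof.
move=> c; rewrite /int_poly /= (same_connected_component c) => -[_ h]; split=> //.
exact: (connected_component_sub (connected_component_sym (connected_component_sym c))).
Qed.

Lemma ext_same x y : @connected_component pt (~` polygon p) x y -> ext_poly p x -> ext_poly p y.
Proof.
move=> c; rewrite /ext_poly /= (same_connected_component c) => -[_ h]; split=> //.
exact: (connected_component_sub (connected_component_sym (connected_component_sym c))).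
Qed.

Lemma oseg_component x v z : ~ on Q x -> oseg x v `<=` ~` on Q -> oseg x v z ->
  @connected_component pt (~` polygon p) x z.
Proof.
move=> nx h hz; rewrite polygon_on; apply: seg_component => q.
case/cseg_cases => [->//|->|hq]; first exact: h.
apply: h; case: hz hq => r hr -> [t ht ->]; rewrite lerp_lerp; exists (t * r) => //; nra.
Qed.

Lemma int_oseg x v : int_poly p x -> oseg x v `<=` ~` on Q -> oseg x v `<=` int_poly p.
Proof.
move=> ix h z hz; apply: (int_same _ ix); apply: oseg_component h hz.
by have [] := int_ins ix.
Qed.

Lemma ext_oseg x v : ext_poly p x -> oseg x v `<=` ~` on Q -> oseg x v `<=` ext_poly p.
Proof.
move=> ix h z hz; apply: (ext_same _ ix); apply: oseg_component h hz.
by have [] := ext_outs ix.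
Qed.

(** A point off [Q] lies on no edge, so the second clause of [view] is void. *)
Lemma ins_view x : odd_side Q x -> view Q x `<=` ~` on Q.
Proof.
move=> [nx _] z [[]//|[e he [hx _]]].
by case: nx; exists e => //; apply: oseg_cseg.
Qed.

End Poly.
End Components.

(** * Counting edges between two groups of vertices on a cycle *)

Lemma extremal (T : eqType) (f : T -> nat) (s : seq T) : s != [::] ->
  exists a b, [/\ a \in s, b \in s & forall z, z \in s -> (f a <= f z <= f b)%N].
Proof.
elim: s => // x [|y s] IH _; first by exists x, x; split; rewrite ?mem_head // => z; rewrite inE => /eqP->; rewrite leqnn.
have [//|a [b [ha hb h]]] := IH.
exists (if (f a <= f x)%N then a else x), (if (f x <= f b)%N then b else x).
have xs z : z \in y :: s -> z \in x :: y :: s by move=> hz; rewrite inE hz orbT.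
split; first by case: ifP => _; [apply: xs | apply: mem_head].
  by case: ifP => _; [apply: xs | apply: mem_head].
move=> z; rewrite inE => /orP[/eqP->|/h /andP[h1 h2]].
  by case: (leqP (f a) (f x)); case: (leqP (f x) (f b)) => k1 k2; lia.
by case: (leqP (f a) (f x)); case: (leqP (f x) (f b)) => k1 k2; lia.
Qed.

Lemma size_between (T : eqType) (f : T -> nat) (s : seq T) (a b : nat) : uniq s ->
  {in s &, injective f} -> (forall z, z \in s -> (a <= f z <= b)%N) -> (size s <= b.+1 - a)%N.
Proof.
move=> us fi h; rewrite -(size_map f) -[X in (_ <= X)%N](size_iota a).
apply: uniq_leq_size; first by rewrite map_inj_in_uniq.
by move=> k /mapP[z /h hz ->]; rewrite mem_iota; lia.
Qed.

Definition apart_idx (n i j k : nat) := let d := ((i + n - j) %% n)%N in (minn d (n - d) <= k)%N.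

Lemma apart_of n i j a k : (i < n)%N -> (j < n)%N -> (i + a = j \/ i + a = j + n)%N -> (a <= k)%N ->
  apart_idx n i j k /\ apart_idx n j i k.
Proof.
have md x y : (x < n)%N -> (y < n)%N -> ((x + n - y) %% n = if (y <= x)%N then x - y else x + n - y)%N.
  move=> hx hy; case: leqP => c; last by rewrite modn_small //; lia.
  by rewrite (_ : x + n - y = n + (x - y))%N ?modnDl ?modn_small //; lia.
by move=> hi hj h ak; rewrite /apart_idx /= !md //; split; [case: (leqP j i) | case: (leqP i j)] => c; lia.
Qed.

(** [k] distinct indices span at least [k - 1] edges. The two groups use up [K - 2] edges of the
    cycle, and the two gaps between them share the rest. *)
Lemma apart_pair (T : eqType) (f : T -> nat) (n lo hi K : nat) (r1 r2 : seq T) :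
  uniq r1 -> uniq r2 -> {in r1 &, injective f} -> {in r2 &, injective f} ->
  (1 < size r1)%N -> (1 < size r2)%N -> (K <= size r1 + size r2)%N ->
  (forall v, v \in r1 -> (lo <= f v <= hi)%N /\ (f v < n)%N) ->
  (forall v, v \in r2 -> ((f v <= lo) || (hi <= f v))%N /\ (f v < n)%N) ->
  exists v w, [/\ v \in r1, w \in r2, apart_idx n (f v) (f w) (n - (K - 2))./2 &
     apart_idx n (f w) (f v) (n - (K - 2))./2].
Proof.
move=> u1 u2 i1 i2 s1 s2 hK h1 h2.
have n1 : r1 != [::] by case: (r1) s1.
have n2 : r2 != [::] by case: (r2) s2.
(* The cycle is unrolled: indices below [hi] are shifted by [n], so that the values of [g] run from
   at least [f b] to at most [f a + n]. *)
pose g v := if (hi <= f v)%N then f v else (f v + n)%N.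
have [a [b [ar br hab]]] := extremal f n1.
have [c [d [cr dr hcd]]] := extremal g n2.
have := size_between u1 i1 hab => z1.
have ab : (f a < f b)%N by lia.
have [ha ha'] := h1 a ar; have [hb hb'] := h1 b br.
have ig : {in r2 &, injective g}.
  move=> v w hv hw; have [hv1 hv2] := h2 v hv; have [hw1 hw2] := h2 w hw.
  rewrite /g => E; apply: i2 => //; move: E hv1 hv2 hw1 hw2; clear.
  by case: (leqP hi (f v)); case: (leqP hi (f w)); lia.
have := size_between u2 ig hcd => z2.
have [hc hc'] := h2 c cr; have [hd hd'] := h2 d dr.
have gc : (g c = f c \/ g c = f c + n)%N by rewrite /g; case: (leqP hi (f c)); [left|right].
have gd : (g d = f d \/ g d = f d + n)%N by rewrite /g; case: (leqP hi (f d)); [left|right].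
have gch : (f b <= g c)%N.
  by rewrite /g; case: (leqP hi (f c)) => k; [apply: leq_trans k; case/andP: hb | lia].
have gdl : (g d <= f a + n)%N.
  rewrite /g; case: (leqP hi (f d)) => k; first by apply: leq_trans (ltnW hd') (leq_addl _ _).
  rewrite leq_add2r; case/andP: ha => ha1 _; apply: leq_trans ha1.
  by move: hd; rewrite [(hi <= _)%N]leqNgt k orbF.
clear hab hcd h1 h2 ha hb hc hd i1 i2 ig u1 u2.
have [k1|k1] := leqP (g c - f b) (n - (K - 2))./2.
  have E : (f b + (g c - f b) = f c \/ f b + (g c - f b) = f c + n)%N by lia.
  by exists b, c; have [x y] := apart_of hb' hc' E k1.
have k2 : (n + f a - g d <= (n - (K - 2))./2)%N by lia.
have E : (f d + (n + f a - g d) = f a \/ f d + (n + f a - g d) = f a + n)%N by lia.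
by exists a, d; have [x y] := apart_of hd' ha' E k2.
Qed.

(** * Shearing to general position *)

Section Transport.
Variable R : realType.
Local Notation pt := (R * R)%type.
Implicit Types (x y z : pt) (Q : seq pt).

Section Generic.
Variables (n : nat) (p : 'I_n -> pt).
Hypothesis sp : simple_polygon p.
Hypothesis gen : forall i j, (p i).1 = (p j).1 -> i = j.
Let Q := [seq p i | i <- enum 'I_n].
Let key v := index v Q.

Lemma edges_apart_refl (i : 'I_n) k : edges_apart_le i i k.
Proof. by rewrite /edges_apart_le /= addnC addnK modnn min0n. Qed.

Lemma pair_apart Wx Wy x y K : pair_sees key Wx Wy Q x y K ->
  exists i j : 'I_n, [/\ oseg x (p i) `<=` Wx, oseg y (p j) `<=` Wy &
    edges_apart_le i j (n - (K - 2))./2].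
Proof.
have keyE i : key (p i) = i by apply: index_vertex.
have kinj : {in Q &, injective key}.
  by move=> v w /mem_vertices[i ->] /mem_vertices[j ->]; rewrite !keyE => /ord_inj ->.
have klt v : v \in Q -> (key v < n)%N by move=> /mem_vertices[i ->]; rewrite keyE.
case=> [[v /mem_vertices[i ->] [h1 h2]]|[lo [hi [k1 [k2 [hK s1 s2 h]]]]]].
  by exists i, i; split=> //; apply: edges_apart_refl.
have go Wu Wv u v k k' : (K <= k + k')%N -> (1 < k)%N -> (1 < k')%N ->
    sees Wu (insideI key Q lo hi) u k -> sees Wv (outsideI key Q lo hi) v k' ->
    exists i j : 'I_n, [/\ oseg u (p i) `<=` Wu, oseg v (p j) `<=` Wv,
     edges_apart_le i j (n - (K - 2))./2 & edges_apart_le j i (n - (K - 2))./2].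
  move=> hk a1 a2 [r1 [u1 e1 c1]] [r2 [u2 e2 c2]].
  have sub1 : {subset r1 <= Q} by move=> w /c1[[]].
  have sub2 : {subset r2 <= Q} by move=> w /c2[[]].
  have [|||||||w [w' [hw hw' ap1 ap2]]] := @apart_pair _ key n lo hi K r1 r2 u1 u2.
  - by move=> ? ? /sub1 ? /sub1; apply: kinj.
  - by move=> ? ? /sub2 ? /sub2; apply: kinj.
  - by rewrite e1.
  - by rewrite e2.
  - by rewrite e1 e2.
  - by move=> w hw; have [[wQ hI] _] := c1 w hw; split=> //; apply: klt.
  - by move=> w hw; have [[wQ hI] _] := c2 w hw; split=> //; apply: klt.
  have [[wQ _] o1] := c1 w hw; have [[wQ' _] o2] := c2 w' hw'.
  have [i Ei] := mem_vertices wQ; have [j Ej] := mem_vertices wQ'; subst w w'.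
  by rewrite !keyE in ap1 ap2; exists i, j.
case: h => -[h1 h2].
  by have [i [j [a b c d]]] := go _ _ _ _ _ _ hK s1 s2 h1 h2; exists i, j.
rewrite addnC in hK.
by have [i [j [a b c d]]] := go _ _ _ _ _ _ hK s2 s1 h2 h1; exists j, i.
Qed.

Lemma theorem_generic :
  ((4 <= n)%N -> forall a b : pt, int_poly p a -> int_poly p b ->
     exists i j : 'I_n,
       oseg a (p i) `<=` int_poly p /\ oseg b (p j) `<=` int_poly p /\
       edges_apart_le i j (n./2 - 2)%N) /\
  ((5 <= n)%N -> forall a b : pt, ext_poly p a -> ext_poly p b ->
     (exists i j : 'I_n,
       oseg a (p i) `<=` ext_poly p /\ oseg b (p j) `<=` ext_poly p /\
       edges_apart_le i j (n.+1./2 - 2)%N)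
     \/ link_dist_le (ext_poly p) a b 3).
Proof.
have sQ := vertices_simple_cycle sp gen; have iQ := vertices_incr sp gen.
split=> n4 a b ha hb.
  have ia := int_ins sp gen ha; have ib := int_ins sp gen hb.
  have [i [j [h1 h2 h3]]] := pair_apart (inner_pair sQ iQ (or_introl ia) (or_introl ib)).
  exists i, j; split; [|split].
  - by apply: int_oseg => // z /h1; apply: ins_view.
  - by apply: int_oseg => // z /h2; apply: ins_view.
  - by have <- : ((n - (6 - 2))./2 = n./2 - 2)%N by lia.
have oa := ext_outs sp gen ha; have ob := ext_outs sp gen hb.
have outsC : even_side Q `<=` ~` on Q by move=> z [].
case: (outs_pair sQ iQ oa ob) => [[ua ub]|h]; [right | left].
  have [q h1 h2] := outer_link2 sQ ua ub.
  (* One bend at [q]: two segments, within the allowed three. *)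
  exists [:: q; b]; split=> //; split=> //=; split; [|split=> //].
    move=> z hz; apply: (ext_same _ ha); apply: seg_component => w hw.
    rewrite polygon_on; apply/outsC/h1; exact: (cseg_sub (cseg_l _ _) hz hw).
  move=> z hz; apply: (ext_same _ hb); apply: seg_component => w hw.
  rewrite polygon_on; apply/outsC/h2; exact: (cseg_sub (cseg_r _ _) hz hw).
have [i [j [h1 h2 h3]]] := pair_apart h.
exists i, j; split; [|split].
- by apply: ext_oseg => // z /h1 /outsC.
- by apply: ext_oseg => // z /h2 /outsC.
- by have <- : ((n - (5 - 2))./2 = n.+1./2 - 2)%N by lia.
Qed.

End Generic.

Lemma shear_lerp (r : R) x y t : shear r (lerp x y t) = lerp (shear r x) (shear r y) t.
Proof. by apply: pt_eq; rewrite /shear /lerp /=; ring. Qed.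

Lemma shearK (r : R) : cancel (shear r) (shear (- r)).
Proof. by move=> z; apply: pt_eq; rewrite /shear /=; ring. Qed.
Lemma shearNK (r : R) : cancel (shear (- r)) (shear r).
Proof. by move=> z; apply: pt_eq; rewrite /shear /=; ring. Qed.

Lemma shear_cseg (r : R) x y z : cseg (shear r x) (shear r y) (shear r z) <-> cseg x y z.
Proof.
split=> -[t ht E]; exists t => //; last by rewrite E shear_lerp.
by apply: (can_inj (shearK r)); rewrite E shear_lerp.
Qed.

Lemma shear_oseg (r : R) x y z : oseg (shear r x) (shear r y) (shear r z) <-> oseg x y z.
Proof.
split=> -[t ht E]; exists t => //; last by rewrite E shear_lerp.
by apply: (can_inj (shearK r)); rewrite E shear_lerp.
Qed.

Section Shear.
Variable n : nat.
Implicit Types p : 'I_n -> pt.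

Lemma shear_polygon (r : R) p z : polygon (shear r \o p) (shear r z) <-> polygon p z.
Proof. by split=> -[i _ h]; exists i => //; apply/(shear_cseg r); exact: h. Qed.

Lemma shear_simple (r : R) p : simple_polygon p -> simple_polygon (shear r \o p).
Proof.
move=> [n3 [pi h]]; split=> //; split.
  exact: inj_comp (can_inj (shearK r)) pi.
move=> i j ij x; rewrite -(shearNK r x) => /shear_cseg h1 /shear_cseg h2.
case: (h i j ij _ h1 h2) => -[-> e]; [left|right]; split=> //; by rewrite e.
Qed.

Lemma shear_component (r : R) p x y : @connected_component pt (~` polygon p) x y ->
  @connected_component pt (~` polygon (shear r \o p)) (shear r x) (shear r y).
Proof.
move=> [C [Cx CP con] Cy]; exists (shear r @` C); last by exists y.
split; first by exists x.
  by move=> _ [z Cz <-] /shear_polygon; apply: CP.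
apply: connected_continuous_connected con _.
exact: continuous_subspaceT (@shear_cont R r).
Qed.

Lemma shear_invol (r : R) p : shear (- r) \o (shear r \o p) = p.
Proof. by apply/funext => i /=; rewrite shearK. Qed.

Lemma shear_bounded (r : R) p x :
  Defs.bounded_set (@connected_component pt (~` polygon p) x) ->
  Defs.bounded_set (@connected_component pt (~` polygon (shear r \o p)) (shear r x)).
Proof.
move=> [M hM]; exists (M + `|r| * M) => z /(shear_component (- r)).
rewrite shear_invol shearK => /hM [] /= h1 h2.
have M0 : 0 <= M by apply: le_trans h2.
have rM : 0 <= `|r| * M by rewrite mulr_ge0.
split; last by lra.
have -> : z.1 = (z.1 + - r * z.2) + r * z.2 by ring.
apply: le_trans (ler_normD _ _) _; apply: lerD => //.
by rewrite normrM ler_wpM2l.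
Qed.

Lemma shear_boundedE (r : R) p x :
  Defs.bounded_set (@connected_component pt (~` polygon (shear r \o p)) (shear r x)) <->
  Defs.bounded_set (@connected_component pt (~` polygon p) x).
Proof.
split; last exact: shear_bounded.
by move/(shear_bounded (- r)); rewrite shear_invol shearK.
Qed.

Lemma shear_int (r : R) p x : int_poly (shear r \o p) (shear r x) <-> int_poly p x.
Proof.
by split=> -[h1 h2]; split; try (by move/shear_polygon: h1); try (by apply/shear_boundedE; exact: h2);
 try (by move/shear_polygon); move/shear_boundedE: h2.
Qed.

Lemma shear_ext (r : R) p x : ext_poly (shear r \o p) (shear r x) <-> ext_poly p x.
Proof.
split=> -[h1 h2]; split.
- by move/(shear_polygon r).
- by move/(shear_boundedE r).
- by move/(shear_polygon r).
- by move/(shear_boundedE r).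
Qed.

Lemma shear_path (r : R) p a (s : seq pt) : poly_path_in (ext_poly (shear r \o p)) (shear r a) s ->
  poly_path_in (ext_poly p) a [seq shear (- r) q | q <- s].
Proof.
elim: s a => //= q s IH a [h1 h2]; split; last by apply: IH; rewrite shearNK.
by move=> z hz; apply/(shear_ext r)/h1; rewrite -{1}(shearNK r q); apply/shear_cseg.
Qed.

(** Two vertices of different heights get equal abscissae for a single value of [r], and the chosen
    [r] exceeds all these values; vertices of equal height keep their distance. *)
Lemma generic_shear p : injective p ->
  exists r : R, forall i j, (shear r (p i)).1 = (shear r (p j)).1 -> i = j.
Proof.
move=> pinj.
pose bad (k : 'I_n * 'I_n) : R := ((p k.2).1 - (p k.1).1) / ((p k.1).2 - (p k.2).2).
exists (1 + \sum_k `|bad k|) => i j; rewrite /shear /= => E.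
have [e2|n2] := eqVneq (p i).2 (p j).2.
  by apply: pinj; apply: pt_eq => //; rewrite e2 in E; lra.
have nz : (p i).2 - (p j).2 != 0 by rewrite subr_eq0.
have : 1 + \sum_k `|bad k| = bad (i, j).
  by rewrite /bad /=; apply: (mulIf nz); rewrite divfK //; lra.
have : `|bad (i, j)| <= \sum_k `|bad k|.
  by rewrite (bigD1 (i, j)) //= lerDl sumr_ge0.
have := ler_norm (bad (i, j)); move: (\sum_k _) (bad _) => S b h1 h2 h3; exfalso.
by clear -h1 h2 h3; lra.
Qed.

End Shear.
End Transport.

Theorem theorem4p2 (R : realType) (n : nat) (p : 'I_n -> pt R) :
  simple_polygon p ->
  ((4 <= n)%N -> forall a b : pt R, int_poly p a -> int_poly p b ->
     exists i j : 'I_n,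
       oseg a (p i) `<=` int_poly p /\ oseg b (p j) `<=` int_poly p /\
       edges_apart_le i j (n./2 - 2)%N) /\
  ((5 <= n)%N -> forall a b : pt R, ext_poly p a -> ext_poly p b ->
     (exists i j : 'I_n,
       oseg a (p i) `<=` ext_poly p /\ oseg b (p j) `<=` ext_poly p /\
       edges_apart_le i j (n.+1./2 - 2)%N)
     \/ link_dist_le (ext_poly p) a b 3).
Proof.
move=> sp; have [_ [pinj _]] := sp.
have [r gen] := generic_shear pinj.
have [Hi He] := theorem_generic (shear_simple r sp) gen.
split=> hn a b ha hb.
  have [i [j [h1 [h2 h3]]]] := Hi hn _ _ ((shear_int r p a).2 ha) ((shear_int r p b).2 hb).
  exists i, j; split; [|split=> //].
    by move=> z hz; apply/(shear_int r)/h1/shear_oseg.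
  by move=> z hz; apply/(shear_int r)/h2/shear_oseg.
have [[i [j [h1 [h2 h3]]]]|[s [hs [hl hp]]]] :=
    He hn _ _ ((shear_ext r p a).2 ha) ((shear_ext r p b).2 hb); [left | right].
  exists i, j; split; [|split=> //].
    by move=> z hz; apply/(shear_ext r)/h1/shear_oseg.
  by move=> z hz; apply/(shear_ext r)/h2/shear_oseg.
exists [seq shear (- r) q | q <- s]; split; first by rewrite size_map.
split; last exact: shear_path.
by rewrite -{1}(shearK r a) last_map hl shearK.
Qed.
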